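(* Let $S$ be an infinite discrete weakly cancellative semigroup, $\omega$ a weight on $S$, and suppose $\mathcal A=l^1(S,\omega)$ is unital with unit $e_{\mathcal A}$. Then $\mathcal A$ is Connes-amenable with respect to the predual $c_0(S)$ if and only if there exists $M\in l^\infty(S\times S)'$ such that: (1) $\langle M,(f_{gh}\Omega(g,h))_{(g,h)\in S\times S}\rangle=\langle f,e_{\mathcal A}\rangle$ for every $f=(f_g)\in c_0(S)$; (2) $\langle M,(f(hk,g)\Omega(h,k)-f(h,kg)\Omega(k,g))_{(g,h)\in S\times S}\rangle=0$ for every $k\in S$ and every bounded $f:S\times S\to\mathbb C$ such that: for each fixed $s\in S$ both $f(s,\cdot)$ and $f(\cdot,s)$ belong to $c_0(S)$; and for every sequence $(k_n)$ of distinct elements of $S$ and every sequence $((g_m,h_m))$ of distinct elements of $S\times S$ for which the repeated limits $\lim_n\lim_m f(h_m,k_ng_m)$, $\lim_n\lim_m\Omega(k_n,g_m)$, $\lim_n\lim_m f(h_mk_n,g_m)$, $\lim_n\lim_m\Omega(h_m,k_n)$ all exist, at least one of the first two and at least one of the last two is zero.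
   Context: Weight: $\omega:S\to(0,\infty)$, $\omega(st)\le\omega(s)\omega(t)$; $\Omega(g,h)=\omega(gh)\omega(g)^{-1}\omega(h)^{-1}$; $l^1(S,\omega)$ is $l^1(S)$ with $\delta_g\star\delta_h=\Omega(g,h)\delta_{gh}$, dual $l^\infty(S)$ with $\langle f,\delta_g\rangle=f_g$; since $S$ is weakly cancellative ($t\mapsto st$, $t\mapsto ts$ finite-to-one), $c_0(S)$ is a predual making $\mathcal A$ a dual Banach algebra. $(\mathcal A\hat\otimes\mathcal A)'=l^\infty(S\times S)$, where the entry at $(g,h)$ pairs with $\delta_g\otimes\delta_h$. Connes-amenability of a dual Banach algebra $(\mathcal A,\mathcal A_* )$: every $\sigma(\mathcal A,\mathcal A_* )$–$\sigma(E',E)$ continuous derivation $\mathcal A\to E'$ is inner, for every Banach bimodule $E$ such that $a\mapsto a\cdot\mu,\ \mu\cdot a$ are $\sigma(\mathcal A,\mathcal A_* )$–$\sigma(E',E)$ continuous for each $\mu\in E'$. *)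

(* Defs.v *)
From HB Require Import structures.
From mathcomp Require Import all_boot all_algebra finmap.
From mathcomp Require Import all_classical all_reals all_analysis.
From mathcomp Require Import complex.
Import Num.Theory GRing.Theory numFieldNormedType.Exports.
Set Implicit Arguments. Unset Strict Implicit. Unset Printing Implicit Defensive.
Local Open Scope classical_set_scope.
Local Open Scope complex_scope.
Local Open Scope ring_scope.

Definition totally {I : choiceType} : set_system {fset I} :=
  filter_from setT (fun A => [set B | (A `<=` B)%fset]).

Definition partial_sum {I : choiceType} {K : numFieldType} (x : I -> K)
  (A : {fset I}) : K := \sum_(i : A) x (val i).

Definition usum {I : choiceType} {K : numFieldType} (x : I -> K) : K :=
  lim (partial_sum x @ totally).

Definition abs_summable {I : choiceType} {K : numFieldType} (x : I -> K) :=
  exists M : K, forall J : {fset I}, partial_sum (fun i => `|x i|) J <= M.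

Definition rep_lim {K : numFieldType} (x : nat -> nat -> K) (L : K) :=
  exists l : nat -> K, (forall n, x n @ \oo --> l n) /\ l @ \oo --> L.

Section L1.
Variables (R : realType) (S : choiceType) (mul : S -> S -> S) (om : S -> R).
Local Notation C := R[i].

Definition Omega (g h : S) : C := (om (mul g h) / (om g * om h))%:C.

Definition weight := (forall s, 0 < om s) /\
  (forall s t, om (mul s t) <= om s * om t).

Definition weakly_cancellative := forall s t : S,
  finite_set [set u | mul s u = t] /\ finite_set [set u | mul u s = t].

Definition l1 (a : S -> C) := abs_summable a.
Definition l1norm (a : S -> C) : C := usum (fun g => `|a g|).

(* the product of l^1(S,omega): delta_g * delta_h = Omega(g,h) delta_{gh} *)
Definition conv (a b : S -> C) : S -> C := fun s =>
  usum (fun p : S * S => if mul p.1 p.2 == s then a p.1 * b p.2 * Omega p.1 p.2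
                         else 0).

Definition addf (a b : S -> C) : S -> C := fun g => a g + b g.
Definition sclf (c : C) (a : S -> C) : S -> C := fun g => c * a g.

Definition is_unit (e : S -> C) :=
  l1 e /\ forall a, l1 a -> conv e a = a /\ conv a e = a.

Definition c0 {T : choiceType} (f : T -> C) :=
  forall eps : R, 0 < eps -> finite_set [set g | eps%:C <= `|f g|].

Definition pair (f a : S -> C) : C := usum (fun g => f g * a g).

(* sigma(A, c_0(S))-continuity of a map phi : A -> C (continuity at every
   point of A for the weak topology given by the seminorms |<f,.>|, f in c_0) *)
Definition wcont (phi : (S -> C) -> C) :=
  forall a0, l1 a0 -> forall eps : R, 0 < eps ->
  exists (F : seq (S -> C)) (delta : R), 0 < delta /\
    (forall f, f \in F -> c0 f) /\
    forall a, l1 a ->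
      (forall f, f \in F -> `|pair f (fun g => a g - a0 g)| < delta%:C) ->
      `|phi a - phi a0| < eps%:C.

(* sigma(A,c_0)-sigma(E',E) continuity of Phi : A -> E'
   (E' carries the initial topology of the evaluations at points of E) *)
Definition wstar_cont {E : Type} (Phi : (S -> C) -> E -> C) :=
  forall x : E, wcont (fun a => Phi a x).

Section Module.
Variable E : completeNormedModType C.

Definition dualE (mu : E -> C) :=
  (forall x y, mu (x + y) = mu x + mu y) /\
  (forall (c : C) x, mu (c *: x) = c * mu x) /\
  exists K : R, forall x, `|mu x| <= K%:C * `|x|.

Definition banach_bimodule (lm : (S -> C) -> E -> E) (rm : E -> (S -> C) -> E) :=
  (forall a b x, l1 a -> l1 b -> lm (addf a b) x = lm a x + lm b x) /\
  (forall (c : C) a x, l1 a -> lm (sclf c a) x = c *: lm a x) /\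
  (forall a x y, l1 a -> lm a (x + y) = lm a x + lm a y) /\
  (forall (c : C) a x, l1 a -> lm a (c *: x) = c *: lm a x) /\
  (forall a b x, l1 a -> l1 b -> rm x (addf a b) = rm x a + rm x b) /\
  (forall (c : C) a x, l1 a -> rm x (sclf c a) = c *: rm x a) /\
  (forall a x y, l1 a -> rm (x + y) a = rm x a + rm y a) /\
  (forall (c : C) a x, l1 a -> rm (c *: x) a = c *: rm x a) /\
  (forall a b x, l1 a -> l1 b -> lm (conv a b) x = lm a (lm b x)) /\
  (forall a b x, l1 a -> l1 b -> rm x (conv a b) = rm (rm x a) b) /\
  (forall a b x, l1 a -> l1 b -> lm a (rm x b) = rm (lm a x) b) /\
  (exists K : R, forall a x, l1 a -> `|lm a x| <= K%:C * l1norm a * `|x|) /\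
  (exists K : R, forall a x, l1 a -> `|rm x a| <= K%:C * l1norm a * `|x|).

(* dual module actions on E': (a.mu)(x) = mu(x.a), (mu.a)(x) = mu(a.x) *)
Definition normal_dual (lm : (S -> C) -> E -> E) (rm : E -> (S -> C) -> E) :=
  forall mu, dualE mu ->
    wstar_cont (fun a x => mu (rm x a)) /\ wstar_cont (fun a x => mu (lm a x)).

Definition derivation (lm : (S -> C) -> E -> E) (rm : E -> (S -> C) -> E) (D : (S -> C) -> E -> C) :=
  (forall a, l1 a -> dualE (D a)) /\
  (forall a b x, l1 a -> l1 b -> D (addf a b) x = D a x + D b x) /\
  (forall (c : C) a x, l1 a -> D (sclf c a) x = c * D a x) /\
  (forall a b x, l1 a -> l1 b -> D (conv a b) x = D b (rm x a) + D a (lm b x)).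

Definition inner (lm : (S -> C) -> E -> E) (rm : E -> (S -> C) -> E) (D : (S -> C) -> E -> C) :=
  exists mu, dualE mu /\ forall a x, l1 a -> D a x = mu (rm x a) - mu (lm a x).

End Module.

Definition connes_amenable :=
  forall (E : completeNormedModType C) (lm : (S -> C) -> E -> E)
      (rm : E -> (S -> C) -> E),
    banach_bimodule lm rm -> normal_dual lm rm ->
    forall D : (S -> C) -> E -> C,
      derivation lm rm D -> wstar_cont D -> inner lm rm D.

Definition bounded2 (f : S * S -> C) := exists K : R, forall p, `|f p| <= K%:C.

Definition linf_dual (M : (S * S -> C) -> C) :=
  (forall f g, bounded2 f -> bounded2 g ->
     M (fun p => f p + g p) = M f + M g) /\
  (forall (c : C) f, bounded2 f -> M (fun p => c * f p) = c * M f) /\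
  exists K : R, forall f (r : R), (forall p, `|f p| <= r%:C) ->
     `|M f| <= K%:C * r%:C.


Definition admissible (f : S * S -> C) :=
  bounded2 f /\
  (forall s, c0 (fun t => f (s, t)) /\ c0 (fun t => f (t, s))) /\
  forall (k : nat -> S) (gh : nat -> S * S), injective k -> injective gh ->
  forall L1 L2 L3 L4,
    rep_lim (fun n m => f ((gh m).2, mul (k n) (gh m).1)) L1 ->
    rep_lim (fun n m => Omega (k n) (gh m).1) L2 ->
    rep_lim (fun n m => f (mul (gh m).2 (k n), (gh m).1)) L3 ->
    rep_lim (fun n m => Omega (gh m).2 (k n)) L4 ->
    (L1 = 0 \/ L2 = 0) /\ (L3 = 0 \/ L4 = 0).

End L1.

(* Main.v *)
(** A function f as in (2), read as u (g, h) = f (h, g), is weakly almost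
    periodic in the strong sense that k |-> M (delta_k . u) and k |-> M (u . delta_k) vanish at infinity for every
    bounded functional M.  The repeated limit condition controls the limits of
    u . delta_k along ultrafilters of S x S, and a Fatou argument for the finitely
    additive variation of M passes from ultrafilters to M.

    Necessity.  The u with this property form a Banach space E with normal dual under the actions
    a o u = u (g, h a) - u (g h, a) and u . a = u (a g, h).  The map
    D (a) (u) = u (e, a) is a derivation; if it is implemented by mu, then evaluating at
    the images of c_0 under the adjoint of the product gives (1) for mu, hence (2),
    and M is a Hahn-Banach extension of mu.

    Sufficiency.  Given a derivation D into E', the coefficients
    D (delta_h) (x . delta_g) are admissible: they are bounded by the uniform
    boundedness principle, and their repeated limits are computed by taking
    ultrafilter limits of functionals in E', to which normality applies.  Applying M
    to them gives phi in E' with D (a) (x . e) = phi (x . a) - phi (a . x), and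
    mu (x) = phi (x) - D (e) (e . x) implements D, whether or not E is unital. *)

Require Import Defs.
From HB Require Import structures.
From mathcomp Require Import all_boot all_order all_algebra finmap.
From mathcomp Require Import all_classical all_reals all_analysis.
From mathcomp Require Import complex.
From mathcomp Require Import ring lra.
Import Order.TTheory Num.Theory GRing.Theory numFieldNormedType.Exports.
Import Normc.
Set Implicit Arguments. Unset Strict Implicit. Unset Printing Implicit Defensive.
Local Open Scope classical_set_scope.
Local Open Scope complex_scope.
Local Open Scope ring_scope.

Local Notation Re := complex.Re.
Local Notation Im := complex.Im.
Local Notation addf := Defs.addf.
Local Notation conv := Defs.conv.

(** * Modulus and unordered sums *)

(** Since [l^infty(X)] is [C(beta X)], the functionals [M] are measures on a space whose points are
    ultrafilters, and passing from ultrafilters to [M] is dominated convergence; the Fatou argument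
    carries it out without representing [M] by a measure. Testing on single ultrafilters is what
    makes a condition on sequences enough: an ultrafilter limit that does not vanish at infinity can
    be thinned out to sequences of distinct elements along which all four repeated limits exist. The
    action [a o u] comes from noncommutative differential forms. Read [delta_g (x) delta_h] as
    [g dh]: the Leibniz rule [(g dh) a = g d(ha) - gh da] is dual to [a o u], and [a |-> e (x) a] is
    the universal derivation [a |-> da]. The usual derivation [a (x) e - e (x) a] into the kernel of
    the product would need a quotient by the range of the adjoint of the product. With forms the
    module is a space of functions, and the implementing functional is itself the virtual
    diagonal. *)

Section ComplexModulus.
Variable R : realType.
Local Notation C := R[i].
Implicit Types x y z : C.

Lemma normcE x : `|x| = (normc x)%:C. Proof. by []. Qed.

Lemma normc_ge0 x : 0 <= normc x.
Proof. by rewrite -ler0c -normcE normr_ge0. Qed.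

Lemma normcD x y : normc (x + y) <= normc x + normc y.
Proof. exact: le_normcD. Qed.

Lemma normc_opp x : normc (- x) = normc x.
Proof. exact: normcN. Qed.

Lemma normcB x y : normc (x - y) <= normc x + normc y.
Proof. by rewrite -(normc_opp y) normcD. Qed.

Lemma normc_distC x y : normc (x - y) = normc (y - x).
Proof. by rewrite -normc_opp opprB. Qed.

Lemma normc_tri z x y : normc (x - y) <= normc (x - z) + normc (z - y).
Proof. by have := normcD (x - z) (z - y); rewrite addrA subrK. Qed.

Lemma normc_real (r : R) : normc r%:C = `|r|.
Proof. by rewrite /normc /= expr0n addr0 sqrtr_sqr. Qed.

Lemma normc_eq0 x : (normc x == 0) = (x == 0).
Proof. by apply/eqP/eqP => [/eq0_normc //|->]; rewrite normc0. Qed.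

Lemma lecE_norm x (r : R) : (`|x| <= r%:C) = (normc x <= r).
Proof. by rewrite normcE lecR. Qed.

Lemma ltcE_norm x (r : R) : (`|x| < r%:C) = (normc x < r).
Proof. by rewrite normcE ltcR. Qed.

Lemma Re_le_normc x : `|Re x| <= normc x.
Proof. by rewrite -lecR -normcE normc_ge_Re. Qed.

Lemma Im_le_normc x : `|Im x| <= normc x.
Proof.
have := Re_le_normc (x * 'i); rewrite ReiNIm normrN normcM.
by rewrite (_ : normc 'i = 1) ?mulr1 // /normc /= expr0n expr1n add0r sqrtr1.
Qed.

Lemma normc_le_ReIm x : normc x <= `|Re x| + `|Im x|.
Proof.
rewrite [x in normc x]complexE (le_trans (normcD _ _))// normcM !normc_real.
by rewrite (_ : normc 'i = 1) ?mul1r // /normc /= expr0n expr1n add0r sqrtr1.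
Qed.

Lemma normc_sum (I : Type) (r : seq I) (P : pred I) (F : I -> C) :
  normc (\sum_(i <- r | P i) F i) <= \sum_(i <- r | P i) normc (F i).
Proof.
elim/big_ind2 : _ => //; first by rewrite normc0.
by move=> a b c d ab cd; rewrite (le_trans (normcD _ _))// lerD.
Qed.

Lemma normc_small_eq0 x : (forall e : R, 0 < e -> normc x <= e) -> x = 0.
Proof.
move=> h; apply: eq0_normc; apply/eqP; rewrite eq_le normc_ge0 andbT.
by apply/ler_addgt0Pr => e e0; rewrite add0r h.
Qed.

Lemma normc_rot x : exists2 w : C, normc w = 1 & w * x = (normc x)%:C.
Proof.
have [->|x0] := eqVneq x 0; first by exists 1; rewrite ?normc1// normc0 mulr0.
have nx0 : normc x != 0 by rewrite normc_eq0.
exists ((normc x)%:C / x); last by rewrite divfK.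
by rewrite normcM normcV normc_real ger0_norm ?normc_ge0// divff.
Qed.

End ComplexModulus.

Section Sums.
Variable R : realType.
Local Notation C := R[i].
Variable I : choiceType.
Implicit Types (x y : I -> C) (J : {fset I}).
Local Open Scope fset_scope.
Local Open Scope ring_scope.

Lemma psumE (K : numFieldType) (x : I -> K) J : partial_sum x J = \sum_(i <- J) x i.
Proof. by rewrite /partial_sum big_seq_fsetE. Qed.

#[local] Instance totally_proper : ProperFilter (@totally I).
Proof.
apply: filter_from_proper; last by move=> A _; exists A => /=.
apply: filter_from_filter; first by exists fset0.
move=> A B _ _; exists (A `|` B) => // D /= ABD; split.
  exact: fsubset_trans (fsubsetUl _ _) ABD.
exact: fsubset_trans (fsubsetUr _ _) ABD.
Qed.

Lemma usum_unique (K : numFieldType) (x : I -> K) (L : K) :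
  (forall e : K, 0 < e -> exists J0, forall J, J0 `<=` J ->
     `|partial_sum x J - L| < e) -> usum x = L.
Proof.
move=> h; apply: cvg_lim; first exact: norm_hausdorff.
apply: (iffRL (@cvgrPdist_lt _ K^o _ _ _ _ _)) => e e0; have [J0 hJ0] := h e e0.
by exists J0 => // J /= /hJ0; rewrite distrC.
Qed.

(** [usum] is a limit over the complex field; a real [e] and a non-strict bound keep all estimates
    in the ordered field [R]. *)
Definition has_sum x (L : C) := forall e : R, 0 < e ->
  exists J0, forall J, J0 `<=` J -> normc (\sum_(i <- J) x i - L) <= e.

Lemma has_sum_usum x L : has_sum x L -> usum x = L.
Proof.
move=> h; apply: usum_unique => e e0.
have [r r0 re] : exists2 r : R, 0 < r & e = r%:C.
  have /complex_realP[r re] : e \is Num.real by rewrite gtr0_real.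
  by exists r => //; rewrite -ltcR -re.
have [|J0 hJ0] := h (r / 2); first by rewrite divr_gt0.
exists J0 => J /hJ0; rewrite psumE re ltcE_norm => /le_lt_trans; apply; lra.
Qed.

Definition n1 x : R := sup [set \sum_(i <- J) normc (x i) | J in [set: {fset I}]].

Definition summable x := exists B : R, forall J, \sum_(i <- J) normc (x i) <= B.

Lemma l1P x : l1 x <-> summable x.
Proof.
split=> [[M hM]|[B hB]]; last first.
  exists B%:C => J; rewrite psumE.
  by under eq_bigr do rewrite normcE; rewrite -rmorph_sum lecR.
exists (Re M) => J; have := hM J; rewrite psumE.
under eq_bigr do rewrite normcE.
by rewrite -rmorph_sum /= lecE => /andP[].
Qed.

Lemma n1_ub x J : summable x -> \sum_(i <- J) normc (x i) <= n1 x.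
Proof.
move=> [B hB]; apply: ub_le_sup; last by exists J.
by exists B => _ [K _ <-].
Qed.

Lemma n1_lub x B : (forall J, \sum_(i <- J) normc (x i) <= B) -> n1 x <= B.
Proof.
move=> hB; apply: ge_sup; first by exists (\sum_(i <- fset0) normc (x i)), fset0.
by move=> _ [K _ <-].
Qed.

Lemma n1_ge0 x : summable x -> 0 <= n1 x.
Proof. by move=> /(n1_ub fset0); rewrite big_seq_fset0. Qed.

Lemma sum_fsubset (f : I -> R) J J' : (forall i, 0 <= f i) -> J `<=` J' ->
  \sum_(i <- J) f i <= \sum_(i <- J') f i.
Proof.
move=> f0 JJ'.
rewrite [leRHS](big_fsetID _ (fun i => i \in J)) /=.
rewrite (_ : [fset i in J' | i \in J] = J).
  by rewrite lerDl sumr_ge0.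
apply/fsetP => i; rewrite !inE /=; have /fsubsetP/(_ i) := JJ'.
by case: (i \in J) => [->|]; rewrite ?andbF.
Qed.

Lemma n1_approx x (e : R) : summable x -> 0 < e ->
  exists J, n1 x - e < \sum_(i <- J) normc (x i).
Proof.
move=> [B hB] e0.
have hs : has_sup [set \sum_(i <- J) normc (x i) | J in [set: {fset I}]].
  split; first by exists (\sum_(i <- fset0) normc (x i)), fset0.
  by exists B => _ [K _ <-].
by have [_ [J _ <-]] := sup_adherent e0 hs; exists J.
Qed.

End Sums.

(** * Summable families, their pairing with bounded functions, and point masses *)

Section SumTheory.
Variable R : realType.
Local Notation C := R[i].
Variable I : choiceType.
Implicit Types (x y a b : I -> C) (J : {fset I}).
Local Open Scope fset_scope.
Local Open Scope ring_scope.

Lemma eq_usum x y : (forall i, x i = y i) -> usum x = usum y.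
Proof. by move=> /funext ->. Qed.

Lemma eq_pair (f g : I -> C) a : (forall i, f i = g i) -> pair f a = pair g a.
Proof. by move=> /funext ->. Qed.

Lemma eq_pairr (f a b : I -> C) : (forall i, a i = b i) -> pair f a = pair f b.
Proof. by move=> /funext ->. Qed.

Lemma has_sumD x y L M : has_sum x L -> has_sum y M ->
  has_sum (fun i => x i + y i) (L + M).
Proof.
move=> hx hy e e0; have e2 : 0 < e / 2 by rewrite divr_gt0.
have [A hA] := hx _ e2; have [B hB] := hy _ e2.
exists (A `|` B) => J; rewrite fsubUset => /andP[/hA a /hB b].
rewrite big_split /= opprD addrACA (le_trans (normcD _ _))//; lra.
Qed.

Lemma has_sumZ c x L : has_sum x L -> has_sum (fun i => c * x i) (c * L).
Proof.
move=> hx e e0; have d0 : 0 < normc c + 1 by rewrite ltr_wpDl ?normc_ge0.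
have [|A hA] := hx (e / (normc c + 1)); first by rewrite divr_gt0.
exists A => J /hA h; rewrite -mulr_sumr -mulrBr normcM.
apply: le_trans (ler_wpM2l (normc_ge0 _) h) _.
by rewrite mulrA ler_pdivrMr // mulrC ler_wpM2l ?(ltW e0)// lerDl.
Qed.

Lemma has_sum_ge0 (f : I -> R) (B : R) : (forall i, 0 <= f i) ->
  (forall J, \sum_(i <- J) f i <= B) ->
  has_sum (fun i => (f i)%:C)
    (sup [set \sum_(i <- J) f i | J in [set: {fset I}]])%:C.
Proof.
move=> f0 hB e e0; set T := [set _ | _ in _].
have hs : has_sup T.
  split; first by exists (\sum_(i <- fset0) f i), fset0.
  by exists B => _ [K _ <-].
have [_ [J0 _ <-] h] := sup_adherent e0 hs; exists J0 => J J0J.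
rewrite -rmorph_sum -rmorphB normc_real ler_norml.
have h1 := sum_fsubset f0 J0J.
have h2 : \sum_(i <- J) f i <= sup T by apply: ub_le_sup; [case: hs|exists J].
by apply/andP; split; lra.
Qed.

(** A real family [f] dominated by [normc x] is the difference of the nonnegative families
    [normc x + f] and [normc x], whose sums exist by monotonicity. This applies to the real and
    imaginary parts of [x]. *)
Lemma summable_has_sum x : summable x -> exists L, has_sum x L.
Proof.
move=> [B hB].
have hn := has_sum_ge0 (fun i => normc_ge0 (x i)) hB.
have aux (f : I -> R) : (forall i, `|f i| <= normc (x i)) ->
    exists L, has_sum (fun i => (f i)%:C) L.
  move=> fx; pose g i := normc (x i) + f i.
  have g0 i : 0 <= g i by have := fx i; rewrite ler_norml => /andP[? _]; rewrite /g; lra.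
  have gB J : \sum_(i <- J) g i <= B + B.
    apply: le_trans (lerD (hB J) (hB J)); rewrite -big_split /=.
    by apply: ler_sum => i _; rewrite lerD2l (le_trans (ler_norm _)).
  have := has_sumD (has_sum_ge0 g0 gB) (has_sumZ (-1) hn).
  under eq_fun do rewrite /g rmorphD mulN1r addrAC subrr add0r.
  by move=> h; eexists; exact: h.
have [L1 h1] := aux _ (fun i => Re_le_normc (x i)).
have [L2 h2] := aux _ (fun i => Im_le_normc (x i)).
exists (L1 + 'i * L2); have := has_sumD h1 (has_sumZ 'i h2).
by under eq_fun do rewrite -complexE.
Qed.

Lemma usumP x : summable x -> has_sum x (usum x).
Proof. by move=> /summable_has_sum[L hL]; rewrite (has_sum_usum hL). Qed.

Lemma summableD x y : summable x -> summable y -> summable (fun i => x i + y i).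
Proof.
move=> [A hA] [B hB]; exists (A + B) => J; apply: le_trans (lerD (hA J) (hB J)).
by rewrite -big_split; apply: ler_sum => i _; exact: normcD.
Qed.

Lemma summable_le x y (K : R) : 0 <= K -> (forall i, normc (x i) <= K * normc (y i)) ->
  summable y -> summable x.
Proof.
move=> K0 xy [B hB]; exists (K * B) => J.
apply: le_trans (ler_wpM2l K0 (hB J)).
by rewrite mulr_sumr; apply: ler_sum => i _.
Qed.

Lemma n1_le x y (K : R) : 0 <= K -> (forall i, normc (x i) <= K * normc (y i)) ->
  summable y -> n1 x <= K * n1 y.
Proof.
move=> K0 xy sy; apply: n1_lub => J.
apply: le_trans (ler_wpM2l K0 (n1_ub J sy)).
by rewrite mulr_sumr; apply: ler_sum => i _.
Qed.

Lemma summableZ c x : summable x -> summable (fun i => c * x i).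
Proof.
by apply: (summable_le (normc_ge0 c)) => i; rewrite normcM.
Qed.

Lemma usumD x y : summable x -> summable y ->
  usum (fun i => x i + y i) = usum x + usum y.
Proof. by move=> sx sy; apply: has_sum_usum; apply: has_sumD; exact: usumP. Qed.

Lemma usumZ c x : summable x -> usum (fun i => c * x i) = c * usum x.
Proof. by move=> sx; apply: has_sum_usum; apply: has_sumZ; exact: usumP. Qed.

Lemma normc_usum x : summable x -> normc (usum x) <= n1 x.
Proof.
move=> sx; apply/ler_addgt0Pr => e e0; have [J hJ] := usumP sx e0.
have := hJ _ (fsubset_refl J) => h.
have h1 := le_trans (normc_sum J predT x) (n1_ub J sx).
have := normc_tri (\sum_(i <- J) x i) (usum x) 0; rewrite !subr0 normc_distC; lra.
Qed.

Lemma l1norm_n1 x : summable x -> l1norm x = (n1 x)%:C.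
Proof.
move=> [B hB]; apply: has_sum_usum; apply: has_sum_ge0 hB => i; exact: normc_ge0.
Qed.

Definition bnd (K : choiceType) (f : K -> C) (B : R) := forall i, normc (f i) <= B.

Lemma summable_pair (f a : I -> C) B : bnd f B -> summable a ->
  summable (fun i => f i * a i).
Proof.
move=> fB; apply: (@summable_le _ _ `|B|) => // i.
by rewrite normcM ler_wpM2r ?normc_ge0// (le_trans (fB i)) ?ler_norm.
Qed.

Lemma normc_pair (f a : I -> C) B : 0 <= B -> bnd f B -> summable a ->
  normc (pair f a) <= B * n1 a.
Proof.
move=> B0 fB sa; apply: (le_trans (normc_usum (summable_pair fB sa))).
by apply: n1_le => // i; rewrite normcM ler_wpM2r ?normc_ge0.
Qed.

Lemma pairDl (f g a : I -> C) B B' : bnd f B -> bnd g B' -> summable a ->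
  pair (fun i => f i + g i) a = pair f a + pair g a.
Proof.
move=> fB gB sa; rewrite /pair -usumD; try exact: summable_pair sa.
by apply: eq_usum => i; rewrite mulrDl.
Qed.

Lemma pairZl c (f a : I -> C) B : bnd f B -> summable a ->
  pair (fun i => c * f i) a = c * pair f a.
Proof.
move=> fB sa; rewrite /pair -usumZ; last exact: summable_pair sa.
by apply: eq_usum => i; rewrite mulrA.
Qed.

Lemma pairDr (f a b : I -> C) B : bnd f B -> summable a -> summable b ->
  pair f (addf a b) = pair f a + pair f b.
Proof.
move=> fB sa sb; rewrite /pair -usumD; try exact: (summable_pair fB).
by apply: eq_usum => i; rewrite mulrDr.
Qed.

Lemma pairZr c (f a : I -> C) B : bnd f B -> summable a ->
  pair f (sclf c a) = c * pair f a.
Proof.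
move=> fB sa; rewrite /pair -usumZ; last exact: (summable_pair fB).
by apply: eq_usum => i; rewrite mulrCA.
Qed.

Definition dl (s : I) : I -> C := fun t => (t == s)%:R.

Lemma sum_dl (f : I -> C) s J : \sum_(i <- J) f i * dl s i = (s \in J)%:R * f s.
Proof.
rewrite /dl; have [sJ|sJ] := boolP (s \in J).
  rewrite (big_fsetD1 s) //= eqxx mulr1 mul1r big_seq big1 ?addr0 // => i.
  by rewrite !inE => /andP[/negbTE -> _]; rewrite mulr0.
rewrite mul0r big_seq big1 // => i iJ.
by case: eqP => [E|_]; [rewrite E (negbTE sJ) in iJ|rewrite mulr0].
Qed.

Lemma pair_dl f s : pair f (dl s) = f s.
Proof.
apply: has_sum_usum => e e0; exists [fset s] => J /fsubsetP sJ.
by rewrite sum_dl (sJ s) ?inE// mul1r subrr normc0 ltW.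
Qed.

Lemma n1_dl_le J s : \sum_(i <- J) normc (dl s i) <= 1.
Proof.
have -> : \sum_(i <- J) normc (dl s i) = Re (\sum_(i <- J) 1 * dl s i).
  have -> : \sum_(i <- J) 1 * dl s i = \sum_(i <- J) (normc (dl s i))%:C.
    apply: eq_bigr => i _; rewrite mul1r /dl; case: eqP => _ /=.
      by rewrite expr1n expr0n addr0 sqrtr1.
    by rewrite expr0n addr0 sqrtr0.
  by rewrite -rmorph_sum.
by rewrite sum_dl mulr1; case: (_ \in _) => //=.
Qed.

Lemma summable_dl s : summable (dl s).
Proof. by exists 1 => J; exact: n1_dl_le. Qed.

Lemma l1_dl s : l1 (dl s).
Proof. by apply/l1P; exact: summable_dl. Qed.

Lemma n1_dl s : n1 (dl s) <= 1.
Proof. by apply: n1_lub => J; exact: n1_dl_le. Qed.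

Lemma l1D a b : l1 a -> l1 b -> l1 (addf a b).
Proof. by move=> /l1P ? /l1P ?; apply/l1P; exact: summableD. Qed.

Lemma l1Z c a : l1 a -> l1 (sclf c a).
Proof. by move=> /l1P ?; apply/l1P; exact: summableZ. Qed.

Definition restr J (a : I -> C) : I -> C := fun i => if i \in J then a i else 0.

Lemma summable_restr J a : summable a -> summable (restr J a).
Proof.
apply: (@summable_le _ _ 1) => // i; rewrite mul1r /restr.
by case: ifP; rewrite ?normc0 ?normc_ge0.
Qed.

(** A finite sum outside [J] and the sum over [J] add up to at most [n1 a], while the sum over [J0]
    alone already exceeds [n1 a - e]. *)
Lemma n1_tail a (e : R) : summable a -> 0 < e -> exists J0, forall J, J0 `<=` J ->
  n1 (fun i => a i - restr J a i) <= e.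
Proof.
move=> sa e0; have [J0 hJ0] := n1_approx sa e0; exists J0 => J J0J.
apply: n1_lub => K; set S1 := \sum_(i <- K) _.
suff : S1 + \sum_(i <- J) normc (a i) <= n1 a.
  have h0 : \sum_(i <- J0) normc (a i) <= \sum_(i <- J) normc (a i).
    by apply: sum_fsubset J0J => i; exact: normc_ge0.
  rewrite -lerBrDr => /le_trans; apply.
  by rewrite lerBlDr addrC -lerBlDr ltW // (lt_le_trans hJ0).
have := n1_ub (J `|` K) sa; apply: le_trans.
rewrite [leRHS](big_fsetID _ (fun i => i \in J)) /= addrC.
rewrite (_ : [fset i in J `|` K | i \in J] = J); last first.
  by apply/fsetP => i; rewrite !inE /=; case: (i \in J); rewrite /= ?andbF.
rewrite lerD2r /S1 [leLHS](big_fsetID _ (fun i => i \in J)) /=.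
rewrite big_seq_cond big1 ?add0r.
  rewrite big_seq_cond [leRHS]big_seq_cond.
  rewrite (_ : [fset x in J `|` K | x \notin J] = [fset x in K | x \notin J]).
    apply: ler_sum => i /andP[]; rewrite !inE /= => /andP[_ iJ] _.
    by rewrite /restr (negbTE iJ) subr0.
  by apply/fsetP => i; rewrite !inE /=; case: (i \in J) => //=; rewrite andbF.
move=> i; rewrite !inE /= andbT => /andP[_ iJ].
by rewrite /restr iJ subrr normc0.
Qed.

Definition l1_linear (L : (I -> C) -> C) :=
  (forall a b, l1 a -> l1 b -> L (addf a b) = L a + L b) /\
  (forall c a, l1 a -> L (sclf c a) = c * L a).


Lemma l1_linear0 L : l1_linear L -> L (fun=> 0) = 0.
Proof.
move=> [_ LZ]; have l0 : l1 (fun _ : I => 0 : C).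
  by apply/l1P; exists 0 => J; rewrite big1 // => *; rewrite normc0.
have := LZ 0 _ l0; rewrite mul0r; apply: etrans; congr L.
by apply/funext => i; rewrite /sclf mulr0.
Qed.

Lemma l1_linear_restr L a J : l1_linear L ->
  L (restr J a) = \sum_(i <- J) L (dl i) * a i.
Proof.
move=> lL; have [LD LZ] := lL.
have h : forall s : seq I, uniq s -> let b := (fun i => if i \in s then a i else 0) in
    l1 b /\ L b = \sum_(i <- s) L (dl i) * a i.
  elim=> [_|i s IH /= /andP[isn us]] /=.
    rewrite big_nil; split; last exact: l1_linear0.
    by apply/l1P; exists 0 => K; rewrite big1 // => *; rewrite normc0.
  have [lb Lb] := IH us.
  have -> : (fun i0 => if i0 \in i :: s then a i0 else 0) =
     addf (sclf (a i) (dl i)) (fun j => if j \in s then a j else 0).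
    apply/funext => j; rewrite /addf /sclf /dl inE; case: eqP => [->|_] /=.
      by rewrite (negbTE isn) mulr1 addr0.
    by rewrite mulr0 add0r.
  have ld := l1Z (a i) (l1_dl i).
  split; first exact: l1D.
  by rewrite LD // LZ; [rewrite big_cons Lb mulrC|exact: l1_dl].
exact: (h J (fset_uniq J)).2.
Qed.

(** Truncations to finite sets are dense for [n1], so a bounded functional is determined by its
    values at point masses. Fubini, sums over fibres and the expansion of module orbits all reduce
    to point masses through this lemma. *)
Lemma l1_linear_pair L (K : R) a : l1_linear L ->
  (forall b, l1 b -> normc (L b) <= K * n1 b) -> l1 a ->
  L a = pair (fun i => L (dl i)) a.
Proof.
move=> lL LK la; have sa := la; move/l1P in sa.
apply/esym/has_sum_usum => e e0.
have d0 : 0 < e / (`|K| + 1) by rewrite divr_gt0 // ltr_wpDl.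
have [J0 hJ0] := n1_tail sa d0; exists J0 => J /hJ0 h.
rewrite -l1_linear_restr // normc_distC.
have sr := summable_restr J sa; have lr : l1 (restr J a) by apply/l1P.
have -> : L a - L (restr J a) = L (addf a (sclf (-1) (restr J a))).
  by rewrite lL.1 ?lL.2 ?mulN1r//; exact: l1Z.
apply: (le_trans (LK _ _)); first by apply: l1D => //; exact: l1Z.
have -> : addf a (sclf (-1) (restr J a)) = (fun i => a i - restr J a i).
  by apply/funext => i; rewrite /addf /sclf mulN1r.
have d1 : 0 < `|K| + 1 by rewrite ltr_wpDl.
rewrite ler_pdivlMr // in h.
apply: le_trans h; rewrite mulrC; apply: ler_wpM2l; last first.
  by rewrite (le_trans (ler_norm _)) ?lerDl.
apply: n1_ge0; have := summableD sa (summableZ (-1) sr).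
by under eq_fun do rewrite mulN1r.
Qed.

End SumTheory.
Arguments dl {R I} s.

(** * Push-forwards, tensor products and interchange of sums *)

Section Fubini.
Variable R : realType.
Local Notation C := R[i].
Local Open Scope fset_scope.
Local Open Scope ring_scope.

Lemma bnd_le (I : choiceType) (f : I -> C) B B' : B <= B' -> bnd f B -> bnd f B'.
Proof. by move=> BB fB i; exact: le_trans (fB i) BB. Qed.

Lemma normc_bool (b : bool) : normc (b%:R : C) <= 1.
Proof. by case: b; rewrite ?normc1// normc0. Qed.

Lemma usum_pair1 (I : choiceType) (x : I -> C) : usum x = pair (fun=> 1) x.
Proof. by apply: eq_usum => i; rewrite mul1r. Qed.

Lemma pair_linear (I : choiceType) (f : I -> C) B : bnd f B -> l1_linear (pair f).
Proof.
move=> fB; split=> [a b /l1P sa /l1P sb|c a /l1P sa].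
  exact: pairDr fB sa sb.
exact: pairZr fB sa.
Qed.

Section Fiber.
Variables (I J : choiceType) (f : I -> J).
Implicit Type x : I -> C.

(** The push-forward of [x] along [f]. *)
Definition fiber_sum x (j : J) : C := pair (fun i => (f i == j)%:R) x.

Let fiber_bnd j : bnd (fun i => (f i == j)%:R : C) 1.
Proof. by move=> i; exact: normc_bool. Qed.

Let fiber_sum_lin j : l1_linear (fun x => fiber_sum x j).
Proof. exact: pair_linear (fiber_bnd j). Qed.

(** Phases [w j] rotate each fibre sum to its modulus, so the left side is the value at [x] of a
    linear functional [L] with coefficients [w (f i)] or 0. The bound on [L] by the size of [K] is
    crude and serves only to apply [l1_linear_pair]; the constant 1 comes from the coefficients. *)
Lemma n1_fiber_sum_le x (K : {fset J}) : summable x ->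
  \sum_(j <- K) normc (fiber_sum x j) <= n1 x.
Proof.
move=> sx; have [w w1 hw] : exists2 w : J -> C, (forall j, normc (w j) = 1) &
    forall j, w j * fiber_sum x j = (normc (fiber_sum x j))%:C.
  have /choice[w hw] : forall j, exists w : C,
     normc w = 1 /\ w * fiber_sum x j = (normc (fiber_sum x j))%:C.
    by move=> j; have [w] := normc_rot (fiber_sum x j); exists w.
  by exists w => j; have [] := hw j.
pose L y : C := \sum_(j <- K) w j * fiber_sum y j.
have lL : l1_linear L.
  split=> [a b la lb|c a la]; rewrite /L.
    rewrite -big_split; apply: eq_bigr => j _ /=.
    by rewrite (fiber_sum_lin j).1 // mulrDr.
  rewrite mulr_sumr; apply: eq_bigr => j _ /=.
  by rewrite (fiber_sum_lin j).2 // mulrCA.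
have bL b : l1 b -> normc (L b) <= (\sum_(j <- K) 1) * n1 b.
  move=> /l1P sb; rewrite mulr_suml; apply: le_trans (normc_sum _ _ _) _.
  apply: ler_sum => j _; rewrite normcM w1 mul1r.
  exact: normc_pair (fiber_bnd j) sb.
have lx : l1 x by apply/l1P.
have := l1_linear_pair lL bL lx; rewrite /L.
under eq_bigr do rewrite hw.
rewrite -rmorph_sum => /(congr1 (@normc R)).
rewrite normc_real ger0_norm ?sumr_ge0 // => [->|j _]; last exact: normc_ge0.
rewrite -[leRHS]mul1r; apply: normc_pair sx => // i.
under eq_bigr do rewrite /fiber_sum pair_dl eq_sym.
rewrite (sum_dl w) normcM w1 mulr1; exact: normc_bool.
Qed.

Lemma summable_fiber_sum x : summable x -> summable (fiber_sum x).
Proof. by move=> sx; exists (n1 x) => K; exact: n1_fiber_sum_le. Qed.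

Lemma n1_fiber_sum x : summable x -> n1 (fiber_sum x) <= n1 x.
Proof. by move=> sx; apply: n1_lub => K; exact: n1_fiber_sum_le. Qed.

Lemma usum_fiber_sum x : summable x -> usum (fiber_sum x) = usum x.
Proof.
move=> sx; pose L y := usum (fiber_sum y).
have lL : l1_linear L.
  split=> [a b la lb|c a la]; rewrite /L.
    rewrite -usumD; try (apply: summable_fiber_sum; exact/l1P).
    by apply: eq_usum => j; rewrite (fiber_sum_lin j).1.
  rewrite -usumZ; try (apply: summable_fiber_sum; exact/l1P).
  by apply: eq_usum => j; rewrite (fiber_sum_lin j).2.
have bL b : l1 b -> normc (L b) <= 1 * n1 b.
  move=> /l1P sb; rewrite mul1r.
  exact: le_trans (normc_usum (summable_fiber_sum sb)) (n1_fiber_sum sb).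
have lx : l1 x by apply/l1P.
rewrite -/(L x) (l1_linear_pair lL bL lx) [RHS]usum_pair1.
apply: eq_pair => i; rewrite /L /fiber_sum.
transitivity (usum (fun j : J => (f i == j)%:R : C)).
  by apply: eq_usum => j; rewrite pair_dl.
rewrite -[RHS](pair_dl (fun=> 1) (f i)); apply: eq_usum => j.
by rewrite /dl mul1r eq_sym.
Qed.

Lemma pair_fiber_sum (phi : J -> C) B x : bnd phi B -> summable x ->
  pair phi (fiber_sum x) = pair (phi \o f) x.
Proof.
move=> pB sx; rewrite [RHS]/pair -usum_fiber_sum; last first.
  by apply: (summable_pair (B := B)) => // i; exact: pB.
apply: eq_usum => j; rewrite /fiber_sum -(pairZl _ (fiber_bnd j) sx).
apply: eq_usum => i.
by rewrite mulrA; congr (_ * _); case: eqP => [<-|_] /=; rewrite ?mulr1 ?mul1r ?mulr0 ?mul0r.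
Qed.

End Fiber.

Section Tensor.
Variables (I J : choiceType).
Implicit Types (a : I -> C) (b : J -> C).

Definition tens a b : I * J -> C := fun p => a p.1 * b p.2.

Lemma sum_tens_le a b (K : {fset I * J}) : summable a -> summable b ->
  \sum_(p <- K) normc (tens a b p) <= n1 a * n1 b.
Proof.
move=> sa sb; pose A := [fset p.1 | p in K]; pose B := [fset p.2 | p in K].
pose r := [seq (i, j) | i <- A, j <- B].
have ur : uniq r by apply: allpairs_uniq; rewrite ?fset_uniq // => -[? ?] [? ?].
have Kr : {subset K <= r}.
  move=> [i j] pK; apply/allpairsP; exists (i, j); split => //=.
    by apply/imfsetP; exists (i, j).
  by apply/imfsetP; exists (i, j).
have pe : perm_eq [seq p <- r | p \in K] K.
  apply: uniq_perm; rewrite ?filter_uniq ?fset_uniq // => p.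
  by rewrite mem_filter; have := Kr p; case: (p \in K) => //= ->.
apply: (@le_trans _ _ (\sum_(p <- r) normc (tens a b p))).
  rewrite -(perm_big _ pe) big_filter /= [leRHS](bigID (fun p => p \in K)) /=.
  by rewrite lerDl sumr_ge0 // => p _; exact: normc_ge0.
rewrite /r big_allpairs /=.
have -> : \sum_(i <- A) \sum_(j <- B) normc (tens a b (i, j)) =
    \sum_(i <- A) normc (a i) * \sum_(j <- B) normc (b j).
  by apply: eq_bigr => i _; rewrite mulr_sumr; apply: eq_bigr => j _; rewrite normcM.
rewrite -mulr_suml; apply: ler_pM; rewrite ?sumr_ge0 //.
- by move=> i _; exact: normc_ge0.
- by move=> i _; exact: normc_ge0.
- exact: n1_ub.
- exact: n1_ub.
Qed.

Lemma summable_tens a b : summable a -> summable b -> summable (tens a b).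
Proof. by move=> sa sb; exists (n1 a * n1 b) => K; exact: sum_tens_le. Qed.

Lemma n1_tens a b : summable a -> summable b -> n1 (tens a b) <= n1 a * n1 b.
Proof. by move=> sa sb; apply: n1_lub => K; exact: sum_tens_le. Qed.

Lemma tens_dl (i : I) (j : J) : tens (dl i) (dl j) = dl (i, j) :> (_ -> C).
Proof.
apply/funext => -[k l]; rewrite /tens /dl /= xpair_eqE.
by case: (k == i); case: (l == j); rewrite ?mulr1 ?mulr0.
Qed.

Variables (w : I * J -> C) (B : R).
Hypotheses (B0 : 0 <= B) (wB : bnd w B).

Let bilin_l b : summable b -> l1_linear (fun a => pair w (tens a b)).
Proof.
move=> sb; split=> [a a' /l1P sa /l1P sa'|c a /l1P sa].
  rewrite -(pairDr wB (summable_tens sa sb) (summable_tens sa' sb)).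
  by apply: eq_pairr => p; rewrite /addf /tens mulrDl.
rewrite -(pairZr _ wB (summable_tens sa sb)).
by apply: eq_pairr => p; rewrite /sclf /tens mulrA.
Qed.

Let bilin_r a : summable a -> l1_linear (fun b => pair w (tens a b)).
Proof.
move=> sa; split=> [b b' /l1P sb /l1P sb'|c b /l1P sb].
  rewrite -(pairDr wB (summable_tens sa sb) (summable_tens sa sb')).
  by apply: eq_pairr => p; rewrite /addf /tens mulrDr.
rewrite -(pairZr _ wB (summable_tens sa sb)).
by apply: eq_pairr => p; rewrite /sclf /tens mulrCA.
Qed.

Let bilin_bnd a b : summable a -> summable b ->
  normc (pair w (tens a b)) <= B * n1 a * n1 b.
Proof.
move=> sa sb; apply: (le_trans (normc_pair B0 wB (summable_tens sa sb))).
by rewrite -mulrA ler_wpM2l // n1_tens.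
Qed.

(** Expansion by [l1_linear_pair] in one variable and then in the other leaves only tensors of point
    masses, which are point masses of the product. *)
Lemma fubini_l a b : summable a -> summable b ->
  pair w (tens a b) = pair (fun i => pair (fun j => w (i, j)) b) a.
Proof.
move=> sa sb; have [la lb] : l1 a /\ l1 b by split; apply/l1P.
have -> := l1_linear_pair (K := B * n1 b) (bilin_l sb) _ la; last first.
  by move=> a' /l1P sa'; rewrite mulrAC bilin_bnd.
apply: eq_pair => i; have sd : summable (dl i : I -> C) := summable_dl _ i.
have -> := l1_linear_pair (K := B * n1 (dl i : I -> C)) (bilin_r sd) _ lb; last first.
  by move=> b' /l1P sb'; rewrite bilin_bnd.
by apply: eq_pair => j; rewrite tens_dl pair_dl.
Qed.

Lemma fubini_r a b : summable a -> summable b ->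
  pair w (tens a b) = pair (fun j => pair (fun i => w (i, j)) a) b.
Proof.
move=> sa sb; have [la lb] : l1 a /\ l1 b by split; apply/l1P.
have -> := l1_linear_pair (K := B * n1 a) (bilin_r sa) _ lb; last first.
  by move=> b' /l1P sb'; rewrite bilin_bnd.
apply: eq_pair => j; have sd : summable (dl j : J -> C) := summable_dl _ j.
have -> := l1_linear_pair (K := B * n1 (dl j : J -> C)) (bilin_l sd) _ la; last first.
  by move=> a' /l1P sa'; rewrite mulrAC bilin_bnd.
by apply: eq_pair => i; rewrite tens_dl pair_dl.
Qed.

Lemma pair_swap a b : summable a -> summable b ->
  pair (fun i => pair (fun j => w (i, j)) b) a =
  pair (fun j => pair (fun i => w (i, j)) a) b.
Proof. by move=> sa sb; rewrite -fubini_l // fubini_r. Qed.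

End Tensor.

Lemma bnd_pair (I J : choiceType) (w : I -> J -> C) B (b : J -> C) : 0 <= B ->
  (forall i, bnd (w i) B) -> summable b -> bnd (fun i => pair (w i) b) (B * n1 b).
Proof. by move=> B0 wB sb i; exact: normc_pair (wB i) sb. Qed.

End Fubini.

(** * Functions vanishing at infinity and [sigma(l^1, c_0)]-continuity *)

Section VanishingFunctions.
Variable R : realType.
Local Notation C := R[i].
Local Open Scope ring_scope.

Lemma c0P (T : choiceType) (f : T -> C) :
  c0 f <-> forall e : R, 0 < e -> finite_set [set g | e <= normc (f g)].
Proof.
by split=> h e e0; have := h e e0; congr finite_set; apply/funext => g /=;
  rewrite normcE lecR.
Qed.

Lemma c0_le (T : choiceType) (f g : T -> C) (K : R) :
  (forall t, normc (f t) <= K * normc (g t)) -> c0 g -> c0 f.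
Proof.
move=> fg /c0P hg; apply/c0P => e e0.
have d0 : 0 < `|K| + 1 by rewrite ltr_wpDl.
have := hg _ (divr_gt0 e0 d0); apply: sub_finite_set => t /= et.
rewrite ler_pdivrMr // mulrC (le_trans et)// (le_trans (fg t))//.
by rewrite ler_wpM2r ?normc_ge0// (le_trans (ler_norm _)) ?lerDl.
Qed.

Lemma c0_approx (T : choiceType) (f : T -> C) :
  (forall e : R, 0 < e -> exists2 g, c0 g & forall t, normc (f t - g t) <= e) -> c0 f.
Proof.
move=> h; apply/c0P => e e0; have [|g /c0P hg fg] := h (e / 2); first lra.
have := hg (e / 2) ltac:(lra); apply: sub_finite_set => t /= et.
have := normc_tri (f t) (g t) 0; rewrite !subr0.
have := fg t; rewrite -normc_opp opprB => h1 h2.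
have := normcD (f t - g t) (g t); rewrite subrK; have := fg t; lra.
Qed.

Lemma c0D (T : choiceType) (f g : T -> C) : c0 f -> c0 g -> c0 (fun t => f t + g t).
Proof.
move=> /c0P hf /c0P hg; apply/c0P => e e0.
have e2 : 0 < e / 2 by rewrite divr_gt0.
have := hf _ e2; have := hg _ e2 => h1 h2.
have : finite_set ([set t | e / 2 <= normc (f t)] `|` [set t | e / 2 <= normc (g t)]).
  by rewrite finite_setU.
apply: sub_finite_set => t /= et; have [?|ft] := lerP (e / 2) (normc (f t)); first by left.
by right; have := normcD (f t) (g t); lra.
Qed.

Lemma c0Z (T : choiceType) c (f : T -> C) : c0 f -> c0 (fun t => c * f t).
Proof. by apply: (@c0_le _ _ _ (normc c)) => t; rewrite normcM. Qed.

Lemma c0_cst0 (T : choiceType) : c0 (fun _ : T => 0 : C).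
Proof.
apply/c0P => e e0; rewrite (_ : [set g | _] = set0) ?finite_set0//.
by apply/seteqP; split => // t; rewrite /mkset normc0 leNgt e0.
Qed.

Lemma c0_sum (T I : choiceType) (r : seq I) (F : I -> T -> C) :
  (forall i, c0 (F i)) -> c0 (fun t => \sum_(i <- r) F i t).
Proof.
move=> h; elim: r => [|i r IH].
  by under eq_fun do rewrite big_nil; exact: c0_cst0.
by under eq_fun do rewrite big_cons; apply: c0D.
Qed.

Lemma c0_comp (T U : choiceType) (h : U -> T) (f : T -> C) :
  (forall t, finite_set [set u | h u = t]) -> c0 f -> c0 (fun u => f (h u)).
Proof.
move=> hfin /c0P hf; apply/c0P => e e0.
have -> : [set g | e <= normc (f (h g))] =
    \bigcup_(t in [set t | e <= normc (f t)]) [set u | h u = t].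
  apply/seteqP; split => u /=; first by move=> eu; exists (h u).
  by move=> [t et ->].
by apply: bigcup_finite; [exact: hf|move=> t _; exact: hfin].
Qed.

Lemma c0_bnd (T : choiceType) (f : T -> C) : c0 f -> exists2 B : R, 0 <= B & bnd f B.
Proof.
move=> /c0P /(_ 1 ltr01) /finite_fsetP[A hA].
exists (1 + \sum_(t <- A) normc (f t)).
  by rewrite addr_ge0 // sumr_ge0 // => i _; exact: normc_ge0.
move=> t; have [tA|tA] := boolP (t \in A).
  rewrite (big_fsetD1 t) //= addrCA lerDl addr_ge0 // sumr_ge0 // => i _.
  exact: normc_ge0.
have : ~ [set g | 1 <= normc (f g)] t by rewrite hA /=; apply/negP.
move=> /= /negP; rewrite -ltNge => /ltW h; rewrite (le_trans h)// lerDl sumr_ge0 // => i _.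
exact: normc_ge0.
Qed.

(** The function is a uniform limit of finite combinations of the [w i], the tail of [a] bounding
    the error. *)
Lemma c0_pair (I T : choiceType) (w : I -> T -> C) (B : R) a : summable a ->
  (forall t, bnd (w^~ t) B) -> (forall i, c0 (w i)) ->
  c0 (fun t => pair (w^~ t) a).
Proof.
move=> sa wB w0; apply: c0_approx => e e0.
have d1 : 0 < `|B| + 1 by rewrite ltr_wpDl.
have d0 : 0 < e / (`|B| + 1) by rewrite divr_gt0.
have [J hJ] := n1_tail sa d0; have := hJ J (fsubset_refl _) => {}hJ.
have sr := summable_restr J sa.
have wB' t : bnd (w^~ t) (`|B| + 1).
  by apply: bnd_le (wB t); rewrite (le_trans (ler_norm _)) ?lerDl.
exists (fun t => \sum_(i <- J) a i * w i t).
  by apply: c0_sum => i; exact: c0Z.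
move=> t; have := l1_linear_restr a J (pair_linear (wB' t)).
under eq_bigr do rewrite pair_dl mulrC; move=> <-.
have -> : pair (w^~ t) a - pair (w^~ t) (restr J a) =
    pair (w^~ t) (fun i => a i - restr J a i).
  rewrite -mulN1r -(pairZr (-1) (wB' t) sr) -(pairDr (wB' t) sa (summableZ (-1) sr)).
  by apply: eq_pairr => i; rewrite /addf /sclf mulN1r.
have st : summable (fun i => a i - restr J a i).
  by have := summableD sa (summableZ (-1) sr); under eq_fun do rewrite mulN1r.
apply: (le_trans (normc_pair (ltW d1) (wB' t) st)).
by rewrite mulrC -ler_pdivlMr.
Qed.

Lemma wcont_pair (S : choiceType) (phi : S -> C) : c0 phi -> wcont (pair phi).
Proof.
move=> p0 a0 l0 e e0; exists [:: phi], e; split => //; split.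
  by move=> f; rewrite inE => /eqP ->.
move=> a la /(_ phi (mem_head _ _)); have [B B0 pB] := c0_bnd p0.
have -> // : pair phi (fun g => a g - a0 g) = pair phi a - pair phi a0.
move/l1P : l0 => s0; move/l1P : la => sa.
rewrite -mulN1r -(pairZr (-1) pB s0) -(pairDr pB sa (summableZ (-1) s0)).
by apply: eq_pairr => i; rewrite /addf /sclf mulN1r.
Qed.

(** Continuity at 0 involves finitely many functions in [c0]; a point [s] with [L (dl s)] of modulus
    at least [e] must make one of them at least [d], which leaves finitely many [s]. For the second
    claim no norm bound on [L] is at hand: the truncations of [a] tend to [a] against each function
    in [c0], and continuity of [L] at [a] transfers this to [L]. *)
Lemma wcont_linear (S : choiceType) (L : (S -> C) -> C) : l1_linear L -> wcont L ->
  c0 (fun s => L (dl s)) /\ forall a, l1 a -> L a = pair (fun s => L (dl s)) a.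
Proof.
move=> lL cL; split.
  apply/c0P => e e0; have l0 : l1 (fun _ : S => 0 : C).
    by apply/l1P; exists 0 => J; rewrite big1 // => *; rewrite normc0.
  have [F [d [d0 [F0 h]]]] := cL _ l0 e e0.
  have : finite_set (\bigcup_(f in [set` F]) [set s | d <= normc (f s)]).
    apply: bigcup_finite; first exact: finite_seq.
    by move=> f /= /F0 /c0P; apply.
  apply: sub_finite_set => s /= es; apply: contrapT => ns.
  have : normc (L (dl s)) < e.
    rewrite -ltcE_norm; have := h (dl s) (l1_dl _ s); rewrite l1_linear0 // subr0; apply.
    move=> f fF; rewrite (_ : (fun g => _) = dl s); last by apply/funext => g; rewrite subr0.
    rewrite pair_dl ltcE_norm ltNge; apply/negP => df; apply: ns.
    by exists f.
  by rewrite ltNge es.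
move=> a la; apply/esym/has_sum_usum => e e0.
have [F [d [d0 [F0 h]]]] := cL _ la e e0; move/l1P : (la) => sa.
have [J hJ] : exists J : {fset S}, forall J', (J `<=` J')%fset -> forall f, f \in F ->
    normc (pair f (restr J' a) - pair f a) <= d / 2.
  elim: F F0 {h} => [_|f F IH F0]; first by exists fset0.
  have [J1 hJ1] := IH (fun g gF => F0 g (mem_behead (s := f :: F) gF)).
  have [B B0 fB] := c0_bnd (F0 f (mem_head _ _)).
  have [J2 hJ2] := usumP (summable_pair fB sa) (divr_gt0 d0 (ltr0Sn _ 1)).
  exists (J1 `|` J2)%fset => J'; rewrite fsubUset => /andP[s1 s2] g.
  rewrite inE => /orP[/eqP ->|gF]; last exact: hJ1.
  rewrite (l1_linear_restr a J' (pair_linear fB)).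
  by under eq_bigr do rewrite pair_dl; exact: hJ2.
exists J => J' /hJ {}hJ; rewrite -l1_linear_restr //.
have sr := summable_restr J' sa; have lr : l1 (restr J' a) by apply/l1P.
apply: ltW; rewrite -ltcE_norm; apply: h => // f fF.
have [B B0 fB] := c0_bnd (F0 f fF).
have -> : pair f (fun g => restr J' a g - a g) = pair f (restr J' a) - pair f a.
  rewrite -mulN1r -(pairZr (-1) fB sa) -(pairDr fB sr (summableZ (-1) sa)).
  by apply: eq_pairr => i; rewrite /addf /sclf mulN1r.
by rewrite ltcE_norm; apply: le_lt_trans (hJ f fF) _; lra.
Qed.

End VanishingFunctions.

(** * Convolution and the module of functions on the square *)

Section Weighted.
Variables (R : realType) (S : choiceType) (mul : S -> S -> S) (om : S -> R).
Local Notation C := R[i].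
Local Notation Om := (Omega mul om).
Hypotheses (mulA : associative mul) (wc : weakly_cancellative mul)
  (wt : weight mul om).
Implicit Types (a b : S -> C) (u v : S * S -> C) (phi : S -> C) (k g h s t : S).

Lemma normc_Omega g h : normc (Om g h) <= 1.
Proof.
have [p le] := wt; rewrite /Omega normc_real ger0_norm; last first.
  by rewrite divr_ge0 ?mulr_ge0 // ltW.
by rewrite ler_pdivrMr ?mul1r // mulr_gt0.
Qed.

(** Both sides equal [om (ghk) / (om g * om h * om k)]. This identity is the weighted form of
    associativity behind the module identities. *)
Lemma Omega_cocycle g h k :
  Om g (mul h k) * Om h k = Om (mul g h) k * Om g h.
Proof.
have [p _] := wt; have n s : om s != 0 by rewrite gt_eqF.
rewrite /Omega -!rmorphM mulA; congr (_ %:C).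
by field; rewrite !n.
Qed.

Lemma bndM_Omega (T : choiceType) (f : T -> C) (x y : T -> S) B : 0 <= B -> bnd f B ->
  bnd (fun z => f z * Om (x z) (y z)) B.
Proof.
move=> B0 fB z; rewrite normcM -[leRHS]mulr1 ler_pM ?normc_ge0 ?normc_Omega //.
Qed.

Section Conv.
Variables (a b : S -> C).
Hypotheses (sa : summable a) (sb : summable b).
Let x : S * S -> C := fun p => a p.1 * b p.2 * Om p.1 p.2.

Let le_x p : normc (x p) <= 1 * normc (tens a b p).
Proof. by rewrite mul1r /x normcM ler_piMr ?normc_ge0 ?normc_Omega. Qed.

Let sx : summable x.
Proof. exact: summable_le le_x (summable_tens sa sb). Qed.

Let convE : conv mul om a b = fiber_sum (fun p => mul p.1 p.2) x.
Proof.
apply/funext => s; apply: eq_usum => p.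
by rewrite /x; case: eqP; rewrite ?mul1r ?mul0r.
Qed.

Lemma summable_conv : summable (conv mul om a b).
Proof. by rewrite convE; exact: summable_fiber_sum. Qed.

(** The product is the push-forward along [mul] of the tensor product weighted by [Omega], so this
    is push-forward followed by Fubini. Module identities are proved in this dual form and never
    touch the coefficients of [conv]. *)
Lemma pair_conv phi B : 0 <= B -> bnd phi B -> pair phi (conv mul om a b) =
  pair (fun s => pair (fun t => phi (mul s t) * Om s t) b) a.
Proof.
move=> B0 pB; rewrite convE (pair_fiber_sum _ pB sx).
rewrite -(fubini_l (w := fun p => phi (mul p.1 p.2) * Om p.1 p.2) B0 _ sa sb).
  apply: eq_usum => p; rewrite /x /tens /=.
  ring.
by apply: bndM_Omega => // p; exact: pB.
Qed.

End Conv.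

Lemma l1_conv a b : l1 a -> l1 b -> l1 (conv mul om a b).
Proof. by move=> /l1P sa /l1P sb; apply/l1P; exact: summable_conv. Qed.

Lemma conv_dl g h : conv mul om (dl g) (dl h) = sclf (Om g h) (dl (mul g h)).
Proof.
apply/funext => s; rewrite /conv /sclf.
transitivity (pair (fun p => (mul p.1 p.2 == s)%:R * Om p.1 p.2) (dl (g, h))).
  apply: eq_usum => p; rewrite -tens_dl /tens.
  by case: eqP; rewrite ?mul1r ?mul0r // mulrC.
by rewrite pair_dl /= mulrC /dl eq_sym.
Qed.

(* With [u (g, h)] the value of the functional [u] at [delta_g (x) delta_h],
   [lact a u] is [a . u], [ract u a] is [u . a], [Dl phi] is the image of [phi]
   under the adjoint of the product, and [col u a] is [u (. (x) a)]. *)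
Definition lact a u : S * S -> C :=
  fun p => pair (fun k => u (p.1, mul p.2 k) * Om p.2 k) a.
Definition ract u a : S * S -> C :=
  fun p => pair (fun k => u (mul k p.1, p.2) * Om k p.1) a.
Definition col u a : S -> C := fun g => pair (fun k => u (g, k)) a.
Definition Dl phi : S * S -> C := fun p => phi (mul p.1 p.2) * Om p.1 p.2.
(* The representative of [a . u] modulo the range of [Dl] that [col _ e] annihilates,
   [e] being the unit. *)
Definition lmod a u : S * S -> C := fun p => lact a u p - Dl (col u a) p.

Lemma lact_dl k u : lact (dl k) u = fun p => u (p.1, mul p.2 k) * Om p.2 k.
Proof. by apply/funext => p; rewrite /lact pair_dl. Qed.

Lemma ract_dl k u : ract u (dl k) = fun p => u (mul k p.1, p.2) * Om k p.1.
Proof. by apply/funext => p; rewrite /ract pair_dl. Qed.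

Section Bounds.
Variables (B : R) (u : S * S -> C).
Hypotheses (B0 : 0 <= B) (uB : bnd u B).

Lemma bnd_lact_in p : bnd (fun k => u (p.1, mul p.2 k) * Om p.2 k) B.
Proof. by apply: bndM_Omega => // k; exact: uB. Qed.

Lemma bnd_ract_in p : bnd (fun k => u (mul k p.1, p.2) * Om k p.1) B.
Proof. by apply: bndM_Omega => // k; exact: uB. Qed.

Lemma bnd_col_in g : bnd (fun k => u (g, k)) B.
Proof. by move=> k; exact: uB. Qed.

Lemma bnd_lact a : summable a -> bnd (lact a u) (B * n1 a).
Proof. by move=> sa p; exact: normc_pair B0 (bnd_lact_in p) sa. Qed.

Lemma bnd_ract a : summable a -> bnd (ract u a) (B * n1 a).
Proof. by move=> sa p; exact: normc_pair B0 (bnd_ract_in p) sa. Qed.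

Lemma bnd_col a : summable a -> bnd (col u a) (B * n1 a).
Proof. by move=> sa p; exact: normc_pair B0 (bnd_col_in p) sa. Qed.

Lemma bnd_Dl phi : bnd phi B -> bnd (Dl phi) B.
Proof. by move=> pB; apply: bndM_Omega => // p; exact: pB. Qed.

End Bounds.

Lemma bnd_lmod B u a : 0 <= B -> bnd u B -> summable a ->
  bnd (lmod a u) (2 * (B * n1 a)).
Proof.
move=> B0 uB sa p; rewrite mulr2n mulrDl !mul1r (le_trans (normcB _ _))// lerD //.
  exact: bnd_lact.
by apply: bnd_Dl; [rewrite mulr_ge0 ?n1_ge0|exact: bnd_col].
Qed.

Section Identities.
Variables (a b : S -> C) (u : S * S -> C) (B : R).
Hypotheses (sa : summable a) (sb : summable b) (B0 : 0 <= B) (uB : bnd u B).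

Lemma col_lact : col (lact b u) a = col u (conv mul om a b).
Proof.
by apply/funext => g; rewrite /col (pair_conv sa sb B0 (bnd_col_in uB g)).
Qed.

Lemma lact_conv : lact (conv mul om a b) u = lact a (lact b u).
Proof.
apply/funext => -[g h]; rewrite /lact /= (pair_conv sa sb B0 (bnd_lact_in B0 uB (g, h))).
apply: eq_pair => s /=; rewrite mulrC -(pairZl _ (bnd_lact_in B0 uB (g, mul h s)) sb).
apply: eq_pair => t /=.
rewrite mulA; ring: (Omega_cocycle h s t).
Qed.

Lemma ract_conv : ract u (conv mul om a b) = ract (ract u a) b.
Proof.
apply/funext => -[g h]; rewrite /ract /= (pair_conv sa sb B0 (bnd_ract_in B0 uB (g, h))).
pose w (p : S * S) := u (mul (mul p.1 p.2) g, h) * Om (mul p.1 p.2) g * Om p.1 p.2.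
rewrite (pair_swap (w := w) B0) //; last first.
  by apply: bndM_Omega => //; apply: bndM_Omega => // p; exact: uB.
apply: eq_pair => t /=; rewrite mulrC -(pairZl _ (bnd_ract_in B0 uB (mul t g, h)) sa).
apply: eq_pair => s /=.
rewrite /w /= -mulA; ring: (Omega_cocycle s t g).
Qed.

Lemma lact_ract : lact a (ract u b) = ract (lact a u) b.
Proof.
apply/funext => -[g h]; rewrite /lact /ract /=.
pose w (p : S * S) := u (mul p.2 g, mul h p.1) * Om p.2 g * Om h p.1.
transitivity (pair (fun i => pair (fun j => w (i, j)) b) a).
  apply: eq_pair => k; rewrite mulrC -(pairZl _ (bnd_ract_in B0 uB (g, mul h k)) sb).
  by apply: eq_pair => s /=; rewrite mulrC.
rewrite (pair_swap (w := w) B0) //; last first.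
  by apply: bndM_Omega => //; apply: bndM_Omega => // p; exact: uB.
apply: eq_pair => s; rewrite mulrC -(pairZl _ (bnd_lact_in B0 uB (mul s g, h)) sa).
apply: eq_pair => k; rewrite /w /=; ring.
Qed.

(** Makes the correction term of [lmod] commute with the right action. *)
Lemma Dl_col_ract : Dl (col (ract u b) a) = ract (Dl (col u a)) b.
Proof.
apply/funext => -[g h]; rewrite /Dl /col /ract /= mulrC.
pose w (p : S * S) := u (mul p.2 (mul g h), p.1) * Om p.2 (mul g h) * Om g h.
transitivity (pair (fun i => pair (fun j => w (i, j)) b) a).
  rewrite -(pairZl _ (B := B * n1 b)) //; last first.
    by apply: bnd_pair => // i; exact: (bnd_ract_in B0 uB (mul g h, i)).
  apply: eq_pair => k; rewrite -(pairZl _ (bnd_ract_in B0 uB (mul g h, k)) sb).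
  by apply: eq_pair => s; rewrite /w /= mulrC.
rewrite (pair_swap (w := w) B0) //; last first.
  apply: (@bndM_Omega _ _ (fun=> g) (fun=> h)) => //.
  by apply: bndM_Omega => // p; exact: uB.
apply: eq_pair => s.
rewrite -mulrA mulrC -(pairZl _ (bnd_col_in uB (mul (mul s g) h)) sa).
apply: eq_pair => k; rewrite /w /= -mulA; ring: (Omega_cocycle s g h).
Qed.

End Identities.

(** Hence [lmod a] vanishes on the range of [Dl], which is what makes [lmod] multiplicative in
    [a]. *)
Lemma lact_Dl a phi B : summable a -> 0 <= B -> bnd phi B ->
  lact a (Dl phi) = Dl (col (Dl phi) a).
Proof.
move=> sa B0 pB; apply/funext => -[g h]; rewrite /lact /Dl /col /= mulrC.
rewrite -(pairZl _ (B := B)) //; last first.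
  by apply: (@bndM_Omega _ _ (fun=> mul g h) id) => // k; exact: pB.
apply: eq_pair => k; rewrite mulA; ring: (Omega_cocycle g h k).
Qed.

End Weighted.

(** * Ultrafilter limits *)

Section UltraLimits.
Variable R : realType.
Local Notation C := R[i].

Lemma ultra_bigcup (T : Type) (I : choiceType) (U : set_system T) (D : set I)
    (A : I -> set T) : UltraFilter U -> finite_set D ->
  U (\bigcup_(i in D) A i) -> exists2 i, D i & U (A i).
Proof.
move=> UU /finite_fsetP[J ->] UA; apply: contrapT => nA.
have h : U (\bigcap_(i in [set` J]) ~` A i).
  apply: filter_bigI => i iJ; have [UAi|//] := in_ultra_setVsetC (A i) UU.
  by exfalso; apply: nA; exists i.
by have [x [[i iJ Ai] /(_ i iJ)]] := filter_ex (filterI UA h).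
Qed.

Lemma ultra_lim_real (T : Type) (U : set_system T) (x : T -> R) (B : R) :
  UltraFilter U -> (forall t, `|x t| <= B) ->
  exists l, forall e, 0 < e -> U [set t | `|x t - l| <= e].
Proof.
move=> UU xB; pose A := [set r : R | U [set t | r <= x t]].
have hs : has_sup A.
  split.
    exists (- B); rewrite /A /=; apply: filterS filterT => t _ /=.
    by have := xB t; rewrite ler_norml => /andP[].
  exists B => r /filter_ex[t /= rt]; apply: le_trans rt _.
  by have := xB t; rewrite ler_norml => /andP[].
exists (sup A) => e e0.
have [r Ar hr] := sup_adherent e0 hs.
have [h|h] := in_ultra_setVsetC [set t | sup A + e <= x t] UU.
  have : sup A + e <= sup A by apply: ub_le_sup => //; case: hs.
  by rewrite gerDl leNgt e0.
apply: filterS (filterI Ar h) => t /= [rx /negP]; rewrite -ltNge => xt.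
by rewrite ler_norml; apply/andP; split; lra.
Qed.

Lemma ultra_lim (T : Type) (U : set_system T) (x : T -> C) (B : R) :
  UltraFilter U -> (forall t, normc (x t) <= B) ->
  exists l, forall e : R, 0 < e -> U [set t | normc (x t - l) <= e].
Proof.
move=> UU xB.
have [a ha] := ultra_lim_real (x := fun t => Re (x t)) UU
  (fun t => le_trans (Re_le_normc (x t)) (xB t)).
have [b hb] := ultra_lim_real (x := fun t => Im (x t)) UU
  (fun t => le_trans (Im_le_normc (x t)) (xB t)).
exists (a +i* b) => e e0; have e2 : 0 < e / 2 by rewrite divr_gt0.
apply: filterS (filterI (ha _ e2) (hb _ e2)) => t /= [h1 h2].
apply: le_trans (normc_le_ReIm _) _; move: h1 h2; case: (x t) => c d /= h1 h2; lra.
Qed.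

(** The default 0 is never met on bounded families, whose limit along an ultrafilter always
    exists. *)
Definition ulim (T : Type) (U : set_system T) (x : T -> C) : C :=
  xget 0 [set l | forall e : R, 0 < e -> U [set t | normc (x t - l) <= e]].

Lemma ulimP (T : Type) (U : set_system T) (x : T -> C) (B : R) :
  UltraFilter U -> (forall t, normc (x t) <= B) ->
  forall e : R, 0 < e -> U [set t | normc (x t - ulim U x) <= e].
Proof. by move=> UU /(ultra_lim UU)[l hl]; rewrite /ulim; case: xgetP => [? -> //|/(_ l)]. Qed.

Lemma ulim_unique (T : Type) (U : set_system T) (x : T -> C) (l : C) :
  UltraFilter U -> (forall e : R, 0 < e -> U [set t | normc (x t - l) <= e]) ->
  ulim U x = l.
Proof.
move=> UU hl; have hl' : forall e : R, 0 < e -> U [set t | normc (x t - ulim U x) <= e].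
  by rewrite /ulim; case: xgetP => [? ->|/(_ l)].
apply/eqP; rewrite -subr_eq0; apply/eqP/normc_small_eq0 => e e0.
have e2 : 0 < e / 2 by rewrite divr_gt0.
have [t /= [h1 h2]] := filter_ex (filterI (hl _ e2) (hl' _ e2)).
have := normc_tri (x t) (ulim U x) l; rewrite (normc_distC (ulim U x) (x t)); lra.
Qed.

Section UlimTheory.
Variables (T : Type) (U : set_system T) (UU : UltraFilter U).
Implicit Types x y : T -> C.

Lemma ulimD x y A B : (forall t, normc (x t) <= A) -> (forall t, normc (y t) <= B) ->
  ulim U (fun t => x t + y t) = ulim U x + ulim U y.
Proof.
move=> xA yB; apply: ulim_unique => e e0; have e2 : 0 < e / 2 by rewrite divr_gt0.
apply: filterS (filterI (ulimP UU xA e2) (ulimP UU yB e2)) => t /= [h1 h2].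
rewrite opprD addrACA; have := normcD (x t - ulim U x) (y t - ulim U y); lra.
Qed.

Lemma ulimZ c x A : (forall t, normc (x t) <= A) ->
  ulim U (fun t => c * x t) = c * ulim U x.
Proof.
move=> xA; apply: ulim_unique => e e0.
have d0 : 0 < normc c + 1 by rewrite ltr_wpDl ?normc_ge0.
apply: filterS (ulimP UU xA (divr_gt0 e0 d0)) => t /= h.
rewrite -mulrBr normcM; rewrite ler_pdivlMr // in h.
apply: le_trans h; rewrite mulrC; apply: ler_wpM2l; first exact: normc_ge0.
by rewrite lerDl.
Qed.

Lemma ulim_le x A : (forall t, normc (x t) <= A) -> normc (ulim U x) <= A.
Proof.
move=> xA; apply/ler_addgt0Pr => e e0.
have [t /= h] := filter_ex (ulimP UU xA e0).
have := normc_tri (x t) (ulim U x) 0; rewrite !subr0 normc_distC; have := xA t; lra.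
Qed.

Lemma ulim_ge x A e : (forall t, normc (x t) <= A) -> U [set t | e <= normc (x t)] ->
  e <= normc (ulim U x).
Proof.
move=> xA ex; apply/ler_addgt0Pr => d d0.
have [t /= [h1 h2]] := filter_ex (filterI ex (ulimP UU xA d0)).
have := normc_tri (ulim U x) (x t) 0; rewrite !subr0; lra.
Qed.

Lemma ulimM x y A B : (forall t, normc (x t) <= A) -> (forall t, normc (y t) <= B) ->
  ulim U (fun t => x t * y t) = ulim U x * ulim U y.
Proof.
move=> xA yB; apply: ulim_unique => e e0.
have [t0 _] := filter_ex (filterT : U setT).
have A0 : 0 <= A := le_trans (normc_ge0 _) (xA t0).
have B0 : 0 <= B := le_trans (normc_ge0 _) (yB t0).
have d0 : 0 < A + B + 1 by lra.
have ed := divr_gt0 e0 d0.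
apply: filterS (filterI (ulimP UU xA ed) (ulimP UU yB ed)) => t /= [h1 h2].
have -> : x t * y t - ulim U x * ulim U y =
  (x t - ulim U x) * y t + ulim U x * (y t - ulim U y) by ring.
apply: le_trans (normcD _ _) _; rewrite !normcM.
have -> : e = e / (A + B + 1) * B + A * (e / (A + B + 1)) + e / (A + B + 1).
  by field; rewrite gt_eqF.
apply: le_trans (lerD (_ : _ <= e / (A + B + 1) * B) (_ : _ <= A * (e / (A + B + 1)))) _.
- by apply: ler_pM; rewrite ?normc_ge0.
- by apply: ler_pM; rewrite ?normc_ge0 //; exact: ulim_le.
- by rewrite lerDl ltW.
Qed.

End UlimTheory.

Definition converges (x : nat -> C) (l : C) :=
  forall e : R, 0 < e -> exists N, forall n, (N <= n)%N -> normc (x n - l) <= e.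

Lemma cvg_distP (K : numFieldType) (x : nat -> K) (l : K) :
  x @ \oo --> l <-> forall e : K, 0 < e -> exists N, forall n, (N <= n)%N -> `|x n - l| < e.
Proof.
split=> [/(iffLR (@cvgrPdist_lt _ K^o _ _ _ _ _)) h e /h[N _ hN]|h].
  by exists N => n /hN /=; rewrite distrC.
apply: (iffRL (@cvgrPdist_lt _ K^o _ _ _ _ _)) => e /h[N hN].
by exists N => // n /= /hN; rewrite distrC.
Qed.

Lemma convergesP (x : nat -> C) (l : C) : converges x l <->
  forall e : C, 0 < e -> exists N, forall n, (N <= n)%N -> `|x n - l| < e.
Proof.
split=> h e e0.
  have /complex_realP[r re] : e \is Num.real by rewrite gtr0_real.
  have r0 : 0 < r by rewrite -ltcR -re.
  have [|N hN] := h (r / 2); first by rewrite divr_gt0.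
  by exists N => n /hN; rewrite re ltcE_norm => /le_lt_trans; apply; lra.
have /h[N hN] : 0 < e%:C :> C by rewrite ltcR.
by exists N => n /hN; rewrite ltcE_norm => /ltW.
Qed.

Lemma rep_limP (x : nat -> nat -> C) (L : C) : rep_lim x L <->
  exists l, (forall n, converges (x n) (l n)) /\ converges l L.
Proof.
split=> -[l [h1 h2]]; exists l; split=> [n|].
- by apply/convergesP/cvg_distP; exact: h1.
- by apply/convergesP/cvg_distP; exact: h2.
- by apply/cvg_distP/convergesP; exact: h1.
- by apply/cvg_distP/convergesP; exact: h2.
Qed.

Lemma ulim_converges (U : set_system nat) (x : nat -> C) (l : C) : UltraFilter U ->
  \oo `<=` U -> converges x l -> ulim U x = l.
Proof.
move=> UU sU h; apply: ulim_unique => e e0; apply: sU.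
by have [N hN] := h e e0; exists N.
Qed.

(** Every member of [F] still meets the complement of a finite set, so a point of [P n] can be
    chosen off the list [L n] of earlier choices. *)
Lemma filter_select (T : choiceType) (F : set_system T) (P : nat -> set T) :
  ProperFilter F -> (forall t, F [set z | z <> t]) -> (forall j, F (P j)) ->
  exists2 z : nat -> T, injective z & forall j, P j (z j).
Proof.
move=> FF nF FP.
have ex (js : nat * seq T) : exists z, P js.1 z /\ z \notin js.2.
  have : F [set z | z \notin js.2].
    elim: js.2 => [|t s IH]; first exact: filterS filterT.
    apply: filterS (filterI (nF t) IH) => z /= [/eqP zt zs].
    by rewrite inE negb_or zt.
  by move=> /(filterI (FP js.1)) /filter_ex[z [? ?]]; exists z.
have [f hf] := choice ex.
pose L := fix L n := if n is m.+1 then f (m, L m) :: L m else [::].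
pose z n := f (n, L n).
have zL n m : (n < m)%N -> z n \in L m.
  elim: m => // m IH; rewrite ltnS leq_eqVlt inE => /orP[/eqP ->|/IH ->].
    by rewrite eqxx.
  by rewrite orbT.
exists z; last by move=> j; have [] := hf (j, L j).
have zne n m : (n < m)%N -> z n <> z m.
  by move=> /zL nm E; have [_] := hf (m, L m); rewrite -/(z m) -E nm.
move=> n m E; have [nm|mn|//] := ltngtP n m; first by case: (zne _ _ nm).
by case: (zne _ _ mn).
Qed.

Lemma free_ultra (T : choiceType) (A : set T) : infinite_set A ->
  exists2 U : set_system T, UltraFilter U & U A /\ forall t, U [set z | z <> t].
Proof.
move=> iA; pose F : set_system T := filter_from [set D : set T | finite_set D] (fun D => A `\` D).
have FF : ProperFilter F.
  apply: filter_from_proper; last first.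
    move=> D /= fD; apply/infinite_setN0 => h; apply: iA.
    have : finite_set ((A `\` D) `|` D) by rewrite finite_setU.
    by apply: sub_finite_set => t At; have [?|?] := pselect (D t); [right|left].
  apply: filter_from_filter; first by exists set0; exact: finite_set0.
  move=> D E /= fD fE; exists (D `|` E); first by rewrite /= finite_setU.
  by move=> t [At] /not_orP[? ?].
have [U [UU sU]] := ultraFilterLemma FF; exists U => //; split.
  by apply: sU; exists set0; [exact: finite_set0|move=> t []].
by move=> t; apply: sU; exists [set t]; [exact: finite_set1|move=> z []].
Qed.

Lemma infinite_inj (T : choiceType) (A : set T) : infinite_set A ->
  exists2 z : nat -> T, injective z & forall n, A (z n).
Proof.
move=> /free_ultra[U UU [UA Uf]].
by have [z zi zA] := filter_select (P := fun=> A) ultra_proper Uf (fun=> UA); exists z.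
Qed.

(** Iterated ultrafilter limits are realised by sequences of distinct points: [k n] brings the inner
    limits within [1/(n+1)] of the outer ones, and [x m] then approximates the inner limits. Because
    [I] is finite, one choice serves all the families at once, so all their repeated limits exist
    along the same sequences. *)
Lemma repeated_limits (S X : choiceType) (I : finType) (y : I -> S -> X -> C) (B : R)
    (U : set_system X) (A : set S) :
  UltraFilter U -> (forall x, U [set z | z <> x]) -> infinite_set A ->
  (forall i k x, normc (y i k x) <= B) ->
  exists (k : nat -> S) (x : nat -> X) (V : set_system S) (L : I -> C),
  [/\ injective k, injective x, UltraFilter V, V A &
    forall i, rep_lim (fun n m => y i (k n) (x m)) (L i) /\
      L i = ulim V (fun k => ulim U (y i k))].
Proof.
move=> UU Uf iA yB; have [V VV [VA Vf]] := free_ultra iA.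
pose l i k := ulim U (y i k); pose L i := ulim V (l i).
have lB i k : normc (l i k) <= B by apply: ulim_le.
have e0 n : 0 < n.+1%:R^-1 :> R by rewrite invr_gt0.
pose P n : set S := [set k | forall i, normc (l i k - L i) <= n.+1%:R^-1].
have VP n : V (P n).
  apply: (@filter_forall _ _ (fun i => [set k | normc (l i k - L i) <= n.+1%:R^-1])) => i.
  exact: (ulimP VV (lB i) (e0 n)).
have [k ki kP] := filter_select _ Vf VP.
(* Stage [m] controls only [k 0, ..., k m], finitely many conditions; the inner limit at [k n] is
   thus approximated from [m >= n] on, whence the [maxn N n] below. *)
pose Q m : set X := [set x | forall (n : 'I_m.+1) i,
  normc (y i (k n) x - l i (k n)) <= m.+1%:R^-1].
have UQ m : U (Q m).
  apply: (@filter_forall _ _ (fun n : 'I_m.+1 => [set x | forall i,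
    normc (y i (k n) x - l i (k n)) <= m.+1%:R^-1])) => n.
  apply: (@filter_forall _ _ (fun i => [set x |
    normc (y i (k n) x - l i (k n)) <= m.+1%:R^-1])) => i.
  exact: (ulimP UU (yB i (k n)) (e0 m)).
have [x xi xQ] := filter_select _ Uf UQ.
exists k, x, V, L; split => // i; split=> //.
have small (e : R) : 0 < e -> exists N, forall n, (N <= n)%N -> n.+1%:R^-1 <= e.
  move=> e1; exists (Num.trunc e^-1) => n Nn.
  rewrite -[leRHS]invrK lef_pV2 ?posrE ?invr_gt0 //.
  by rewrite (le_trans (ltW (truncnS_gt _))) // ler_nat ltnS.
apply/rep_limP; exists (fun n => l i (k n)); split=> [n|] e /small[N hN].
  exists (maxn N n) => m; rewrite geq_max => /andP[/hN h nm].
  apply: le_trans h; have := xQ m (Ordinal (nm : (n < m.+1)%N)); exact.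
by exists N => n /hN h; apply: le_trans h; exact: kP.
Qed.

End UltraLimits.

(** * Variation of a functional on l^infty *)

Section Variation.
Variables (R : realType) (S : choiceType).
Local Notation C := R[i].
Local Notation X := (S * S)%type.
Implicit Types (f : X -> C) (A : set X).

Lemma bounded2P f : bounded2 f <-> exists2 B : R, 0 <= B & bnd f B.
Proof.
split=> [[B hB]|[B B0 hB]]; last by exists B => p; rewrite lecE_norm.
exists `|B| => // p; have := hB p; rewrite lecE_norm => /le_trans; apply.
exact: ler_norm.
Qed.

Lemma bnd_bounded2 f B : bnd f B -> bounded2 f.
Proof. by move=> fB; exists B => p; rewrite lecE_norm. Qed.

Variables (M : (X -> C) -> C) (hM : linf_dual M).

Lemma dual_bound : exists2 K : R, 0 <= K &
  forall f (r : R), bnd f r -> 0 <= r -> normc (M f) <= K * r.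
Proof.
have [_ [_ [K hK]]] := hM; exists `|K| => // f r fr r0.
have := hK f r; rewrite -rmorphM lecE_norm => h.
apply: le_trans (h _) _; first by move=> p; rewrite lecE_norm.
by rewrite ler_wpM2r // ler_norm.
Qed.

Lemma dualD f g : bounded2 f -> bounded2 g -> M (fun p => f p + g p) = M f + M g.
Proof. by have [h _] := hM; exact: h. Qed.

Lemma dualZ c f : bounded2 f -> M (fun p => c * f p) = c * M f.
Proof. by have [_ [h _]] := hM; exact: h. Qed.

Definition restrict A f : X -> C := fun p => if `[< A p >] then f p else 0.

Lemma bnd_restrict A f B : 0 <= B -> bnd f B -> bnd (restrict A f) B.
Proof. by move=> B0 fB p; rewrite /restrict; case: asboolP => // _; rewrite normc0. Qed.

Definition below A f := bnd f 1 /\ forall p, ~ A p -> f p = 0.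

(** The total variation on [A] of the finitely additive measure that [M] stands for. *)
Definition variation A : R := sup [set normc (M f) | f in below A].

Lemma variation_ub A f : below A f -> normc (M f) <= variation A.
Proof.
have [K K0 hK] := dual_bound => h; apply: ub_le_sup; last by exists f.
by exists (K * 1) => _ [g [g1 _] <-]; exact: hK.
Qed.

Lemma variation_lub A c : (forall f, below A f -> normc (M f) <= c) -> variation A <= c.
Proof.
move=> h; apply: ge_sup; last by move=> _ [f fA <-]; exact: h.
by exists (normc (M (fun=> 0))), (fun=> 0) => //; split=> // p; rewrite normc0.
Qed.

Lemma variation_approx A e : 0 < e -> exists2 f, below A f & variation A - e < normc (M f).
Proof.
have [K K0 hK] := dual_bound => e0.
have hs : has_sup [set normc (M f) | f in below A].
  split; first by exists (normc (M (fun=> 0))), (fun=> 0) => //; split=> // p; rewrite normc0.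
  by exists (K * 1) => _ [g [g1 _] <-]; exact: hK.
by have [_ [f fA <-] hf] := sup_adherent e0 hs; exists f.
Qed.

Lemma variation_mono A A' : A `<=` A' -> variation A <= variation A'.
Proof.
move=> AA; apply: variation_lub => f [f1 f0]; apply: variation_ub; split=> // p nA.
by apply: f0 => /AA.
Qed.

Lemma variationU A A' : variation (A `|` A') <= variation A + variation A'.
Proof.
apply: variation_lub => f [f1 f0].
have b1 := bnd_restrict A ler01 f1; have b2 := bnd_restrict (~` A) ler01 f1.
have -> : f = fun p => restrict A f p + restrict (~` A) f p.
  apply/funext => p; rewrite /restrict /=; case: asboolP => Ap; case: asboolP => nAp.
  - by case: nAp.
  - by rewrite addr0.
  - by rewrite add0r.
  - by case: nAp.
rewrite dualD; [|exact: bnd_bounded2 b1|exact: bnd_bounded2 b2].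
apply: le_trans (normcD _ _) _; apply: lerD; apply: variation_ub; split=> // p.
  by move=> nA; rewrite /restrict; case: asboolP.
move=> nA; rewrite /restrict; case: asboolP => //= nA'.
by apply: f0 => -[].
Qed.

(** Nearly extremal functions on the two sets, rotated so that [M] is nonnegative on them, have a
    sum still bounded by 1 because their supports are disjoint. *)
Lemma variation_disj A A' : A `&` A' = set0 ->
  variation A + variation A' <= variation (A `|` A').
Proof.
move=> dis; apply/ler_addgt0Pr => e e0; have e2 : 0 < e / 2 by rewrite divr_gt0.
have [f [f1 f0] hf] := variation_approx A e2.
have [g [g1 g0] hg] := variation_approx A' e2.
have [w w1 hw] := normc_rot (M f); have [z z1 hz] := normc_rot (M g).
pose h p := w * f p + z * g p.
have bf : bnd (fun p => w * f p) 1 by move=> p; rewrite normcM w1 mul1r.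
have bg : bnd (fun p => z * g p) 1 by move=> p; rewrite normcM z1 mul1r.
have Mh : M h = (normc (M f) + normc (M g))%:C.
  rewrite /h dualD; [|exact: bnd_bounded2 bf|exact: bnd_bounded2 bg].
  rewrite !dualZ; [|exact: bnd_bounded2 g1|exact: bnd_bounded2 f1].
  by rewrite hw hz rmorphD.
have : below (A `|` A') h.
  split=> p; last by move=> /not_orP[nA nA']; rewrite /h f0 // g0 // !mulr0 addr0.
  have [Ap|nAp] := pselect (A p); last by rewrite /h f0 // mulr0 add0r.
  rewrite /h g0 ?mulr0 ?addr0 // => A'p.
  by have : (A `&` A') p by []; rewrite dis.
move=> /variation_ub; rewrite Mh normc_real ger0_norm ?addr_ge0 ?normc_ge0 //; lra.
Qed.

Lemma variation_set0 : variation set0 <= 0.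
Proof.
apply: variation_lub => f [f1 f0]; have [K K0 hK] := dual_bound.
have := hK f 0; rewrite mulr0; apply => // p.
by rewrite f0 // normc0.
Qed.

(* A Fatou argument: finitely many of the [A j], [j >= n], exhaust their union up to
   [delta / 2 ^ n.+2], so these finite unions have the finite intersection property. *)
Lemma variation_ultra (A : nat -> set X) (delta : R) : 0 < delta ->
  (forall n, delta <= variation (A n)) ->
  exists2 U : set_system X, UltraFilter U & forall i, exists2 n, (i <= n)%N & U (A n).
Proof.
move=> d0 hA; pose D n m : set X := \bigcup_(j in [set j | n <= j <= m]%N) A j.
have [K K0 hK] := dual_bound.
have varK B : variation B <= K by apply: variation_lub => f [f1 _]; rewrite -[K]mulr1 hK.
have /choice[m hm] : forall n, exists m, (n <= m)%N /\
    forall m', variation (D n m') - delta / 2 ^+ n.+2 <= variation (D n m).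
  move=> n; pose E := [set variation (D n m) | m in [set: nat]].
  have hs : has_sup E.
    split; first by exists (variation (D n 0%N)), 0%N.
    by exists K => _ [m _ <-].
  have e0 : 0 < delta / 2 ^+ n.+2 by rewrite divr_gt0 // exprn_gt0.
  have [_ [m _ <-] hm] := sup_adherent e0 hs.
  exists (maxn n m); split=> [|m']; first exact: leq_maxl.
  have h1 : variation (D n m') <= sup E by apply: ub_le_sup; [case: hs|exists m'].
  have h2 : variation (D n m) <= variation (D n (maxn n m)).
    apply: variation_mono => p [j /= /andP[nj jm] Aj]; exists j => //=.
    by rewrite nj leq_max jm orbT.
  lra.
pose Cn n := D n (m n).
(* Both [Cn i] and [Cn j] consist of sets [A l] with [l >= i], and [Cn i] is nearly extremal among
   such finite unions; superadditivity leaves little variation outside it. *)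
have Cdiff i j : (i <= j)%N -> variation (Cn j `\` Cn i) <= delta / 2 ^+ i.+2.
  move=> ij; have [_ /(_ (maxn (m i) (m j))) h] := hm i.
  have : variation (Cn i) + variation (Cn j `\` Cn i) <= variation (D i (maxn (m i) (m j))).
    apply: le_trans (variation_disj _) (variation_mono _); first exact: setDIK.
    move=> p [[l /= /andP[il lm] Al]|[[l /= /andP[jl lm] Al] _]]; exists l => //=.
      by rewrite il leq_max lm.
    by rewrite (leq_trans ij jl) leq_max lm orbT.
  by move: h; rewrite -/(Cn i); lra.
pose E k : set X := \bigcap_(i in [set i | i < k]%N) Cn i.
(* The losses [delta / 2 ^ (i+2)] for [i < k] add up to [delta / 2 - delta / 2 ^ (k+1)], and this is
   what remains of [delta]. *)
have varE k j : (k <= j)%N -> delta / 2 + delta / 2 ^+ k.+1 <= variation (Cn j `&` E k).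
  elim: k => [|k IH] kj.
    rewrite expr1 -splitr (le_trans (hA j)) //; apply: variation_mono => p Ap.
    by split=> //; exists j => //=; rewrite leqnn; have [] := hm j.
  have := IH (ltnW kj); have := Cdiff k j (ltnW kj) => h1 h2.
  have : variation (Cn j `&` E k) <= variation (Cn j `&` E k.+1) + variation (Cn j `\` Cn k).
    apply: le_trans (variationU _ _); apply: variation_mono => p [Cp Ep].
    have [Ck|nCk] := pselect (Cn k p); last by right.
    left; split=> // i /=; rewrite ltnS leq_eqVlt => /orP[/eqP -> //|ik].
    exact: Ep.
  have -> : delta / 2 ^+ k.+2 = delta / 2 ^+ k.+1 - delta / 2 ^+ k.+2.
    by rewrite [2 ^+ k.+2]exprS; field; rewrite expf_neq0.
  lra.
have FF : ProperFilter (filter_from [set: nat] E).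
  apply: filter_from_proper.
    apply: filter_from_filter; first by exists 0%N.
    move=> i j _ _; exists (maxn i j) => // p Ep; split=> l /= li; apply: Ep => /=.
      by rewrite leq_max li.
    by rewrite leq_max li orbT.
  move=> k _; apply: contrapT => nE.
  have E0 : Cn k `&` E k `<=` set0 by move=> p [_ Ep]; apply: nE; exists p.
  have := le_trans (varE k k (leqnn k)) (variation_mono E0).
  move=> /le_trans /(_ variation_set0).
  have : 0 < delta / 2 ^+ k.+1 by rewrite divr_gt0 // exprn_gt0.
  lra.
have [U [UU sU]] := ultraFilterLemma FF; exists U => // i.
(* [Cn i] is a finite union of sets [A j] with [j >= i], so an ultrafilter containing it contains
   one of them. *)
have UC : U (Cn i) by apply: sU; exists i.+1 => // p; apply => /=.
have fin : finite_set [set j | i <= j <= m i]%N.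
  by apply: sub_finite_set (finite_II (m i).+1) => j /= /andP[].
have [n /= /andP[ni _] Un] := ultra_bigcup UU fin UC.
by exists n.
Qed.

End Variation.

(** * Dominated convergence for bounded functionals on [l^infty] *)

Section WeaklyNull.
Variables (R : realType) (S : choiceType).
Local Notation C := R[i].
Local Notation X := (S * S)%type.

(** Cut [u k] at the level [d], chosen so that the small part contributes at most [e / 2] to
    [M (u k)]. The large part then forces its support to have variation at least [delta], where
    dividing by [B + 1] normalises the function. [variation_ultra] yields one ultrafilter containing
    infinitely many of these supports. *)
Lemma not_weakly_null (M : (X -> C) -> C) (u : S -> X -> C) (B e : R) : linf_dual M ->
  0 <= B -> (forall k, bnd (u k) B) -> 0 < e ->
  infinite_set [set k | e <= normc (M (u k))] ->
  exists (U : set_system X) (d : R), [/\ UltraFilter U, 0 < d &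
    infinite_set [set k | U [set x | d <= normc (u k x)]]].
Proof.
move=> hM B0 uB e0 /infinite_inj[k ki kM]; have [K K0 hK] := dual_bound hM.
pose d := e / 2 / (K + 1); have K1 : 0 < K + 1 by rewrite ltr_wpDl.
have d0 : 0 < d by rewrite !divr_gt0.
pose A n := [set x | d <= normc (u (k n) x)].
pose delta := e / 2 / (B + 1); have B1 : 0 < B + 1 by rewrite ltr_wpDl.
have delta0 : 0 < delta by rewrite !divr_gt0.
have hA n : delta <= variation M (A n).
  set f := u (k n); have fB : bnd f B := uB (k n).
  have b1 := bnd_restrict (A n) B0 fB.
  have b2 : bnd (restrict (~` A n) f) d.
    move=> p; rewrite /restrict; case: asboolP => [|_]; last by rewrite normc0 ltW.
    by rewrite /A /= => /negP; rewrite -ltNge => /ltW.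
  have fE : f = fun p => restrict (A n) f p + restrict (~` A n) f p.
    apply/funext => p; rewrite /restrict /=; case: asboolP => Ap; case: asboolP => nAp.
    - by case: nAp.
    - by rewrite addr0.
    - by rewrite add0r.
    - by case: nAp.
  have := kM n; rewrite /= -/f fE (dualD hM); [|exact: bnd_bounded2 b1|exact: bnd_bounded2 b2].
  move=> h; have h2 := hK _ _ b2 (ltW d0).
  have h3 : K * d <= e / 2.
    by rewrite /d mulrCA ler_piMr ?divr_ge0 ?ltW // ltr_pdivrMr // mul1r ltrDl.
  have c0 : 0 < (B + 1)^-1 by rewrite invr_gt0.
  have : below (A n) (fun p => (B + 1)^-1%:C * restrict (A n) f p).
    split=> p; last by move=> nA; rewrite /restrict; case: asboolP; rewrite ?mulr0.
    rewrite normcM normc_real gtr0_norm // mulrC ler_pdivrMr // mul1r.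
    by rewrite (le_trans (b1 p)) // lerDl.
  move=> /(variation_ub hM); apply: le_trans.
  rewrite (dualZ hM); last exact: bnd_bounded2 b1.
  rewrite normcM normc_real gtr0_norm // /delta mulrC ler_wpM2l ?(ltW c0) //.
  have := normcD (M (restrict (A n) f)) (M (restrict (~` A n) f)).
  lra.
have [U UU hU] := variation_ultra hM delta0 hA.
exists U, d; split=> // fin; apply: (@infinite_nat).
have fin' : finite_set [set n | U (A n)].
  apply: (@sub_finite_set _ _ (\bigcup_(s in [set k | U [set x | d <= normc (u k x)]])
      [set n | k n = s])) => [n An|]; first by exists (k n).
  apply: bigcup_finite => // s _; have [[n0 kn0]|nk] := pselect (exists n, k n = s).
    apply: sub_finite_set (finite_set1 n0) => n /= kn; apply: ki.
    by rewrite kn kn0.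
  by rewrite (_ : [set n | _] = set0) // -subset0 => n kn; apply: nk; exists n.
have /finite_fsetP[J hJ] := fin'.
have [n nJ Un] := hU (\max_(j <- J) j).+1.
have : n \in J by have : [set n | U (A n)] n by []; rewrite hJ.
move=> nJ'; have := leq_bigmax_seq (F := id) n nJ' isT.
by rewrite leqNgt nJ.
Qed.

End WeaklyNull.

(** * The Hahn-Banach theorem over the complex numbers *)

Section HahnBanach.
Variables (R : realType) (V : lmodType R[i]).
Local Notation C := R[i].
Variables (p : V -> R) (W : set V) (phi : V -> C).
Hypotheses (pD : forall x y, p (x + y) <= p x + p y)
  (pZ : forall c x, p (c *: x) = normc c * p x)
  (W0 : W 0) (WD : forall x y, W x -> W y -> W (x + y))
  (WZ : forall c x, W x -> W (c *: x))
  (phiD : forall x y, W x -> W y -> phi (x + y) = phi x + phi y)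
  (phiZ : forall c x, W x -> phi (c *: x) = c * phi x)
  (phip : forall x, W x -> normc (phi x) <= p x).

Let realN1 : (-1 : R)%:C = -1 :> C.
Proof. by apply/eqP; rewrite eq_complex /= oppr0 !eqxx. Qed.

Let scR (r s : R) (v : V) : r%:C *: (s%:C *: v) = (r * s)%:C *: v.
Proof. by rewrite scalerA -rmorphM. Qed.

Let p0 : p 0 = 0.
Proof. by rewrite -(scale0r (0 : V)) pZ normc0 mul0r. Qed.

(** Partial real functionals are encoded as relations. Single-valuedness need not be imposed: if
    [(v, a)] and [(v, b)] both lie in an [ok] relation, then so does [(0, a - b)], and
    [a - b <= p 0 = 0]. *)
Let graph := set (V * R).
Let G0 : graph := [set q | W q.1 /\ q.2 = Re (phi q.1)].

Let ok (G : graph) :=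
  (forall v a w b (r : R), G (v, a) -> G (w, b) -> G (v + r%:C *: w, a + r * b)) /\
  (forall v a, G (v, a) -> a <= p v).

Let ReM (r : R) (x : C) : Re (r%:C * x) = r * Re x.
Proof. by case: x => a b /=; rewrite mul0r subr0. Qed.

Let ok_G0 : ok G0.
Proof.
split=> [v a w b r [/= Wv ->] [/= Ww ->]|v a [/= Wv ->]].
  have Wr : W (r%:C *: w) by exact: WZ.
  by split=> /=; [exact: WD|rewrite phiD // phiZ // raddfD /= ReM].
exact: le_trans (ler_norm _) (le_trans (Re_le_normc _) (phip Wv)).
Qed.

Let maximal_graph : exists2 G : graph, G0 `<=` G /\ ok G &
  forall B, ok B -> G `<=` B -> B `<=` G.
Proof.
(* Adjoining [G0] inside the predicate makes the union of the empty chain satisfy it. *)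
have [F Ftot FP|A [okA maxA]] := @Zorn_bigcup (V * R) [set G | ok (G0 `|` G)].
  split=> [v a w b r|v a [h|[X FX Xv]]]; last 2 first.
  - exact: ok_G0.2 h.
  - by apply: (Ftot X FX).2; right.
  have inX X q : F X -> (G0 `|` X) q -> (G0 `|` \bigcup_(X in F) X) q.
    by move=> FX [?|?]; [left|right; exists X].
  move=> [h1|[X FX h1]] [h2|[Y FY h2]].
  - by left; exact: ok_G0.1.
  - by apply: (inX Y _ FY); apply: (Ftot Y FY).1; [left|right].
  - by apply: (inX X _ FX); apply: (Ftot X FX).1; [right|left].
  - have [XY|YX] := FP X Y FX FY.
      by apply: (inX Y _ FY); apply: (Ftot Y FY).1; right => //; exact: XY.
    by apply: (inX X _ FX); apply: (Ftot X FX).1; right => //; exact: YX.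
exists (G0 `|` A); first by split=> // q; left.
move=> B okB GB q Bq; apply: contrapT => nq.
apply: (maxA B); last first.
  rewrite /= (_ : G0 `|` B = B) //; apply/seteqP; split=> x; last by right.
  by move=> [G0x|//]; apply: GB; left.
split; first by move=> x Ax; apply: GB; right.
by move=> BA; apply: nq; right; exact: BA.
Qed.

Let total_graph G : G0 `<=` G -> ok G ->
  (forall B, ok B -> G `<=` B -> B `<=` G) -> forall v, exists a, G (v, a).
Proof.
move=> G0G [Glin Gp] Gmax v0; apply: contrapT => nv0.
have G00 : G (0, 0).
  apply: G0G; split => //=; have := phiZ 0 W0; rewrite scale0r mul0r.
  by move=> ->.
have Gsc r v a : G (v, a) -> G (r%:C *: v, r * a).
  by move=> /(Glin _ _ _ _ r G00); rewrite !add0r.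
pose E := [set q.2 - p (q.1 - v0) | q in G].
have ubE w b : G (w, b) -> ubound E (p (w + v0) - b).
  move=> Gw _ [[v a] Gv <-] /=.
  have := Gp _ _ (Glin _ _ _ _ 1 Gv Gw); rewrite scale1r mul1r => h.
  have := pD (v - v0) (w + v0).
  by rewrite addrACA addNr addr0 => h2; lra.
have E0 : E !=set0 by exists (0 - p (0 - v0)), (0, 0).
pose c := sup E.
have c1 v a : G (v, a) -> a - p (v - v0) <= c.
  by move=> Gv; apply: ub_le_sup; [exists (p (0 + v0) - 0); exact: ubE|exists (v, a)].
have c2 w b : G (w, b) -> c <= p (w + v0) - b by move=> Gw; apply: ge_sup => //; exact: ubE.
pose B : graph := [set q | exists v a t, [/\ G (v, a), q.1 = v + t%:C *: v0 & q.2 = a + t * c]].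
have GB : G `<=` B.
  by move=> [v a] Gv; exists v, a, 0; split=> //=; rewrite ?scale0r ?addr0 // mul0r addr0.
have okB : ok B.
  split=> [v a w b r [v' [a' [t [Gv' /= -> ->]]]] [w' [b' [s [Gw' /= -> ->]]]]|
           _ _ [v [a [t [Gv /= -> ->]]]]].
    exists (v' + r%:C *: w'), (a' + r * b'), (t + r * s); split=> /=; first exact: Glin.
      by rewrite scalerDr scalerA addrACA -scalerDl -rmorphM -rmorphD.
    by rewrite mulrDr mulrDl addrACA mulrA.
  have [t0|t0|->] := ltrgtP t 0; last by rewrite scale0r addr0 mul0r addr0; exact: Gp.
    have s0 : 0 < - t by rewrite oppr_gt0.
    have := c1 _ _ (Gsc (- t)^-1 _ _ Gv).
    have -> : p ((- t)^-1%:C *: v - v0) = (- t)^-1 * p (v + t%:C *: v0).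
      have -> : (- t)^-1%:C *: v - v0 = (- t)^-1%:C *: (v + t%:C *: v0).
        by rewrite scalerDr scR invrN mulNr mulVf ?lt_eqF // realN1 scaleN1r.
      by rewrite pZ normc_real gtr0_norm // invr_gt0.
    rewrite -mulrBr mulrC ler_pdivrMr //; lra.
  have := c2 _ _ (Gsc t^-1 _ _ Gv).
  have -> : p (t^-1%:C *: v + v0) = t^-1 * p (v + t%:C *: v0).
    have -> : t^-1%:C *: v + v0 = t^-1%:C *: (v + t%:C *: v0).
      by rewrite scalerDr scR mulVf ?gt_eqF // scale1r.
    by rewrite pZ normc_real gtr0_norm // invr_gt0.
  rewrite -mulrBr mulrC ler_pdivlMr //; lra.
apply: nv0; exists c; apply: (Gmax B okB GB).
by exists 0, 0, 1; split=> //=; rewrite ?scale1r ?add0r // mul1r.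
Qed.

Lemma hahn_banach : exists psi : V -> C,
  [/\ forall x y, psi (x + y) = psi x + psi y, forall c x, psi (c *: x) = c * psi x,
      forall x, normc (psi x) <= p x & forall x, W x -> psi x = phi x].
Proof.
have [G [G0G okG] Gmax] := maximal_graph.
have /choice[f fG] := total_graph G0G okG Gmax.
have [Glin Gp] := okG.
have Gfun v a b : G (v, a) -> G (v, b) -> a = b.
  have le a' b' : G (v, a') -> G (v, b') -> a' <= b'.
    move=> ha hb; have := Gp _ _ (Glin _ _ _ _ (-1) ha hb).
    by rewrite realN1 scaleN1r subrr p0; lra.
  by move=> ha hb; apply/eqP; rewrite eq_le !le.
have flin v w r : f (v + r%:C *: w) = f v + r * f w.
  by apply: Gfun (fG _) _; exact: Glin.
have fD v w : f (v + w) = f v + f w by have := flin v w 1; rewrite scale1r mul1r.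
have f0 : f 0 = 0 by have := fD 0 0; rewrite addr0; lra.
have fZ r w : f (r%:C *: w) = r * f w by have := flin 0 w r; rewrite f0 !add0r.
(* The complex linear functional with real part [f]. A phase makes [psi x] real, and there the bound
   on [f] becomes a bound on the modulus. *)
pose psi x : C := f x +i* (- f ('i *: x)).
have psiD x y : psi (x + y) = psi x + psi y.
  by rewrite /psi scalerDr !fD opprD.
have psiZ c x : psi (c *: x) = c * psi x.
  have fc z : f (c *: z) = Re c * f z + Im c * f ('i *: z).
    by rewrite {1}[c]complexE scalerDl mulrC -scalerA fD !fZ.
  rewrite /psi scalerA [_ * c]mulrC -scalerA !fc scalerA -expr2 sqr_i scaleN1r.
  have -> : f (- x) = - f x by have := fZ (-1) x; rewrite realN1 scaleN1r mulN1r.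
  case: (c) => a b /=; apply/eqP; rewrite eq_complex /=; apply/andP; split; apply/eqP; ring.
exists psi; split=> // x.
  have [w w1 hw] := normc_rot (psi x).
  have := psiZ w x; rewrite hw => h.
  have -> : normc (psi x) = f (w *: x) by have := congr1 (@complex.Re R) h.
  by have := Gp _ _ (fG (w *: x)); rewrite pZ w1 mul1r.
move=> Wx; have fW y : W y -> f y = Re (phi y).
  by move=> Wy; apply: Gfun (fG y) _; apply: G0G.
rewrite /psi !fW //; last exact: WZ.
by rewrite phiZ // mulrC ReiNIm opprK; case: (phi x).
Qed.

End HahnBanach.

(** * Closed subspaces of l^infty as Banach spaces *)

(** Bundled so that one construction turns both the module of the necessity proof and all of
    [l^infty] into complete normed modules, the former for [connes_amenable], the latter for the
    Hahn-Banach extension. *)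
Record closed_subspace (R : realType) (X : choiceType) := ClosedSubspace {
  csubset :> (X -> R[i]) -> Prop;
  cs_zero : csubset (fun=> 0);
  cs_lin : forall c f g, csubset f -> csubset g -> csubset (fun x => c * f x + g x);
  cs_bnd : forall f, csubset f -> exists2 B : R, 0 <= B & bnd f B;
  cs_closed : forall f, (forall e : R, 0 < e -> exists2 g, csubset g &
    forall x, normc (f x - g x) <= e) -> csubset f }.

Section FunctionSpace.
Variables (R : realType) (X : choiceType) (Q : closed_subspace R X).
Local Notation C := R[i].

Record fspace := Fspace { fval :> X -> C; fvalP : Q fval }.

Lemma fspace_eq (f g : fspace) : (forall x, f x = g x) -> f = g.
Proof.
case: f g => f fQ [g gQ] /= /funext fg; case: _ / fg in gQ *.
by congr Fspace; exact: Prop_irrelevance.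
Qed.

HB.instance Definition _ := gen_eqMixin fspace.
HB.instance Definition _ := gen_choiceMixin fspace.

Let lin_csub c f g : Q f -> Q g -> Q (fun x => c * f x + g x).
Proof. exact: cs_lin. Qed.

Lemma csD f g : Q f -> Q g -> Q (fun x => f x + g x).
Proof. by move=> Qf Qg; have := lin_csub 1 Qf Qg; under eq_fun do rewrite mul1r. Qed.

Lemma csZ c f : Q f -> Q (fun x => c * f x).
Proof.
by move=> Qf; have := lin_csub c Qf (cs_zero Q); under eq_fun do rewrite addr0.
Qed.

Lemma csN f : Q f -> Q (fun x => - f x).
Proof. by move=> /(csZ (-1)); under eq_fun do rewrite mulN1r. Qed.

Definition fzero := Fspace (cs_zero Q).
Definition fadd (f g : fspace) := Fspace (csD (fvalP f) (fvalP g)).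
Definition fopp (f : fspace) := Fspace (csN (fvalP f)).
Definition fscale c (f : fspace) := Fspace (csZ c (fvalP f)).

Let faddA : associative fadd.
Proof. by move=> f g h; apply: fspace_eq => x /=; rewrite addrA. Qed.
Let faddC : commutative fadd.
Proof. by move=> f g; apply: fspace_eq => x /=; rewrite addrC. Qed.
Let fadd0 : left_id fzero fadd.
Proof. by move=> f; apply: fspace_eq => x /=; rewrite add0r. Qed.
Let faddN : left_inverse fzero fopp fadd.
Proof. by move=> f; apply: fspace_eq => x /=; rewrite addNr. Qed.

HB.instance Definition _ := GRing.isZmodule.Build fspace faddA faddC fadd0 faddN.

Let fscaleA a b f : fscale a (fscale b f) = fscale (a * b) f.
Proof. by apply: fspace_eq => x /=; rewrite mulrA. Qed.
Let fscale1 : left_id 1 fscale.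
Proof. by move=> f; apply: fspace_eq => x /=; rewrite mul1r. Qed.
Let fscaleDr : right_distributive fscale +%R.
Proof. by move=> c f g; apply: fspace_eq => x /=; rewrite mulrDr. Qed.
Let fscaleDl f : {morph fscale^~ f : a b / a + b}.
Proof. by move=> a b; apply: fspace_eq => x /=; rewrite mulrDl. Qed.

HB.instance Definition _ := GRing.Zmodule_isLmodule.Build C fspace
  fscaleA fscale1 fscaleDr fscaleDl.

Lemma fvalD (f g : fspace) x : (f + g) x = f x + g x. Proof. by []. Qed.
Lemma fvalZ c (f : fspace) x : (c *: f) x = c * f x. Proof. by []. Qed.
Lemma fvalB (f g : fspace) x : (f - g) x = f x - g x. Proof. by []. Qed.
Definition supnorm (f : fspace) : R := inf [set r | 0 <= r /\ bnd f r].

Let has_inf_bounds (f : fspace) : has_inf [set r | 0 <= r /\ bnd f r].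
Proof. by split; [have [B B0 fB] := cs_bnd (fvalP f); exists B|exists 0 => r []]. Qed.

Lemma supnorm_ge0 f : 0 <= supnorm f.
Proof. by apply: lb_le_inf; [exact: (has_inf_bounds f).1|move=> r []]. Qed.

Lemma supnorm_le (f : fspace) r : 0 <= r -> bnd f r -> supnorm f <= r.
Proof. by move=> r0 fr; apply: ge_inf; [exact: (has_inf_bounds f).2|]. Qed.

Lemma bnd_supnorm (f : fspace) : bnd f (supnorm f).
Proof. by move=> x; apply: lb_le_inf; [exact: (has_inf_bounds f).1|move=> r []]. Qed.

Let norm (f : fspace) : C := (supnorm f)%:C.

Let norm_triangle f g : norm (f + g) <= norm f + norm g.
Proof.
rewrite /norm -rmorphD lecR; apply: supnorm_le; first by rewrite addr_ge0 ?supnorm_ge0.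
by move=> x; rewrite fvalD (le_trans (normcD _ _)) // lerD ?bnd_supnorm.
Qed.

Let supnormZ_le c f : supnorm (c *: f) <= normc c * supnorm f.
Proof.
apply: supnorm_le; first by rewrite mulr_ge0 ?normc_ge0 ?supnorm_ge0.
by move=> x; rewrite fvalZ normcM ler_wpM2l ?normc_ge0 ?bnd_supnorm.
Qed.

Let norm_scale (c : C) f : norm (c *: f) = `|c| * norm f.
Proof.
rewrite /norm normcE -rmorphM; congr (_ %:C); apply/eqP.
rewrite eq_le supnormZ_le /=; have [->|c0] := eqVneq c 0.
  by rewrite normc0 mul0r supnorm_ge0.
have n0 : 0 < normc c by rewrite lt_neqAle normc_ge0 eq_sym normc_eq0 c0.
rewrite mulrC -ler_pdivlMr //.
have := supnormZ_le c^-1 (c *: f).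
by rewrite scalerA mulVf // scale1r normcV mulrC.
Qed.

Let norm_eq0 f : norm f = 0 -> f = 0.
Proof.
move=> [] f0; apply: fspace_eq => x; apply: eq0_normc.
by apply/eqP; rewrite eq_le normc_ge0 andbT -f0 bnd_supnorm.
Qed.

HB.instance Definition _ := Lmodule_isNormed.Build C fspace
  norm_triangle norm_scale norm_eq0.

Lemma fnormE (f : fspace) : `|f| = (supnorm f)%:C. Proof. by []. Qed.

Let complete (F : set_system fspace) : ProperFilter F -> cauchy F -> cvg F.
Proof.
move=> FF cF.
have cau (e : R) : 0 < e -> exists g : fspace, F [set h | forall x, normc (g x - h x) <= e].
  move=> e0; have ec : 0 < e%:C :> C by rewrite ltcR.
  have [g Fg] := (iffLR (@cauchyP C fspace F FF) cF) _ ec; exists g.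
  apply: filterS Fg => h; rewrite -ball_normE /ball_ /= => gh x.
  rewrite -fvalB (le_trans (bnd_supnorm _ x)) //.
  by apply: ltW; rewrite -ltcR -fnormE.
have [U [UU FU]] := ultraFilterLemma FF.
have [g0 Fg0] := cau 1 ltr01.
have /choice[f hf] : forall x, exists l : C, forall e : R, 0 < e ->
    U [set h : fspace | normc (h x - l) <= e].
  (* [h x] is replaced by [g0 x] where it is far away, so that the family is bounded for every [h];
     on a set of [U] nothing has changed. *)
  move=> x; pose y (h : fspace) := if normc (g0 x - h x) <= 1 then h x else g0 x.
  have [|l hl] := @ultra_lim R fspace U y (normc (g0 x) + 1) UU.
    move=> h; rewrite /y; case: ifP => [h1|_]; last by rewrite lerDl.
    have := normc_tri (g0 x) (h x) 0; rewrite !subr0 normc_distC; lra.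
  exists l => e e0; apply: filterS (filterI (hl e e0) (FU _ Fg0)) => h /= [h1 h2].
  by rewrite /y h2 in h1.
have near_f (e : R) : 0 < e -> exists2 g : fspace, F [set h : fspace |
    forall x, normc (g x - h x) <= e] & forall x, normc (f x - g x) <= e.
  move=> e0; have [g Fg] := cau e e0; exists g => // x.
  apply/ler_addgt0Pr => d d0.
  have [h /= [h1 /(_ x) h2]] := filter_ex (filterI (hf x d d0) (FU _ Fg)).
  by have := normc_tri (h x) (f x) (g x); rewrite (normc_distC (f x) (h x)) (normc_distC (h x) (g x)); lra.
have Qf : Q f.
  by apply: cs_closed => e e0; have [g _ fg] := near_f e e0; exists g => //; exact: fvalP.
apply/cvg_ex; exists (Fspace Qf); apply/cvg_ballP => e e0.
have /complex_realP[r re] : e \is Num.real by rewrite gtr0_real.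
have r0 : 0 < r by rewrite -ltcR -re.
have r4 : 0 < r / 4 by rewrite divr_gt0.
have [g Fg fg] := near_f _ r4; apply: filterS Fg => h gh.
rewrite -ball_normE /ball_ /= fnormE re ltcR.
apply: (@le_lt_trans _ _ (r / 2)); last lra.
apply: supnorm_le; first lra.
move=> x; rewrite fvalB /=; have := normc_tri (g x) (f x) (h x); have := fg x; have := gh x.
lra.
Qed.

HB.instance Definition _ := Uniform_isComplete.Build fspace complete.

End FunctionSpace.

(** * Weakly almost periodic functions *)

Section WeaklyAlmostPeriodic.
Variables (R : realType) (S : choiceType) (mul : S -> S -> S) (om : S -> R).
Local Notation C := R[i].
Local Notation Om := (Omega mul om).
Local Notation lact := (lact mul om).
Local Notation ract := (ract mul om).
Local Notation Dl := (Dl mul om).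
Local Notation lmod := (lmod mul om).
Local Notation conv := (conv mul om).
Local Notation X := (S * S)%type.
Hypotheses (mulA : associative mul) (wc : weakly_cancellative mul)
  (wt : weight mul om).
Variables (s0 : S) (e : S -> C).
Hypothesis he : is_unit mul om e.
Implicit Types (a b : S -> C) (u v : X -> C) (phi : S -> C) (k h s t : S)
  (M : (X -> C) -> C).

Let se : summable e. Proof. by apply/l1P; case: he. Qed.
Let sdl s : summable (dl s : S -> C). Proof. exact: summable_dl. Qed.

Lemma finite_lmul s t : finite_set [set u | mul s u = t]. Proof. by have [] := wc s t. Qed.
Lemma finite_rmul s t : finite_set [set u | mul u s = t]. Proof. by have [] := wc s t. Qed.

(** The point [(s0, s0)] shows that any radius in [linf_dual] is nonnegative, so the bound has to be
    checked for [0 <= r] only. *)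
Lemma linf_dual_intro M (K : R) : 0 <= K ->
  (forall f g, bounded2 f -> bounded2 g -> M (fun p => f p + g p) = M f + M g) ->
  (forall c f, bounded2 f -> M (fun p => c * f p) = c * M f) ->
  (forall f (r : R), 0 <= r -> bnd f r -> normc (M f) <= K * r) -> linf_dual M.
Proof.
move=> K0 MD MZ MK; split=> //; split=> //; exists K => f r fr.
rewrite -rmorphM lecE_norm; have fr' : bnd f r by move=> p; rewrite -lecE_norm.
by apply: MK => //; apply: le_trans (fr' (s0, s0)); exact: normc_ge0.
Qed.

Definition bounded_op (T : (X -> C) -> X -> C) := exists2 K : R, 0 <= K &
  [/\ forall f g, bounded2 f -> bounded2 g -> T (fun p => f p + g p) = fun p => T f p + T g p,
      forall c f, bounded2 f -> T (fun p => c * f p) = fun p => c * T f p &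
      forall f (r : R), 0 <= r -> bnd f r -> bnd (T f) (K * r)].

(** As [wsc] quantifies over all functionals, a statement about [M] applied to [T] of an orbit is
    the defining property at [M] composed with [T]. *)
Lemma linf_dual_comp M T : linf_dual M -> bounded_op T -> linf_dual (fun f => M (T f)).
Proof.
move=> hM [K K0 [TD TZ TK]]; have [L L0 hL] := dual_bound hM.
have bT f : bounded2 f -> bounded2 (T f).
  move=> /bounded2P[B B0 fB]; apply/bounded2P; exists (K * B); first exact: mulr_ge0.
  exact: TK.
apply: (@linf_dual_intro _ (L * K)).
- exact: mulr_ge0.
- by move=> f g bf bg; rewrite TD // (dualD hM) //; exact: bT.
- by move=> c f bf; rewrite TZ // (dualZ hM) //; exact: bT.
- by move=> f r r0 fr; rewrite -mulrA; apply: hL; [exact: TK|exact: mulr_ge0].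
Qed.

Lemma linf_dual_pair (x : S -> X) a : summable a -> linf_dual (fun f => pair (fun s => f (x s)) a).
Proof.
move=> sa; apply: (@linf_dual_intro _ (n1 a)); first exact: n1_ge0.
- move=> f g /bounded2P[A _ fA] /bounded2P[B _ gB].
  exact: (pairDl (f := fun s => f (x s)) (g := fun s => g (x s)) (fun s => fA (x s)) (fun s => gB (x s)) sa).
- move=> c f /bounded2P[A _ fA].
  exact: (pairZl c (f := fun s => f (x s)) (fun s => fA (x s)) sa).
- move=> f r r0 fr; rewrite mulrC.
  exact: (normc_pair r0 (fun s => fr (x s)) sa).
Qed.

Lemma bounded_op_lact a : summable a -> bounded_op (lact a).
Proof.
move=> sa; exists (n1 a); [exact: n1_ge0|split].
- move=> f g /bounded2P[A A0 fA] /bounded2P[B B0 gB]; apply/funext => p.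
  rewrite -(pairDl (bnd_lact_in wt A0 fA p) (bnd_lact_in wt B0 gB p) sa).
  by apply: eq_pair => k; rewrite mulrDl.
- move=> c f /bounded2P[A A0 fA]; apply/funext => p.
  rewrite -(pairZl c (bnd_lact_in wt A0 fA p) sa).
  by apply: eq_pair => k; rewrite mulrA.
- by move=> f r r0 fr; rewrite mulrC; exact: bnd_lact.
Qed.

Lemma bounded_op_ract a : summable a -> bounded_op (ract^~ a).
Proof.
move=> sa; exists (n1 a); [exact: n1_ge0|split].
- move=> f g /bounded2P[A A0 fA] /bounded2P[B B0 gB]; apply/funext => p.
  rewrite -(pairDl (bnd_ract_in wt A0 fA p) (bnd_ract_in wt B0 gB p) sa).
  by apply: eq_pair => k; rewrite mulrDl.
- move=> c f /bounded2P[A A0 fA]; apply/funext => p.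
  rewrite -(pairZl c (bnd_ract_in wt A0 fA p) sa).
  by apply: eq_pair => k; rewrite mulrA.
- by move=> f r r0 fr; rewrite mulrC; exact: bnd_ract.
Qed.

Lemma bounded_op_id : bounded_op id.
Proof. by exists 1 => //; split=> // f r r0 fr; rewrite mul1r. Qed.

Lemma bounded_op_Dl_col a : summable a -> bounded_op (fun f => Dl (col f a)).
Proof.
move=> sa; exists (n1 a); [exact: n1_ge0|split].
- move=> f g /bounded2P[A A0 fA] /bounded2P[B B0 gB]; apply/funext => p.
  rewrite /Dl -mulrDl; congr (_ * _).
  exact: pairDl (bnd_col_in fA _) (bnd_col_in gB _) sa.
- move=> c f /bounded2P[A A0 fA]; apply/funext => p.
  rewrite /Dl mulrA; congr (_ * _).
  exact: pairZl (bnd_col_in fA _) sa.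
- move=> f r r0 fr; rewrite mulrC; apply: bnd_Dl => //.
    by rewrite mulr_ge0 ?n1_ge0.
  exact: bnd_col.
Qed.

Lemma bounded_opB T T' : bounded_op T -> bounded_op T' ->
  bounded_op (fun f p => T f p - T' f p).
Proof.
move=> [K K0 [TD TZ TK]] [L L0 [TD' TZ' TL]]; exists (K + L); [exact: addr_ge0|split].
- by move=> f g bf bg; rewrite TD // TD' //; apply/funext => p; rewrite opprD addrACA.
- by move=> c f bf; rewrite TZ // TZ' //; apply/funext => p; rewrite mulrBr.
- move=> f r r0 fr p; rewrite mulrDl (le_trans (normcB _ _)) // lerD //.
    exact: TK.
  exact: TL.
Qed.

Section Functional.
Variables (M : (X -> C) -> C) (hM : linf_dual M).

(** [M] is only finitely additive and cannot be moved inside a pointwise sum; but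
    [a |-> M (lact a u)] is bounded for [n1], so [l1_linear_pair] applies. *)
Lemma dual_lact u B a : 0 <= B -> bnd u B -> summable a ->
  M (lact a u) = pair (fun k => M (lact (dl k) u)) a.
Proof.
move=> B0 uB sa; have [K K0 hK] := dual_bound hM; have la : l1 a by apply/l1P.
apply: (l1_linear_pair (L := fun a => M (lact a u)) (K := K * B)) la => [|b /l1P sb].
  split=> [b c /l1P sb /l1P sc|c b /l1P sb].
    rewrite -(dualD hM).
    - by congr M; apply/funext => p; exact: (pairDr (bnd_lact_in wt B0 uB p)).
    - exact: bnd_bounded2 (bnd_lact wt B0 uB sb).
    - exact: bnd_bounded2 (bnd_lact wt B0 uB sc).
  rewrite -(dualZ hM); last exact: bnd_bounded2 (bnd_lact wt B0 uB sb).
  by congr M; apply/funext => p; exact: (pairZr c (bnd_lact_in wt B0 uB p)).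
by rewrite -mulrA; apply: hK; [exact: bnd_lact|rewrite mulr_ge0 ?n1_ge0].
Qed.

Lemma dual_ract u B a : 0 <= B -> bnd u B -> summable a ->
  M (ract u a) = pair (fun k => M (ract u (dl k))) a.
Proof.
move=> B0 uB sa; have [K K0 hK] := dual_bound hM; have la : l1 a by apply/l1P.
apply: (l1_linear_pair (L := fun a => M (ract u a)) (K := K * B)) la => [|b /l1P sb].
  split=> [b c /l1P sb /l1P sc|c b /l1P sb].
    rewrite -(dualD hM).
    - by congr M; apply/funext => p; exact: (pairDr (bnd_ract_in wt B0 uB p)).
    - exact: bnd_bounded2 (bnd_ract wt B0 uB sb).
    - exact: bnd_bounded2 (bnd_ract wt B0 uB sc).
  rewrite -(dualZ hM); last exact: bnd_bounded2 (bnd_ract wt B0 uB sb).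
  by congr M; apply/funext => p; exact: (pairZr c (bnd_ract_in wt B0 uB p)).
by rewrite -mulrA; apply: hK; [exact: bnd_ract|rewrite mulr_ge0 ?n1_ge0].
Qed.

End Functional.

(* The space sigma-WC: functions [u] whose orbit maps [a |-> a . u] and [a |-> u . a] are
   continuous from [sigma(l^1, c_0)] to the weak topology of [l^infty]. *)
Definition wsc u := (exists2 B : R, 0 <= B & bnd u B) /\
  forall M, linf_dual M ->
    c0 (fun k => M (lact (dl k) u)) /\ c0 (fun k => M (ract u (dl k))).

Lemma wsc_lin c u v : wsc u -> wsc v -> wsc (fun p => c * u p + v p).
Proof.
move=> [[A A0 uA] hu] [[B B0 vB] hv]; split.
  exists (normc c * A + B); first by rewrite addr_ge0 ?mulr_ge0 ?normc_ge0.
  by move=> p; rewrite (le_trans (normcD _ _)) // lerD // normcM ler_wpM2l ?normc_ge0.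
have bu : bounded2 u := bnd_bounded2 uA; have bv : bounded2 v := bnd_bounded2 vB.
have bcu : bounded2 (fun p => c * u p).
  apply: (@bnd_bounded2 _ _ _ (normc c * A)) => p.
  by rewrite normcM ler_wpM2l ?normc_ge0.
have lin M : linf_dual M -> M (fun p => c * u p + v p) = c * M u + M v.
  by move=> hM; rewrite (dualD hM) // (dualZ hM).
move=> M hM; split.
  under eq_fun => k do rewrite (dualD (linf_dual_comp hM (bounded_op_lact (sdl k)))) //
    (dualZ (linf_dual_comp hM (bounded_op_lact (sdl k)))) //.
  by apply: c0D; [apply: c0Z|]; [exact: (hu M hM).1|exact: (hv M hM).1].
under eq_fun => k do rewrite (dualD (linf_dual_comp hM (bounded_op_ract (sdl k)))) //
  (dualZ (linf_dual_comp hM (bounded_op_ract (sdl k)))) //.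
by apply: c0D; [apply: c0Z|]; [exact: (hu M hM).2|exact: (hv M hM).2].
Qed.

Lemma wsc0 : wsc (fun=> 0).
Proof.
split; first by exists 0 => // p; rewrite normc0.
move=> M hM; have M0 : M (fun=> 0) = 0.
  have b0 : bounded2 (fun _ : X => 0 : C).
    by apply: (@bnd_bounded2 _ _ _ 0) => p; rewrite normc0.
  by have := dualZ hM 0 b0; rewrite !mul0r.
have T0 T : bounded_op T -> T (fun=> 0) = fun=> 0.
  move=> [K K0 [_ _ /(_ (fun=> 0) 0 (lexx 0))]]; rewrite mulr0 => h.
  apply/funext => p; apply: eq0_normc; apply/eqP; rewrite eq_le normc_ge0 andbT.
  by apply: h => x; rewrite normc0.
split.
  under eq_fun => k do rewrite (T0 _ (bounded_op_lact (sdl k))) M0; exact: c0_cst0.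
by under eq_fun => k do rewrite (T0 _ (bounded_op_ract (sdl k))) M0; exact: c0_cst0.
Qed.

(** Translations by point masses are contractions, so replacing [u] by [v] changes [k |-> M (T k u)]
    by a small amount uniformly in [k], and [c0] is closed under uniform limits. *)
Lemma wsc_closed u : (forall d : R, 0 < d -> exists2 v, wsc v &
  forall x, normc (u x - v x) <= d) -> wsc u.
Proof.
move=> happ.
have [A A0 uA] : exists2 B : R, 0 <= B & bnd u B.
  have [v [[B B0 vB] _] uv] := happ 1 ltr01; exists (B + 1); first by rewrite addr_ge0.
  move=> x; have := normcD (u x - v x) (v x); rewrite subrK.
  have := uv x; have := vB x; lra.
split; first by exists A.
move=> M hM; have [K K0 hK] := dual_bound hM.
have approx (T : S -> (X -> C) -> X -> C) : (forall k, bounded_op (T k)) ->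
    (forall k f (r : R), 0 <= r -> bnd f r -> bnd (T k f) r) ->
    (forall v, wsc v -> c0 (fun k => M (T k v))) -> c0 (fun k => M (T k u)).
  move=> hT T1 Tc; apply: c0_approx => d d0.
  have dd : 0 < d / (K + 1) by rewrite divr_gt0 // ltr_wpDl.
  have [v wv uv] := happ _ dd; exists (fun k => M (T k v)); first exact: Tc.
  move=> k; have hMT := linf_dual_comp hM (hT k); have [[B B0 vB] _] := wv.
  have bNv : bounded2 (fun p => (-1) * v p).
    by apply: (@bnd_bounded2 _ _ _ B) => p; rewrite mulN1r normc_opp.
  have -> : M (T k u) - M (T k v) = M (T k (fun p => u p + (-1) * v p)).
    rewrite (dualD hMT) //; last exact: bnd_bounded2 uA.
    by rewrite (dualZ hMT) ?mulN1r //; exact: bnd_bounded2 vB.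
  apply: le_trans (hK _ _ (T1 k _ _ (ltW dd) _) (ltW dd)) _.
    by move=> p; rewrite mulN1r.
  by rewrite mulrCA ler_piMr ?ltW // ltr_pdivrMr ?ltr_wpDl // mul1r ltrDl.
split; [apply: (approx (fun k => lact (dl k)))|apply: (approx (fun k => ract^~ (dl k)))].
- by move=> k; exact: bounded_op_lact.
- move=> k f r r0 fr; rewrite lact_dl; apply: (@bndM_Omega _ _ _ _ wt _ _ snd (fun=> k)) => // p; exact: fr.
- by move=> v [_ hv]; exact: (hv M hM).1.
- by move=> k; exact: bounded_op_ract.
- by move=> k f r r0 fr; rewrite ract_dl; apply: (@bndM_Omega _ _ _ _ wt _ _ (fun=> k) fst) => // p; exact: fr.
- by move=> v [_ hv]; exact: (hv M hM).2.
Qed.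

Lemma unit_l phi B : 0 <= B -> bnd phi B -> forall a, summable a ->
  pair (fun s => pair (fun t => phi (mul s t) * Om s t) a) e = pair phi a.
Proof.
move=> B0 pB a sa; rewrite -(pair_conv wt se sa B0 pB).
by have [_ /(_ a)] := he; case; [apply/l1P|move=> ->].
Qed.

Lemma unit_r phi B : 0 <= B -> bnd phi B -> forall a, summable a ->
  pair (fun s => pair (fun t => phi (mul s t) * Om s t) e) a = pair phi a.
Proof.
move=> B0 pB a sa; rewrite -(pair_conv wt sa se B0 pB).
by have [_ /(_ a)] := he; case; [apply/l1P|move=> _ ->].
Qed.

(** * Stability and continuity of the orbits of [sigma]-WC functions *)

Section Orbits.
Variables (u : X -> C) (B : R).
Hypotheses (wu : wsc u) (B0 : 0 <= B) (uB : bnd u B).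

(** The semigroup may lack an identity, so the entry is recovered by averaging: pairing
    [h |-> lact (dl k) u (g, h)] with [e] gives [u] at [g] and [e * delta_k = delta_k]. This is a
    functional of the orbit of [u], hence covered by [wsc]. *)
Lemma wsc_row g : c0 (fun k => u (g, k)).
Proof.
have [_ /(_ _ (linf_dual_pair (fun h => (g, h)) se))[+ _]] := wu.
congr c0; apply/funext => k.
rewrite -(pair_dl (fun k => u (g, k)) k) -(unit_l B0 (bnd_col_in uB g) (sdl k)).
by apply: eq_pair => h; rewrite lact_dl pair_dl.
Qed.

Lemma wsc_column h : c0 (fun k => u (k, h)).
Proof.
have [_ /(_ _ (linf_dual_pair (fun g => (g, h)) se))[_ +]] := wu.
congr c0; apply/funext => k.
have uB' : bnd (fun g => u (g, h)) B by move=> g; exact: uB.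
rewrite -(pair_dl (fun k => u (k, h)) k) -(unit_r B0 uB' (sdl k)) pair_dl.
by apply: eq_pair => g; rewrite ract_dl.
Qed.

Lemma wsc_col a : summable a -> c0 (col u a).
Proof.
move=> sa; apply: (c0_pair (w := fun k g => u (g, k)) (B := B) sa).
  by move=> g k; exact: uB.
exact: wsc_column.
Qed.

(** The right orbit is handled by commuting the two actions and composing [M] with [lact a]. On the
    left, [delta_k * a] expands into the terms [M (lact (dl (mul k t)) u)], each vanishing at
    infinity in [k] because [k |-> kt] is finite-to-one, and [c0_pair] sums them. *)
Lemma wsc_lact a : summable a -> wsc (lact a u).
Proof.
move=> sa; split; first by exists (B * n1 a); [rewrite mulr_ge0 ?n1_ge0|exact: bnd_lact].
move=> M hM; have [K K0 hK] := dual_bound hM; split; last first.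
  have [_ /(_ _ (linf_dual_comp hM (bounded_op_lact sa)))[_ +]] := wu.
  by congr c0; apply/funext => k; rewrite (lact_ract wt sa (sdl k) B0 uB).
have [_ /(_ M hM)[c _]] := wu; have [D D0 hD] := c0_bnd c.
pose w t k := M (lact (dl (mul k t)) u) * Om k t.
have -> : (fun k => M (lact (dl k) (lact a u))) = fun k => pair (w^~ k) a.
  apply/funext => k; rewrite -(lact_conv mulA wt (sdl k) sa B0 uB).
  rewrite (dual_lact hM B0 uB (summable_conv wt (sdl k) sa)).
  by rewrite (pair_conv wt (sdl k) sa D0 hD) pair_dl.
apply: (c0_pair (B := D) sa).
  by move=> k t; apply: (@bndM_Omega _ _ _ _ wt _ (fun t => M (lact (dl (mul k t)) u)) (fun=> k) id) => // s; exact: hD.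
move=> t; apply: (@c0_le _ _ _ (fun k => M (lact (dl (mul k t)) u)) 1).
  move=> k; rewrite mul1r /w normcM ler_piMr ?normc_ge0 //; exact: normc_Omega.
exact: (c0_comp (finite_rmul t) c).
Qed.

Lemma wsc_ract a : summable a -> wsc (ract u a).
Proof.
move=> sa; split; first by exists (B * n1 a); [rewrite mulr_ge0 ?n1_ge0|exact: bnd_ract].
move=> M hM; have [K K0 hK] := dual_bound hM; split.
  have [_ /(_ _ (linf_dual_comp hM (bounded_op_ract sa)))[+ _]] := wu.
  by congr c0; apply/funext => k; rewrite (lact_ract wt (sdl k) sa B0 uB).
have [_ /(_ M hM)[_ c]] := wu; have [D D0 hD] := c0_bnd c.
pose w s k := M (ract u (dl (mul s k))) * Om s k.
have -> : (fun k => M (ract (ract u a) (dl k))) = fun k => pair (w^~ k) a.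
  apply/funext => k; rewrite -(ract_conv mulA wt sa (sdl k) B0 uB).
  rewrite (dual_ract hM B0 uB (summable_conv wt sa (sdl k))).
  rewrite (pair_conv wt sa (sdl k) D0 hD).
  by apply: eq_pair => s; rewrite pair_dl.
apply: (c0_pair (B := D) sa).
  by move=> k s; apply: (@bndM_Omega _ _ _ _ wt _ (fun s => M (ract u (dl (mul s k)))) id (fun=> k)) => // t; exact: hD.
move=> s; apply: (@c0_le _ _ _ (fun k => M (ract u (dl (mul s k)))) 1).
  move=> k; rewrite mul1r /w normcM ler_piMr ?normc_ge0 //; exact: normc_Omega.
exact: (c0_comp (finite_lmul s) c).
Qed.

(** Since [col (lact a u) e = col u (e * a) = col u a], the correction in [lmod a u] is obtained
    from [lact a u] by an operator [T] that does not depend on [a]; continuity is then the [wsc]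
    property for [M] composed with [T]. *)
Lemma wcont_lmod M : linf_dual M -> wcont (fun a => M (lmod a u)).
Proof.
move=> hM a0 la0 d d0.
pose T f : X -> C := fun p => f p - Dl (col f e) p.
have hT : linf_dual (fun f => M (T f)).
  by apply: linf_dual_comp hM _; apply: bounded_opB; [exact: bounded_op_id|exact: bounded_op_Dl_col].
have [_ /(_ _ hT)[c _]] := wu.
have E a : l1 a -> M (lmod a u) = pair (fun k => M (T (lact (dl k) u))) a.
  move=> /l1P sa; rewrite -(dual_lact hT B0 uB sa); congr M; apply/funext => p.
  rewrite /T /lmod (col_lact wt se sa B0 uB).
  by have [_ /(_ a)[|-> _]] := he; first by apply/l1P.
have [F [delta [delta0 [F0 h]]]] := wcont_pair c la0 d0.
exists F, delta; split=> //; split=> // a la /(h a la).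
by rewrite !E.
Qed.

Lemma wcont_ract M : linf_dual M -> wcont (fun a => M (ract u a)).
Proof.
move=> hM a0 la0 d d0; have [_ /(_ _ hM)[_ c]] := wu.
have E a : l1 a -> M (ract u a) = pair (fun k => M (ract u (dl k))) a.
  by move=> /l1P sa; exact: dual_ract B0 uB sa.
have [F [delta [delta0 [F0 h]]]] := wcont_pair c la0 d0.
exists F, delta; split=> //; split=> // a la /(h a la).
by rewrite !E.
Qed.

Lemma wcont_eval : wcont (fun a => pair (col u a) e).
Proof.
move=> a0 la0 d d0.
have c : c0 (fun k => pair (fun g => u (g, k)) e).
  apply: (c0_pair (w := fun g k => u (g, k)) (B := B) se); last exact: wsc_row.
  by move=> k g; exact: uB.
have E a : l1 a -> pair (col u a) e = pair (fun k => pair (fun g => u (g, k)) e) a.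
  by move=> /l1P sa; rewrite (pair_swap (w := u) B0 uB se sa).
have [F [delta [delta0 [F0 h]]]] := wcont_pair c la0 d0.
exists F, delta; split=> //; split=> // a la /(h a la).
by rewrite !E.
Qed.

End Orbits.

Lemma weakly_null_c0 M (u : S -> X -> C) B : linf_dual M -> 0 <= B ->
  (forall k, bnd (u k) B) ->
  (forall (U : set_system X) (d : R), UltraFilter U -> 0 < d ->
    finite_set [set k | U [set x | d <= normc (u k x)]]) ->
  c0 (fun k => M (u k)).
Proof.
move=> hM B0 uB hU; apply/c0P => d d0; apply: contrapT => inf.
have [U [d' [UU d'0]]] := not_weakly_null hM B0 uB d0 inf.
by apply; exact: hU.
Qed.

(** Fix [U] and [d]. If some [k0] gives a large value along [U], then [k0] times [mul x.1 x.2] stays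
    in a finite set, so by finiteness of fibres [mul x.1 x.2] is a constant [s] along [U]. Every
    other such [k] then has [phi] large at [k] times [s], which again leaves finitely many [k]. The
    parameter [op] covers both sides. *)
Lemma wsc_Dl phi : c0 phi -> wsc (Dl phi).
Proof.
move=> p0; have [B B0 pB] := c0_bnd p0.
have bD : bnd (Dl phi) B by exact: bnd_Dl.
split; first by exists B.
have key (op : S -> S -> S) (U : set_system X) (d : R) (v : S -> X -> C) :
    (forall k t, finite_set [set s | op k s = t]) ->
    (forall s t, finite_set [set k | op k s = t]) ->
    (forall k x, normc (v k x) <= normc (phi (op k (mul x.1 x.2)))) ->
    UltraFilter U -> 0 < d -> finite_set [set k | U [set x | d <= normc (v k x)]].
  move=> fl fr hv UU d0; set A := [set k | _].
  have [[k0 Ak0]|nA] := pselect (A !=set0); last first.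
    by rewrite (_ : A = set0) // -subset0 => k Ak; apply: nA; exists k.
  move/c0P : (p0) => /(_ d d0); set J := [set g | _] => fJ.
  pose G := \bigcup_(t in J) [set s | op k0 s = t].
  have fG : finite_set G by apply: bigcup_finite => // t _; exact: fl.
  have UG : U (\bigcup_(s in G) [set x | mul x.1 x.2 = s]).
    apply: filterS Ak0 => x /= dx; exists (mul x.1 x.2) => //.
    by exists (op k0 (mul x.1 x.2)) => //; exact: le_trans dx (hv _ _).
  have [s Gs Us] := ultra_bigcup UU fG UG.
  apply: (@sub_finite_set _ _ (\bigcup_(t in J) [set k | op k s = t])); last first.
    by apply: bigcup_finite => // t _; exact: fr.
  move=> k Ak; have [x /= [dx xs]] := filter_ex (filterI (Ak : U _) Us).
  by exists (op k s) => //; rewrite /J /= -xs; exact: le_trans dx (hv _ _).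
move=> M hM; split; apply: (weakly_null_c0 hM B0).
- by move=> k; rewrite lact_dl; apply: (@bndM_Omega _ _ _ _ wt _ _ snd (fun=> k)) => // p; exact: bD.
- move=> U d UU d0; apply: (key (fun k s => mul s k)) => //.
  + by move=> k t; exact: finite_rmul.
  + by move=> s t; exact: finite_lmul.
  + move=> k x; rewrite lact_dl /Dl /= -mulrA mulA normcM ler_piMr ?normc_ge0 //.
    by rewrite normcM mulr_ile1 ?normc_ge0 ?normc_Omega.
- by move=> k; rewrite ract_dl; apply: (@bndM_Omega _ _ _ _ wt _ _ (fun=> k) fst) => // p; exact: bD.
- move=> U d UU d0; apply: (key mul) => //.
  + by move=> k t; exact: finite_lmul.
  + by move=> s t; exact: finite_rmul.
  + move=> k x; rewrite ract_dl /Dl /= -mulrA mulA normcM ler_piMr ?normc_ge0 //.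
    by rewrite normcM mulr_ile1 ?normc_ge0 ?normc_Omega.
Qed.

Lemma wsc_lmod u a : wsc u -> summable a -> wsc (lmod a u).
Proof.
move=> wu sa; have [[B B0 uB] _] := wu.
have := wsc_lin (-1) (wsc_Dl (wsc_col wu B0 uB sa)) (wsc_lact wu B0 uB sa).
by congr wsc; apply/funext => p; rewrite mulN1r addrC.
Qed.

Definition wsc_space := ClosedSubspace wsc0 wsc_lin (fun u => @proj1 _ _) wsc_closed.

(** If the test on ultrafilters failed, [repeated_limits] would produce sequences along which all
    four limits exist while a product that [admissible] forces to vanish has modulus at least
    [d]. *)
Lemma wsc_admissible f : admissible mul om f -> wsc (fun p => f (p.2, p.1)).
Proof.
move=> [/bounded2P[B B0 fB] [fc0 flim]]; set u := fun p => _.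
have uB : bnd u B by move=> p; exact: fB.
split; first by exists B.
(* first component: which product of the repeated limits; second: which factor *)
pose y (i : bool * bool) k (x : X) : C :=
  if i.1 then (if i.2 then f (x.2, mul k x.1) else Om k x.1)
  else (if i.2 then f (mul x.2 k, x.1) else Om x.2 k).
have yB i k x : normc (y i k x) <= B + 1.
  case: i => -[] [] /=; rewrite ?(le_trans (fB _)) ?lerDl //;
    by rewrite (le_trans (normc_Omega wt _ _)) // lerDr.
have key (b : bool) (U : set_system X) (d : R) : UltraFilter U -> 0 < d ->
    (forall x, c0 (fun k => y (b, true) k x)) ->
    finite_set [set k | U [set x | d <= normc (y (b, true) k x * y (b, false) k x)]].
  move=> UU d0 yc; apply: contrapT; set A := [set k | _] => iA.
  (* A principal [U] at [x] would make [y (b, true) k x] at least [d] in modulus for infinitely many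
     [k], against [yc]; hence [U] is free and distinct pairs can be selected from it. *)
  have Uf x : U [set z | z <> x].
    have [Ux|//] := in_ultra_setVsetC [set x] UU; exfalso; apply: iA.
    move/c0P : (yc x) => /(_ d d0); apply: sub_finite_set => k Ak.
    have [z [/= h zx]] := filter_ex (filterI (Ak : U _) Ux); rewrite zx in h; apply: le_trans h _.
    rewrite normcM ler_piMr ?normc_ge0 //.
    by rewrite /y; case: (b); exact: normc_Omega.
  have [k [x [V [L [ki xi VV VA hL]]]]] := repeated_limits UU Uf iA yB.
  (* Ultrafilter limits are multiplicative, so the lower bound [d] on the products along [U], valid
     for [V]-many [k], survives both limits. *)
  have L0 : L (b, true) * L (b, false) != 0.
    rewrite -normc_eq0 gt_eqF // (lt_le_trans d0) // !(hL _).2.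
    have lB i k' : normc (ulim U (y i k')) <= B + 1 by apply: ulim_le.
    rewrite -(ulimM VV (lB _) (lB _)).
    apply: (ulim_ge (A := (B + 1) * (B + 1)) VV).
      by move=> k'; rewrite normcM ler_pM ?normc_ge0.
    apply: filterS VA => k' Ak' /=; rewrite -(ulimM UU (yB _ _) (yB _ _)).
    apply: (ulim_ge (A := (B + 1) * (B + 1)) UU) => // x'.
    by rewrite normcM ler_pM ?normc_ge0.
  have := flim k x ki xi (L (true, true)) (L (true, false)) (L (false, true)) (L (false, false))
    (hL (true, true)).1 (hL (true, false)).1 (hL (false, true)).1 (hL (false, false)).1.
  by move: L0; clear -y; case: b => L0 [[h1|h1] [h2|h2]]; rewrite ?h1 ?h2 ?mul0r ?mulr0 ?eqxx in L0.
move=> M hM; split; apply: (weakly_null_c0 hM B0).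
- by move=> k; rewrite lact_dl; apply: (@bndM_Omega _ _ _ _ wt _ _ snd (fun=> k)) => // p; exact: uB.
- move=> U d UU d0; have := key false U d UU d0; rewrite /y /=.
  under eq_set => k do under eq_set => x do
    rewrite -[_ * _]/((fun p : X => u (p.1, mul p.2 k) * Om p.2 k) x) -lact_dl.
  apply=> x; exact: (c0_comp (finite_lmul x.2) (fc0 x.1).2).
- by move=> k; rewrite ract_dl; apply: (@bndM_Omega _ _ _ _ wt _ _ (fun=> k) fst) => // p; exact: uB.
- move=> U d UU d0; have := key true U d UU d0; rewrite /y /=.
  under eq_set => k do under eq_set => x do
    rewrite -[_ * _]/((fun p : X => u (mul k p.1, p.2) * Om k p.1) x) -ract_dl.
  apply=> x; exact: (c0_comp (finite_rmul x.1) (fc0 x.2).1).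
Qed.

End WeaklyAlmostPeriodic.

(** * Extending functionals from a closed subspace to [l^infty] *)

Section BoundedExtension.
Variables (R : realType) (S : choiceType).
Local Notation C := R[i].
Local Notation X := (S * S)%type.

Lemma bounded_zero : exists2 B : R, 0 <= B & bnd (fun _ : X => 0 : C) B.
Proof. by exists 0 => // p; rewrite normc0. Qed.

Lemma bounded_lin c (f g : X -> C) : (exists2 B : R, 0 <= B & bnd f B) ->
  (exists2 B : R, 0 <= B & bnd g B) -> exists2 B : R, 0 <= B & bnd (fun p => c * f p + g p) B.
Proof.
move=> [A A0 fA] [B B0 gB]; exists (normc c * A + B).
  by rewrite addr_ge0 ?mulr_ge0 ?normc_ge0.
by move=> p; rewrite (le_trans (normcD _ _)) // lerD // normcM ler_wpM2l ?normc_ge0.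
Qed.

Lemma bounded_closed (f : X -> C) : (forall d : R, 0 < d -> exists2 g,
    exists2 B : R, 0 <= B & bnd g B & forall x, normc (f x - g x) <= d) ->
  exists2 B : R, 0 <= B & bnd f B.
Proof.
move=> /(_ 1 ltr01)[g [B B0 gB] fg]; exists (B + 1); first by rewrite addr_ge0.
move=> x; have := normcD (f x - g x) (g x); rewrite subrK.
have := fg x; have := gB x; lra.
Qed.

Definition linf_space := ClosedSubspace bounded_zero bounded_lin (fun f => id) bounded_closed.

(** Hahn-Banach for the seminorm [|K| * supnorm]. The case distinctions only give total functions:
    [phi] is 0 outside the subspace, and [M] is 0 on unbounded functions. *)
Lemma dual_extension (x0 : X) (Q : closed_subspace R X) (mu : fspace Q -> C) : dualE mu ->
  exists2 M, linf_dual M & forall x : fspace Q, M x = mu x.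
Proof.
move=> [muD [muZ [K muK]]].
pose V : lmodType C := fspace linf_space.
pose W : set V := [set v | Q (fval v)].
pose phi (v : V) : C := if pselect (Q (fval v)) is left Qv then mu (Fspace Qv) else 0.
have phiE (v : V) (Qv : Q (fval v)) : phi v = mu (Fspace Qv).
  by rewrite /phi; case: pselect => // Qv'; congr mu; exact: fspace_eq.
pose p (v : V) : R := `|K| * supnorm v.
have [psi [psiD psiZ psip psiW]] : exists psi : V -> C,
  [/\ forall x y, psi (x + y) = psi x + psi y, forall c x, psi (c *: x) = c * psi x,
      forall x, normc (psi x) <= p x & forall x, W x -> psi x = phi x].
  apply: hahn_banach.
  - by move=> x y; rewrite /p -mulrDr ler_wpM2l // -lecR rmorphD; exact: (@ler_normD _ (fspace linf_space)).
  - move=> c x; rewrite /p mulrCA; congr (_ * _); apply: complexI.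
    by rewrite rmorphM; exact: (@normrZ _ (fspace linf_space)).
  - exact: cs_zero.
  - by move=> x y Wx Wy; exact: (csD Wx Wy).
  - by move=> c x Wx; exact: (csZ c Wx).
  - move=> x y Wx Wy; have Wxy : Q (fval (x + y)) := csD Wx Wy.
    rewrite (phiE x Wx) (phiE y Wy) (phiE _ Wxy) -muD.
    by congr mu; exact: fspace_eq.
  - move=> c x Wx; have Wcx : Q (fval (c *: x)) := csZ c Wx.
    rewrite (phiE x Wx) (phiE _ Wcx) -muZ.
    by congr mu; exact: fspace_eq.
  - move=> x Wx; rewrite (phiE x Wx).
    have := muK (Fspace Wx); rewrite fnormE -rmorphM lecE_norm => /le_trans; apply.
    apply: (@le_trans _ _ (`|K| * supnorm (Fspace Wx))).
      by rewrite ler_wpM2r ?supnorm_ge0 // ler_norm.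
    by rewrite ler_wpM2l.
pose M (f : X -> C) : C :=
  if pselect (exists2 B : R, 0 <= B & bnd f B) is left h then psi (@Fspace _ _ linf_space f h) else 0.
have ME (v : V) : M (fval v) = psi v.
  rewrite /M; case: pselect => [h|[]]; last exact: (fvalP v).
  by congr psi; exact: fspace_eq.
have inV (f : X -> C) : bounded2 f -> exists v : V, fval v = f.
  by move=> /bounded2P h; exists (@Fspace _ _ linf_space f h).
exists M.
  split.
    move=> _ _ /inV[f <-] /inV[g <-]; rewrite !ME -psiD -ME.
    by congr M.
  split.
    by move=> c _ /inV[f <-]; rewrite !ME -psiZ -ME; congr M.
  exists `|K| => f r fr; have [v vf] : exists v : V, fval v = f by apply: inV; exists r.
  rewrite -vf ME -rmorphM lecE_norm (le_trans (psip v)) // /p.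
  have r0 : 0 <= r by apply: le_trans (normc_ge0 (f x0)) _; rewrite -lecE_norm.
  by rewrite ler_wpM2l //; apply: supnorm_le => // y; rewrite vf -lecE_norm.
move=> x; have [B B0 xB] := cs_bnd (fvalP x).
have [v vx] : exists v : V, fval v = x by apply: inV; exact: bnd_bounded2 xB.
rewrite -{1}vx ME psiW; last by rewrite /W /= vx; exact: fvalP.
have Qv : Q (fval v) by rewrite vx; exact: fvalP.
by rewrite (phiE v Qv); congr mu; apply: fspace_eq => y /=; rewrite vx.
Qed.

End BoundedExtension.

(** * Necessity *)

Section Necessity.
Variables (R : realType) (S : choiceType) (mul : S -> S -> S) (om : S -> R).
Local Notation C := R[i].
Local Notation Om := (Omega mul om).
Local Notation lact := (lact mul om).
Local Notation ract := (ract mul om).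
Local Notation Dl := (Dl mul om).
Local Notation lmod := (lmod mul om).
Local Notation conv := (conv mul om).
Local Notation X := (S * S)%type.
Hypotheses (mulA : associative mul) (wc : weakly_cancellative mul)
  (wt : weight mul om).
Variables (s0 : S) (e : S -> C).
Hypothesis he : is_unit mul om e.

Let se : summable e. Proof. by apply/l1P; case: he. Qed.
Let E := fspace (wsc_space wt s0).

Lemma wcont_ext (phi psi : (S -> C) -> C) : (forall a, l1 a -> phi a = psi a) ->
  wcont psi -> wcont phi.
Proof.
move=> h c a0 la0 d d0; have [F [delta [delta0 [F0 hF]]]] := c a0 la0 d d0.
by exists F, delta; split=> //; split=> // a la /(hF a la); rewrite !h.
Qed.

Lemma bndE (x : E) : bnd x (supnorm x). Proof. exact: bnd_supnorm. Qed.

Lemma wscE (x : E) : wsc mul om x. Proof. exact: (fvalP x). Qed.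

(** A bimodule acts by arbitrary functions [a], but [lmod a] preserves the space only for [a] in
    [l^1]; elsewhere the action is set to 0. *)
Definition left_act (a : S -> C) (x : E) : E :=
  if pselect (l1 a) is left la
  then Fspace (wsc_lmod mulA wc wt s0 he (wscE x) (iffLR (l1P a) la) : wsc_space wt s0 _) else 0.

Definition right_act (x : E) (a : S -> C) : E :=
  if pselect (l1 a) is left la
  then Fspace (wsc_ract mulA wc wt s0 (wscE x) (supnorm_ge0 x) (bndE x) (iffLR (l1P a) la)
                : wsc_space wt s0 _) else 0.

Lemma left_actE a (x : E) : l1 a -> fval (left_act a x) = lmod a x.
Proof. by rewrite /left_act; case: pselect. Qed.

Lemma right_actE a (x : E) : l1 a -> fval (right_act x a) = ract x a.
Proof. by rewrite /right_act; case: pselect. Qed.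

Section Pointwise.
Variables (a b : S -> C) (u v : X -> C) (A B : R).
Hypotheses (A0 : 0 <= A) (uA : bnd u A) (B0 : 0 <= B) (vB : bnd v B).
Hypotheses (sa : summable a) (sb : summable b).

Lemma lmodDa : lmod (addf a b) u = fun p => lmod a u p + lmod b u p.
Proof.
apply/funext => p; rewrite /lmod /lact (pairDr (bnd_lact_in wt A0 uA p) sa sb).
by rewrite /Dl /col (pairDr (bnd_col_in uA _) sa sb); ring.
Qed.

Lemma lmodZa c : lmod (sclf c a) u = fun p => c * lmod a u p.
Proof.
apply/funext => p; rewrite /lmod /lact (pairZr c (bnd_lact_in wt A0 uA p) sa).
by rewrite /Dl /col (pairZr c (bnd_col_in uA _) sa); ring.
Qed.

Lemma lmodD : lmod a (fun p => u p + v p) = fun p => lmod a u p + lmod a v p.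
Proof.
apply/funext => p; rewrite /lmod /Dl /col.
rewrite (pairDl (bnd_col_in uA _) (bnd_col_in vB _) sa).
have -> : lact a (fun p => u p + v p) p = lact a u p + lact a v p.
  rewrite -(pairDl (bnd_lact_in wt A0 uA p) (bnd_lact_in wt B0 vB p) sa).
  by apply: eq_pair => k; rewrite mulrDl.
by ring.
Qed.

Lemma lmodZ c : lmod a (fun p => c * u p) = fun p => c * lmod a u p.
Proof.
apply/funext => p; rewrite /lmod /Dl /col (pairZl c (bnd_col_in uA _) sa).
have -> : lact a (fun p => c * u p) p = c * lact a u p.
  rewrite -(pairZl c (bnd_lact_in wt A0 uA p) sa).
  by apply: eq_pair => k; rewrite mulrA.
by ring.
Qed.

Lemma ractDa : ract u (addf a b) = fun p => ract u a p + ract u b p.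
Proof. by apply/funext => p; exact: (pairDr (bnd_ract_in wt A0 uA p) sa sb). Qed.

Lemma ractZa c : ract u (sclf c a) = fun p => c * ract u a p.
Proof. by apply/funext => p; exact: (pairZr c (bnd_ract_in wt A0 uA p) sa). Qed.

Lemma ractD : ract (fun p => u p + v p) a = fun p => ract u a p + ract v a p.
Proof.
apply/funext => p.
rewrite -(pairDl (bnd_ract_in wt A0 uA p) (bnd_ract_in wt B0 vB p) sa).
by apply: eq_pair => k; rewrite mulrDl.
Qed.

Lemma ractZ c : ract (fun p => c * u p) a = fun p => c * ract u a p.
Proof.
apply/funext => p; rewrite -(pairZl c (bnd_ract_in wt A0 uA p) sa).
by apply: eq_pair => k; rewrite mulrA.
Qed.

Lemma ractB : ract (fun p => u p - v p) a = fun p => ract u a p - ract v a p.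
Proof.
apply/funext => p; have := ractD; have := ractZ (-1).
have vN : bnd (fun p => - v p) B by move=> q; rewrite normc_opp.
have -> : ract u a p - ract v a p = ract u a p + (-1) * ract v a p by rewrite mulN1r.
rewrite -(pairZl (-1) (bnd_ract_in wt B0 vB p) sa).
have vZ : bnd (fun k => (-1) * (v (mul k p.1, p.2) * Om k p.1)) B.
  by move=> k; rewrite mulN1r normc_opp; exact: (bnd_ract_in wt B0 vB p).
move=> _ _; rewrite -(pairDl (bnd_ract_in wt A0 uA p) vZ sa).
by apply: eq_pair => k; ring.
Qed.

Lemma lactB : lact a (fun p => u p - v p) = fun p => lact a u p - lact a v p.
Proof.
apply/funext => p.
have -> : lact a u p - lact a v p = lact a u p + (-1) * lact a v p by rewrite mulN1r.
rewrite -(pairZl (-1) (bnd_lact_in wt B0 vB p) sa).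
have vZ : bnd (fun k => (-1) * (v (p.1, mul p.2 k) * Om p.2 k)) B.
  by move=> k; rewrite mulN1r normc_opp; exact: (bnd_lact_in wt B0 vB p).
rewrite -(pairDl (bnd_lact_in wt A0 uA p) vZ sa).
by apply: eq_pair => k; ring.
Qed.

Lemma colB g : col (fun p => u p - v p) a g = col u a g - col v a g.
Proof.
have -> : col u a g - col v a g = col u a g + (-1) * col v a g by rewrite mulN1r.
rewrite /col -(pairZl (-1) (bnd_col_in vB g) sa).
have vZ : bnd (fun k => (-1) * v (g, k)) B.
  by move=> k; rewrite mulN1r normc_opp; exact: vB.
rewrite -(pairDl (bnd_col_in uA g) vZ sa).
by apply: eq_pair => k; ring.
Qed.

Lemma lmod_Dl phi : bnd phi A -> lmod a (Dl phi) = fun=> 0.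
Proof.
by move=> pA; apply/funext => p; rewrite /lmod (lact_Dl mulA wt sa A0 pA) subrr.
Qed.

End Pointwise.

(** As [lmod a] kills the range of [Dl], it sends [lmod b u] and [lact b u] to the same function,
    and [col_lact] identifies the remaining correction with that of [conv a b]. *)
Lemma lmod_conv a b u A : 0 <= A -> bnd u A -> summable a -> summable b ->
  lmod (conv a b) u = lmod a (lmod b u).
Proof.
move=> A0 uA sa sb; have Ab : 0 <= A * n1 b by rewrite mulr_ge0 ?n1_ge0.
have bl := bnd_lact wt A0 uA sb; have bc := bnd_col A0 uA sb.
have bD := bnd_Dl wt Ab bc.
apply/funext => p; rewrite {2 3}/lmod /lmod (lactB Ab bl Ab bD sa) (lact_conv mulA wt sa sb A0 uA).
rewrite (lact_Dl mulA wt sa Ab bc) /Dl (colB bl bD sa) (col_lact wt sa sb A0 uA).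
by rewrite /Dl; ring.
Qed.

Lemma lmod_ract a b u A : 0 <= A -> bnd u A -> summable a -> summable b ->
  lmod a (ract u b) = ract (lmod a u) b.
Proof.
move=> A0 uA sa sb; have Aa : 0 <= A * n1 a by rewrite mulr_ge0 ?n1_ge0.
have bl := bnd_lact wt A0 uA sa; have bD := bnd_Dl wt Aa (bnd_col A0 uA sa).
rewrite /lmod (ractB Aa bl Aa bD sb); apply/funext => p.
by rewrite (lact_ract wt sa sb A0 uA) (Dl_col_ract mulA wt sa sb A0 uA).
Qed.

Lemma wsc_bimodule : banach_bimodule mul om left_act right_act.
Proof.
have B (x : E) := bndE x; have B0 (x : E) := supnorm_ge0 x.
do 12?split.
- move=> a b x la lb; apply: fspace_eq => p; rewrite fvalD !left_actE //; last exact: l1D.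
  by rewrite (lmodDa (B0 x) (B x) (iffLR (l1P _) la) (iffLR (l1P _) lb)).
- move=> c a x la; apply: fspace_eq => p; rewrite fvalZ !left_actE //; last exact: l1Z.
  by rewrite (lmodZa (B0 x) (B x) (iffLR (l1P _) la)).
- move=> a x y la; apply: fspace_eq => p; rewrite fvalD !left_actE //.
  exact: (congr1 (@^~ p) (lmodD (B0 x) (B x) (B0 y) (B y) (iffLR (l1P _) la))).
- move=> c a x la; apply: fspace_eq => p; rewrite fvalZ !left_actE //.
  exact: (congr1 (@^~ p) (lmodZ (B0 x) (B x) (iffLR (l1P _) la) c)).
- move=> a b x la lb; apply: fspace_eq => p; rewrite fvalD !right_actE //; last exact: l1D.
  by rewrite (ractDa (B0 x) (B x) (iffLR (l1P _) la) (iffLR (l1P _) lb)).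
- move=> c a x la; apply: fspace_eq => p; rewrite fvalZ !right_actE //; last exact: l1Z.
  by rewrite (ractZa (B0 x) (B x) (iffLR (l1P _) la)).
- move=> a x y la; apply: fspace_eq => p; rewrite fvalD !right_actE //.
  exact: (congr1 (@^~ p) (ractD (B0 x) (B x) (B0 y) (B y) (iffLR (l1P _) la))).
- move=> c a x la; apply: fspace_eq => p; rewrite fvalZ !right_actE //.
  exact: (congr1 (@^~ p) (ractZ (B0 x) (B x) (iffLR (l1P _) la) c)).
- move=> a b x la lb; apply: fspace_eq => p; rewrite !left_actE //; last exact: l1_conv.
  by rewrite (lmod_conv (B0 x) (B x) (iffLR (l1P _) la) (iffLR (l1P _) lb)).
- move=> a b x la lb; apply: fspace_eq => p; rewrite !right_actE //; last exact: l1_conv.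
  by rewrite (ract_conv mulA wt (iffLR (l1P _) la) (iffLR (l1P _) lb) (B0 x) (B x)).
- move=> a b x la lb; apply: fspace_eq => p; rewrite left_actE // !right_actE // left_actE //.
  by rewrite (lmod_ract (B0 x) (B x) (iffLR (l1P _) la) (iffLR (l1P _) lb)).
- exists 2 => a x /[dup] la /l1P sa; rewrite (l1norm_n1 sa) !fnormE -!rmorphM lecR.
  apply: supnorm_le; first by rewrite !mulr_ge0 ?n1_ge0 ?supnorm_ge0.
  rewrite left_actE // -mulrA [n1 a * _]mulrC; exact: bnd_lmod.
- exists 1 => a x /[dup] la /l1P sa; rewrite (l1norm_n1 sa) !fnormE -!rmorphM lecR.
  apply: supnorm_le; first by rewrite !mulr_ge0 ?n1_ge0 ?supnorm_ge0.
  rewrite right_actE // mul1r mulrC; exact: bnd_ract.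
Qed.

Lemma wsc_normal : normal_dual left_act right_act.
Proof.
move=> mu /(dual_extension (s0, s0))[M hM Mmu]; split=> x.
  apply: wcont_ext (wcont_ract wt (wscE x) (supnorm_ge0 x) (bndE x) hM) => a la.
  by rewrite -Mmu right_actE.
apply: wcont_ext (wcont_lmod wt s0 he (wscE x) (supnorm_ge0 x) (bndE x) hM) => a la.
by rewrite -Mmu left_actE.
Qed.

Definition eval_der (a : S -> C) (x : E) : C := pair (col x a) e.

Lemma eval_der_wcont : wstar_cont eval_der.
Proof. by move=> x; exact: (wcont_eval wt s0 he (wscE x) (supnorm_ge0 x) (bndE x)). Qed.

(** Write [x (a, b)] for the value of [x] at [a (x) b]. The right action contributes [x (a, b)] and
    the left action [x (e, ab) - x (a, b)], so the sum is [x (e, ab)]. The identities [e * a = a]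
    and [a * e = a] enter through [unit_l] and [unit_r]. *)
Lemma eval_der_derivation : derivation mul om left_act right_act eval_der.
Proof.
have B (x : E) := bndE x; have B0 (x : E) := supnorm_ge0 x.
have bc (x : E) a (sa : summable a) := bnd_col (B0 x) (B x) sa.
split; [|split; [|split]].
- move=> a /l1P sa; split=> [x y|].
    rewrite /eval_der -(pairDl (bc x a sa) (bc y a sa) se); apply: eq_pair => g.
    by rewrite /col -(pairDl (bnd_col_in (B x) g) (bnd_col_in (B y) g) sa).
  split=> [c x|].
    rewrite /eval_der -(pairZl c (bc x a sa) se); apply: eq_pair => g.
    by rewrite /col -(pairZl c (bnd_col_in (B x) g) sa).
  exists (n1 a * n1 e) => x; rewrite fnormE -rmorphM lecE_norm.
  rewrite mulrC mulrA; apply: normc_pair (bc x a sa) se.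
  by rewrite mulr_ge0 ?n1_ge0 ?supnorm_ge0.
- move=> a b x /l1P sa /l1P sb; rewrite /eval_der -(pairDl (bc x a sa) (bc x b sb) se).
  by apply: eq_pair => g; rewrite /col (pairDr (bnd_col_in (B x) g) sa sb).
- move=> c a x /l1P sa; rewrite /eval_der -(pairZl c (bc x a sa) se).
  by apply: eq_pair => g; rewrite /col (pairZr c (bnd_col_in (B x) g) sa).
move=> a b x /[dup] la /l1P sa /[dup] lb /l1P sb.
have Bb : 0 <= supnorm x * n1 b by rewrite mulr_ge0 ?n1_ge0 ?supnorm_ge0.
have cb := bc x b sb.
have h1 : eval_der b (right_act x a) = pair (col x b) a.
  rewrite /eval_der right_actE // -(unit_r wt he Bb cb sa).
  rewrite -(pair_swap (w := fun p => col x b (mul p.2 p.1) * Om p.2 p.1) Bb _ se sa); last first.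
    by apply: (@bndM_Omega _ _ _ _ wt _ (fun p : X => col x b (mul p.2 p.1)) snd fst) => // p; exact: cb.
  apply: eq_pair => g; rewrite /col /ract /=.
  pose w (p : X) := x (mul p.2 g, p.1) * Om p.2 g.
  rewrite (pair_swap (w := w) (B0 x) _ sb sa); last first.
    by apply: (@bndM_Omega _ _ _ _ wt _ (fun p : X => x (mul p.2 g, p.1)) snd (fun=> g)) => // p; exact: B.
  apply: eq_pair => s; rewrite /w /= mulrC -(pairZl _ (bnd_col_in (B x) (mul s g)) sb).
  by apply: eq_pair => t; rewrite mulrC.
have h2 : eval_der a (left_act b x) = pair (col x (conv a b)) e - pair (col x b) a.
  rewrite /eval_der left_actE // -(unit_l wt he Bb cb sa).
  have cc : bnd (col x (conv a b)) (supnorm x * n1 (conv a b)).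
    by apply: bc; exact: summable_conv.
  pose q s := pair (fun t => col x b (mul s t) * Om s t) a.
  have bq : bnd q (supnorm x * n1 b * n1 a).
    apply: bnd_pair => // s.
    by apply: (@bndM_Omega _ _ _ _ wt _ (fun t => col x b (mul s t)) (fun=> s) id) => // t; exact: cb.
  have bq' : bnd (fun s => (-1) * q s) (supnorm x * n1 b * n1 a).
    by move=> s; rewrite mulN1r normc_opp; exact: bq.
  rewrite -/q -mulN1r -(pairZl (-1) bq se) -(pairDl cc bq' se).
  apply: eq_pair => g; rewrite mulN1r /lmod.
  rewrite (colB (bnd_lact wt (B0 x) (B x) sb) (bnd_Dl wt Bb cb) sa).
  by rewrite (col_lact wt sa sb (B0 x) (B x)).
by rewrite h1 h2 /eval_der addrCA subrr addr0.
Qed.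

Lemma connes_amenable_virtual_diagonal : connes_amenable mul om ->
  exists M : (X -> C) -> C, linf_dual M /\
    (forall f : S -> C, c0 f ->
       M (fun p => f (mul p.1 p.2) * Om p.1 p.2) = pair f e) /\
    (forall (k : S) (f : X -> C), admissible mul om f ->
       M (fun p => f (mul p.2 k, p.1) * Om p.2 k - f (p.2, mul k p.1) * Om k p.1) = 0).
Proof.
move=> /(_ _ _ _ wsc_bimodule wsc_normal _ eval_der_derivation eval_der_wcont).
move=> [mu [dmu inn]]; have [M hM Mmu] := dual_extension (s0, s0) dmu.
have le : l1 e by case: he.
have M1 f : c0 f -> M (Dl f) = pair f e.
  move=> f0; have [B B0 fB] := c0_bnd f0.
  have wf : wsc_space wt s0 (Dl f) := wsc_Dl mulA wc wt f0.
  have := inn e (Fspace wf) le; rewrite -!Mmu left_actE // right_actE //=.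
  rewrite (lmod_Dl B0 se fB) => h.
  have M0 : M (fun=> 0) = 0.
    have b0 : bounded2 (fun _ : X => 0 : C).
      by apply: (@bnd_bounded2 _ _ _ 0) => p; rewrite normc0.
    by have := dualZ hM 0 b0; rewrite !mul0r.
  move: h; rewrite M0 subr0.
  (* At [a = e] the left action has disappeared, and the right action of [e] fixes the range of
     [Dl]; so [M (Dl f)] is the value of the derivation, the pairing of [f] with [e * e]. *)
  have -> : ract (Dl f) e = Dl f.
    apply/funext => -[g h]; rewrite /ract /Dl /=.
    have fgh := unit_l wt he B0 fB (summable_dl _ (mul g h)).
    rewrite pair_dl in fgh; rewrite -fgh mulrC.
    under [in RHS]eq_fun do rewrite pair_dl.
    have bf : bnd (fun s => f (mul s (mul g h)) * Om s (mul g h)) B.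
      by apply: (@bndM_Omega _ _ _ _ wt _ (fun s => f (mul s (mul g h))) id (fun=> mul g h)) => // s; exact: fB.
    rewrite -(pairZl _ bf se); apply: eq_pair => k.
    rewrite -mulA; ring: (Omega_cocycle mulA wt k g h).
  move=> <-; rewrite /eval_der /= -(unit_l wt he B0 fB se).
  by [].
exists M; split=> //; split=> // k f /(wsc_admissible wc wt); set u := fun p : X => _ => wu.
have wf : wsc_space wt s0 u := wu.
have [[B B0 uB] _] := wu; have sk := summable_dl R k; have lk := l1_dl R k.
have := inn (dl k) (Fspace wf) lk; rewrite -!Mmu left_actE // right_actE //=.
have c0u := wsc_col wt s0 he wu B0 uB sk.
(* By (1) the value of the derivation at [dl k] is [M] of the correction term in [lmod]. The two
   cancel and leave [M (lact (dl k) u) = M (ract u (dl k))]. *)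
rewrite /eval_der /= -(M1 _ c0u) => h.
have b1 := bnd_lact wt B0 uB sk; have b2 := bnd_ract wt B0 uB sk.
have Bk : 0 <= B * n1 (dl k : S -> C) by rewrite mulr_ge0 ?n1_ge0.
have b3 := bnd_Dl wt Bk (bnd_col B0 uB sk).
have MB f1 f2 A1 A2 : bnd f1 A1 -> bnd f2 A2 -> M (fun p => f1 p - f2 p) = M f1 - M f2.
  move=> c1 c2; rewrite -mulN1r -(dualZ hM); last exact: bnd_bounded2 c2.
  rewrite -(dualD hM); [|exact: bnd_bounded2 c1|].
    by congr M; apply/funext => p; rewrite mulN1r.
  by apply: (@bnd_bounded2 _ _ _ A2) => p; rewrite mulN1r normc_opp.
rewrite (MB _ _ _ _ b1 b3) in h.
transitivity (M (fun p => lact (dl k) u p - ract u (dl k) p)).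
  by congr M; apply/funext => p; rewrite lact_dl ract_dl.
rewrite (MB _ _ _ _ b1 b2).
move: h; move: (M (Dl _)) (M (ract _ _)) (M (lact _ _)) => x y z h.
have : x - (y - (z - x)) = 0 by rewrite -h subrr.
by move=> h'; rewrite -h'; ring.
Qed.

End Necessity.

(** * Uniform boundedness *)

Section UniformBoundedness.
Variables (R : realType) (E : completeNormedModType R[i]).
Local Notation C := R[i].
Implicit Types x y z : E.

Definition nr x : R := Re `|x|.

Lemma nrE x : `|x| = (nr x)%:C.
Proof. by rewrite /nr RRe_real // normr_real. Qed.

Lemma nr_ge0 x : 0 <= nr x. Proof. by rewrite -ler0c -nrE. Qed.
Lemma nrD x y : nr (x + y) <= nr x + nr y.
Proof. by rewrite -lecR rmorphD /= -!nrE ler_normD. Qed.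
Lemma nrN x : nr (- x) = nr x. Proof. by rewrite /nr normrN. Qed.
Lemma nrZ (c : C) x : nr (c *: x) = normc c * nr x.
Proof. by apply: complexI; rewrite -nrE normrZ rmorphM /= -nrE. Qed.
Lemma nr_distC x y : nr (x - y) = nr (y - x). Proof. by rewrite -nrN opprB. Qed.
Lemma nr_tri z x y : nr (x - y) <= nr (x - z) + nr (z - y).
Proof. by have := nrD (x - z) (z - y); rewrite addrA subrK. Qed.
Lemma nr_eq0 x : nr x = 0 -> x = 0.
Proof. by move=> x0; apply/eqP; rewrite -normr_eq0 nrE x0. Qed.

Section Functional.
Variables (mu : E -> C) (hmu : dualE mu).

Lemma dualED x y : mu (x + y) = mu x + mu y. Proof. by case: hmu => h _; exact: h. Qed.
Lemma dualEZ c x : mu (c *: x) = c * mu x. Proof. by case: hmu => _ [h _]; exact: h. Qed.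
Lemma dualE0 : mu 0 = 0.
Proof. by have := dualEZ 0 0; rewrite scale0r mul0r. Qed.
Lemma dualEN x : mu (- x) = - mu x.
Proof. by have := dualEZ (-1) x; rewrite scaleN1r mulN1r. Qed.
Lemma dualEB x y : mu (x - y) = mu x - mu y. Proof. by rewrite dualED dualEN. Qed.
Lemma dualE_bound : exists2 K : R, 0 <= K & forall x, normc (mu x) <= K * nr x.
Proof.
case: hmu => _ [_ [K hK]]; exists `|K| => // x.
have := hK x; rewrite nrE -rmorphM lecE_norm => /le_trans; apply.
by rewrite ler_wpM2r ?nr_ge0 // ler_norm.
Qed.
End Functional.

Lemma dualE_intro (mu : E -> C) (K : R) : (forall x y, mu (x + y) = mu x + mu y) ->
  (forall c x, mu (c *: x) = c * mu x) -> (forall x, normc (mu x) <= K * nr x) -> dualE mu.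
Proof.
move=> mD mZ mK; split=> //; split=> //; exists K => x.
by rewrite nrE -rmorphM lecE_norm.
Qed.

Lemma cauchy_nr_limit (z : nat -> E) :
  (forall n m, (n <= m)%N -> nr (z m - z n) <= n.+1%:R^-1) ->
  exists x, forall e : R, 0 < e -> exists N, forall n, (N <= n)%N -> nr (x - z n) <= e.
Proof.
move=> hz.
have small (e : R) : 0 < e -> exists N : nat, N.+1%:R^-1 < e.
  move=> e0; exists (Num.trunc e^-1).
  by rewrite -[ltRHS]invrK ltf_pV2 ?posrE ?invr_gt0 // truncnS_gt.
have real (e : C) : 0 < e -> exists2 r : R, 0 < r & e = r%:C.
  move=> e0; have /complex_realP[r re] : e \is Num.real by rewrite gtr0_real.
  by exists r => //; rewrite -ltcR -re.
have : cvg (z @ \oo).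
  apply: cauchy_cvg; apply: cauchy_exP => _ /real[r r0 ->].
  have [N hN] := small r r0; exists (z N); exists N => // m /= Nm.
  by rewrite -ball_normE /ball_ /= nrE ltcR nr_distC (le_lt_trans (hz _ _ Nm)).
move=> /cvg_ex[x zx]; exists x => e e0.
have ec : 0 < e%:C :> C by rewrite ltcR.
have [N _ hN] := iffLR (cvgrPdist_lt _ _) zx _ ec.
by exists N => n /hN /=; rewrite nrE ltcR => /ltW.
Qed.

(** Nested balls: without a common bound, every ball contains a smaller one on which some [mu i] is
    at least [n]; the common point of the balls contradicts pointwise boundedness. *)
Lemma uniform_boundedness (I : Type) (mu : I -> E -> C) : (forall i, dualE (mu i)) ->
  (forall x, exists B : R, forall i, normc (mu i x) <= B) ->
  exists2 K : R, 0 <= K & forall i x, normc (mu i x) <= K * nr x.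
Proof.
move=> hmu pb; apply: contrapT => nK.
(* Positivity of the radius is a hypothesis on the chosen value, so that [choice] yields a total
   function that can be iterated. *)
have step (q : (E * R) * nat) : exists q' : E * R, 0 < q.1.2 ->
    [/\ 0 < q'.2, q'.2 <= q.2.+1%:R^-1, nr (q'.1 - q.1.1) + q'.2 <= q.1.2 &
      exists i, forall x, nr (x - q'.1) <= q'.2 -> q.2%:R <= normc (mu i x)].
  case: q => -[c r] n /=; have [r0|nr0] := pselect (0 < r); last by exists (c, r).
  (* The factor is such that the multiple [y] of [x] with norm [r / 2] satisfies
     [normc (mu i y) > n + 1]. *)
  have [i [x hx]] : exists i x, (2 * (n.+1%:R) / r) * nr x < normc (mu i x).
    apply: contrapT => nix; apply: nK; exists (2 * n.+1%:R / r).
      by rewrite divr_ge0 ?mulr_ge0 // ltW.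
    by move=> i x; rewrite leNgt; apply/negP => h; apply: nix; exists i, x.
  have nx0 : 0 < nr x.
    rewrite lt_neqAle nr_ge0 andbT eq_sym; apply/eqP => /nr_eq0 x0.
    by move: hx; rewrite x0 (dualE0 (hmu i)) normc0 /nr normr0 mulr0 ltxx.
  pose y := (r / 2 / nr x)%:C *: x.
  have t0 : 0 < r / 2 / nr x by rewrite !divr_gt0.
  have ny : nr y = r / 2 by rewrite nrZ normc_real gtr0_norm // divfK // gt_eqF.
  have hy : n.+1%:R <= normc (mu i y).
    rewrite /y (dualEZ (hmu i)) normcM normc_real gtr0_norm // ltW //.
    have -> : n.+1%:R = r / 2 / nr x * (2 * n.+1%:R / r * nr x).
      by field; rewrite !gt_eqF.
    by rewrite ltr_pM2l.
  (* The values at [c + y] and [c - y] differ by [2 * mu i y], so one of them is at least as large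
     as [mu i y]. *)
  have [z nz hz] : exists2 z, nr (z - c) <= r / 2 & n.+1%:R <= normc (mu i z).
    have [h|h] := lerP (n.+1%:R) (normc (mu i (c + y))).
      by exists (c + y) => //; rewrite addrAC subrr add0r ny.
    exists (c - y); first by rewrite addrAC subrr add0r nrN ny.
    have := normcB (mu i (c + y)) (mu i (c - y)).
    rewrite (dualED (hmu i)) (dualEB (hmu i)) in h *.
    have -> : mu i c + mu i y - (mu i c - mu i y) = 2 * mu i y by ring.
    rewrite normcM (_ : normc 2 = 2); last by rewrite -[RHS]ger0_norm // -normc_real rmorph_nat.
    lra.
  have [K K0 hK] := dualE_bound (hmu i).
  (* The bound [r / 2] keeps the new ball inside the old one, [(K + 1)^-1] lets [mu i] drop by at
     most 1 on it, from [n + 1] to [n], and [n.+1^-1] makes the centres Cauchy. *)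
  pose s := Order.min (r / 2) (Order.min (K + 1)^-1 n.+1%:R^-1).
  have K1 : 0 < K + 1 by rewrite ltr_wpDl.
  have [s1 s2 s3] : [/\ s <= r / 2, s <= (K + 1)^-1 & s <= n.+1%:R^-1].
    by rewrite /s !ge_min !lexx !orbT.
  have s0 : 0 < s by rewrite /s !lt_min invr_gt0 K1 invr_gt0 ltr0Sn divr_gt0.
  exists (z, s) => _ /=; split=> //; first lra.
  exists i => w hw.
  have h1 : normc (mu i (z - w)) <= 1.
    apply: le_trans (hK _) _; rewrite nr_distC.
    apply: (@le_trans _ _ (K * (K + 1)^-1)); last by rewrite ler_pdivrMr // mul1r lerDl.
    by rewrite ler_wpM2l // (le_trans hw).
  have := normcD (mu i w) (mu i (z - w)); rewrite -(dualED (hmu i)) addrCA subrr addr0.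
  move: hz; rewrite -natr1; lra.
have [f hf] := choice step.
pose q := fix q n := if n is m.+1 then f (q m, m) else (0 : E, 1 : R).
have q0 n : 0 < (q n).2.
  by elim: n => [|n IH] /=; [exact: ltr01|have [] := hf (q n, n) IH].
have qs n : [/\ 0 < (q n.+1).2, (q n.+1).2 <= n.+1%:R^-1,
    nr ((q n.+1).1 - (q n).1) + (q n.+1).2 <= (q n).2 &
    exists i, forall x, nr (x - (q n.+1).1) <= (q n.+1).2 -> n%:R <= normc (mu i x)].
  exact: (hf (q n, n) (q0 n)).
have nest n m : (n <= m)%N -> nr ((q m).1 - (q n).1) + (q m).2 <= (q n).2.
  elim: m => [|m IH]; first by rewrite leqn0 => /eqP ->; rewrite subrr /nr normr0 add0r.
  rewrite leq_eqVlt => /orP[/eqP ->|]; first by rewrite subrr /nr normr0 add0r.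
  rewrite ltnS => /IH h; have [_ _ h2 _] := qs m; move: h2 h.
  have := nr_tri (q m).1 (q m.+1).1 (q n).1; lra.
have [x hx] : exists x, forall e : R, 0 < e -> exists N, forall n, (N <= n)%N -> nr (x - (q n.+1).1) <= e.
  apply: (@cauchy_nr_limit (fun n => (q n.+1).1)) => n m nm.
  have [_ h _ _] := qs n; apply: le_trans h; apply: le_trans (nest n.+1 m.+1 nm).
  by rewrite lerDl ltW.
have xq n : nr (x - (q n).1) <= (q n).2.
  apply/ler_addgt0Pr => e e0; have [N hN] := hx e e0.
  have h := hN (maxn N n) (leq_maxl _ _).
  have := nest n (maxn N n).+1 (leqW (leq_maxr _ _)); have := q0 (maxn N n).+1.
  have := nr_tri (q (maxn N n).+1).1 x (q n).1; move: h; lra.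
have [B hB] := pb x.
pose n := (Num.trunc `|B|).+1.
have [_ _ _ [i /(_ x (xq n.+1))]] := qs n.
apply/negP; rewrite -ltNge /=; apply: le_lt_trans (hB i) _.
by apply: le_lt_trans (ler_norm B) _; rewrite truncnS_gt.
Qed.

End UniformBoundedness.

(** * Sufficiency *)

Section Sufficiency.
Variables (R : realType) (S : choiceType) (mul : S -> S -> S) (om : S -> R).
Local Notation C := R[i].
Local Notation Om := (Omega mul om).
Local Notation conv := (conv mul om).
Local Notation X := (S * S)%type.
Hypotheses (wt : weight mul om).

Lemma c0_inj_converges (phi : S -> C) (k : nat -> S) : c0 phi -> injective k ->
  converges (fun n => phi (k n)) 0.
Proof.
move=> p0 ki; have h : c0 (fun n => phi (k n)).
  apply: c0_comp p0 => t; have [[n0 kn0]|nk] := pselect (exists n, k n = t).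
    apply: sub_finite_set (finite_set1 n0) => n /= kn; apply: ki.
    by rewrite kn kn0.
  by rewrite (_ : [set n | _] = set0) // -subset0 => n kn; apply: nk; exists n.
move=> d d0; move/c0P : h => /(_ d d0) /finite_fsetP[J hJ].
exists (\max_(j <- J) j).+1 => n nJ; rewrite subr0 leNgt; apply/negP => hn.
have nJ' : n \in J by have : [set n | d <= normc (phi (k n))] n := ltW hn; rewrite hJ.
by have := leq_bigmax_seq (F := id) n nJ' isT; rewrite leqNgt nJ.
Qed.

(** Existing limits agree with limits along [U], which are multiplicative; hence [L * L'] is the
    limit of the inner limits of the products. *)
Lemma rep_lim_mul0 (U : set_system nat) (x y : nat -> nat -> C) (A B : R) (L L' : C) :
  UltraFilter U -> \oo `<=` U ->
  (forall n m, normc (x n m) <= A) -> (forall n m, normc (y n m) <= B) ->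
  rep_lim x L -> rep_lim y L' ->
  converges (fun n => ulim U (fun m => x n m * y n m)) 0 -> L = 0 \/ L' = 0.
Proof.
move=> UU sU xA yB /rep_limP[l [hl lL]] /rep_limP[l' [hl' lL']] h.
have lA n : normc (l n) <= A.
  by rewrite -(ulim_converges UU sU (hl n)); exact: ulim_le.
have lB n : normc (l' n) <= B.
  by rewrite -(ulim_converges UU sU (hl' n)); exact: ulim_le.
have E : L * L' = 0.
  rewrite -(ulim_converges UU sU lL) -(ulim_converges UU sU lL') -(ulimM UU lA lB).
  rewrite -[RHS](ulim_converges UU sU h); congr ulim; apply/funext => n.
  rewrite (ulimM UU (xA n) (yB n)).
  by rewrite (ulim_converges UU sU (hl n)) (ulim_converges UU sU (hl' n)).
by move/eqP : E; rewrite mulf_eq0 => /orP[] /eqP ->; [left|right].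
Qed.

Variables (E : completeNormedModType C) (lm : (S -> C) -> E -> E) (rm : E -> (S -> C) -> E).
Hypotheses (hb : banach_bimodule mul om lm rm) (hn : normal_dual lm rm).
Implicit Types (a b : S -> C) (x y : E).

Let lmDa a b x : l1 a -> l1 b -> lm (addf a b) x = lm a x + lm b x.
Proof. by case: hb => h *; exact: h. Qed.
Let lmZa c a x : l1 a -> lm (sclf c a) x = c *: lm a x.
Proof. by case: hb => _ [h _] *; exact: h. Qed.
Let lmD a x y : l1 a -> lm a (x + y) = lm a x + lm a y.
Proof. by case: hb => _ [_ [h _]] *; exact: h. Qed.
Let lmZ c a x : l1 a -> lm a (c *: x) = c *: lm a x.
Proof. by case: hb => _ [_ [_ [h _]]] *; exact: h. Qed.
Let rmDa a b x : l1 a -> l1 b -> rm x (addf a b) = rm x a + rm x b.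
Proof. by case: hb => _ [_ [_ [_ [h _]]]] *; exact: h. Qed.
Let rmZa c a x : l1 a -> rm x (sclf c a) = c *: rm x a.
Proof. by case: hb => _ [_ [_ [_ [_ [h _]]]]] *; exact: h. Qed.
Let rmD a x y : l1 a -> rm (x + y) a = rm x a + rm y a.
Proof. by case: hb => _ [_ [_ [_ [_ [_ [h _]]]]]] *; exact: h. Qed.
Let rmZ c a x : l1 a -> rm (c *: x) a = c *: rm x a.
Proof. by case: hb => _ [_ [_ [_ [_ [_ [_ [h _]]]]]]] *; exact: h. Qed.
Let lm_conv a b x : l1 a -> l1 b -> lm (conv a b) x = lm a (lm b x).
Proof. by case: hb => _ [_ [_ [_ [_ [_ [_ [_ [h _]]]]]]]] *; exact: h. Qed.
Let rm_conv a b x : l1 a -> l1 b -> rm x (conv a b) = rm (rm x a) b.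
Proof. by case: hb => _ [_ [_ [_ [_ [_ [_ [_ [_ [h _]]]]]]]]] *; exact: h. Qed.
Let lm_rm a b x : l1 a -> l1 b -> lm a (rm x b) = rm (lm a x) b.
Proof. by case: hb => _ [_ [_ [_ [_ [_ [_ [_ [_ [_ [h _]]]]]]]]]] *; exact: h. Qed.

Let lm_bound : exists2 K : R, 0 <= K & forall a x, l1 a -> nr (lm a x) <= K * n1 a * nr x.
Proof.
case: hb => _ [_ [_ [_ [_ [_ [_ [_ [_ [_ [_ [[K hK] _]]]]]]]]]]].
exists `|K| => // a x la; have sa := iffLR (l1P a) la.
have := hK a x la; rewrite (l1norm_n1 sa) !nrE -!rmorphM lecR => /le_trans; apply.
by rewrite ler_wpM2r ?nr_ge0 // ler_wpM2r ?n1_ge0 // ler_norm.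
Qed.

Let rm_bound : exists2 K : R, 0 <= K & forall a x, l1 a -> nr (rm x a) <= K * n1 a * nr x.
Proof.
case: hb => _ [_ [_ [_ [_ [_ [_ [_ [_ [_ [_ [_ [K hK]]]]]]]]]]]].
exists `|K| => // a x la; have sa := iffLR (l1P a) la.
have := hK a x la; rewrite (l1norm_n1 sa) !nrE -!rmorphM lecR => /le_trans; apply.
by rewrite ler_wpM2r ?nr_ge0 // ler_wpM2r ?n1_ge0 // ler_norm.
Qed.

Let ld s : l1 (dl s : S -> C) := l1_dl R s.

Let rm_dl_bound : exists2 K : R, 0 <= K & forall s x, nr (rm x (dl s)) <= K * nr x.
Proof.
have [K K0 hK] := rm_bound; exists K => // s x; apply: le_trans (hK _ _ (ld s)) _.
by rewrite ler_wpM2r ?nr_ge0 // ler_piMr // n1_dl.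
Qed.

Section Orbit.
Variables (mu : E -> C) (hmu : dualE mu) (x : E).

Lemma rm_linear : l1_linear (fun a => mu (rm x a)).
Proof.
split=> [a b la lb|c a la]; first by rewrite rmDa // (dualED hmu).
by rewrite rmZa // (dualEZ hmu).
Qed.

Lemma lm_linear : l1_linear (fun a => mu (lm a x)).
Proof.
split=> [a b la lb|c a la]; first by rewrite lmDa // (dualED hmu).
by rewrite lmZa // (dualEZ hmu).
Qed.

Let rm_wcont : wcont (fun a => mu (rm x a)). Proof. by case: (hn hmu). Qed.
Let lm_wcont : wcont (fun a => mu (lm a x)). Proof. by case: (hn hmu). Qed.

Lemma rm_c0 : c0 (fun s => mu (rm x (dl s))).
Proof. by case: (wcont_linear rm_linear rm_wcont). Qed.
Lemma lm_c0 : c0 (fun s => mu (lm (dl s) x)).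
Proof. by case: (wcont_linear lm_linear lm_wcont). Qed.
Lemma rm_pair a : l1 a -> mu (rm x a) = pair (fun s => mu (rm x (dl s))) a.
Proof. by case: (wcont_linear rm_linear rm_wcont) => _; apply. Qed.
Lemma lm_pair a : l1 a -> mu (lm a x) = pair (fun s => mu (lm (dl s) x)) a.
Proof. by case: (wcont_linear lm_linear lm_wcont) => _; apply. Qed.
End Orbit.

(** * The coefficients of a derivation *)

Variable D : (S -> C) -> E -> C.
Hypotheses (hD : derivation mul om lm rm D) (cD : wstar_cont D).

Let D_dual a : l1 a -> dualE (D a). Proof. by case: hD => h *; exact: h. Qed.
Let DDa a b x : l1 a -> l1 b -> D (addf a b) x = D a x + D b x.
Proof. by case: hD => _ [h _] *; exact: h. Qed.
Let DZa c a x : l1 a -> D (sclf c a) x = c * D a x.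
Proof. by case: hD => _ [_ [h _]] *; exact: h. Qed.
Let D_conv a b x : l1 a -> l1 b -> D (conv a b) x = D b (rm x a) + D a (lm b x).
Proof. by case: hD => _ [_ [_ h]] *; exact: h. Qed.
Let D_linear x : l1_linear (fun a => D a x).
Proof. by split=> *; [exact: DDa|exact: DZa]. Qed.
Let D_c0 x : c0 (fun s => D (dl s) x).
Proof. by case: (wcont_linear (D_linear x) (cD x)). Qed.
Let D_pair a x : l1 a -> D a x = pair (fun s => D (dl s) x) a.
Proof. by case: (wcont_linear (D_linear x) (cD x)) => _; apply. Qed.

(** [derivation] bounds each [D a] separately. For fixed [x] the values [D (dl s) x] vanish at
    infinity by weak-star continuity, so they are bounded in [s] and uniform boundedness applies. *)
Let D_bound : exists2 K : R, 0 <= K & forall s x, normc (D (dl s) x) <= K * nr x.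
Proof.
apply: (uniform_boundedness (mu := fun s => D (dl s))) => [s|x]; first exact: D_dual.
by have [B _ hB] := c0_bnd (D_c0 x); exists B.
Qed.

Definition coef x : X -> C := fun p => D (dl p.1) (rm x (dl p.2)).

Let coef_bound : exists2 K : R, 0 <= K & forall x, bnd (coef x) (K * nr x).
Proof.
have [K K0 hK] := D_bound; have [L L0 hL] := rm_dl_bound.
exists (K * L) => [|x p]; first exact: mulr_ge0.
by apply: le_trans (hK _ _) _; rewrite -mulrA ler_wpM2l.
Qed.

Let coef_bounded2 x : bounded2 (coef x).
Proof. by have [K K0 hK] := coef_bound; exact: bnd_bounded2 (hK x). Qed.

Let coefD x y p : coef (x + y) p = coef x p + coef y p.
Proof. by rewrite /coef rmD ?(dualED (D_dual (ld p.1))). Qed.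

Let coefZ c x p : coef (c *: x) p = c * coef x p.
Proof. by rewrite /coef rmZ ?(dualEZ (D_dual (ld p.1))). Qed.

Let coef_ract x g h k : coef x (h, mul k g) * Om k g = coef (rm x (dl k)) (h, g).
Proof.
rewrite /coef /= -rm_conv // conv_dl // rmZa //.
by rewrite (dualEZ (D_dual (ld h))) mulrC.
Qed.

(** The derivation rule at [conv (dl h) (dl k)]. The extra term depends on [g] and [h] through
    [mul g h] alone, up to [Omega]; this is the shape that (1) evaluates. *)
Let coef_lact x g h k : coef x (mul h k, g) * Om h k =
  D (dl k) (rm x (dl (mul g h))) * Om g h + coef (lm (dl k) x) (h, g).
Proof.
have := D_conv (rm x (dl g)) (ld h) (ld k); rewrite conv_dl // DZa // mulrC => ->.
by rewrite -rm_conv // conv_dl // rmZa // (dualEZ (D_dual (ld k))) mulrC lm_rm.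
Qed.

Let coef_ulim (U : set_system nat) (gh : nat -> X) : UltraFilter U ->
  dualE (fun x => ulim U (fun m => coef x ((gh m).2, (gh m).1))).
Proof.
move=> UU; have [K K0 hK] := coef_bound.
apply: (@dualE_intro _ _ _ K) => [x y|c x|x].
- rewrite -(ulimD UU (fun m => hK x _) (fun m => hK y _)).
  by congr ulim; apply/funext => m; exact: coefD.
- rewrite -(ulimZ UU c (fun m => hK x _)).
  by congr ulim; apply/funext => m; exact: coefZ.
- by apply: ulim_le => m; exact: hK.
Qed.

Lemma coef_admissible x : admissible mul om (coef x).
Proof.
have [K K0 hK] := coef_bound; have bx := hK x.
have KD y : bnd (coef y) (K * nr y) := hK y.
split; first exact: coef_bounded2.
split=> [s|k gh ki ghi L1 L2 L3 L4 r1 r2 r3 r4].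
  by split; [exact: (rm_c0 (D_dual (ld s)) x)|exact: (D_c0 (rm x (dl s)))].
have [U [UU sU]] := ultraFilterLemma (@eventually_filter).
have n0 := nr_ge0 x; have KE0 := mulr_ge0 K0 n0.
split.
  apply: (rep_lim_mul0 UU sU (fun n m => bx _) (fun n m => normc_Omega wt _ _) r1 r2).
  have := c0_inj_converges (rm_c0 (coef_ulim gh UU) x) ki.
  congr converges; apply/funext => n; congr ulim; apply/funext => m.
  by rewrite coef_ract.
apply: (rep_lim_mul0 UU sU (fun n m => bx _) (fun n m => normc_Omega wt _ _) r3 r4).
pose nu y := ulim U (fun m => coef y ((gh m).2, (gh m).1)).
pose s m := mul (gh m).1 (gh m).2.
pose psi n m : C := D (dl (k n)) (rm x (dl (s m))) * Om (gh m).1 (gh m).2.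
have bpsi n m : normc (psi n m) <= K * nr x.
  rewrite /psi normcM -[leRHS]mulr1 ler_pM ?normc_ge0 ?normc_Omega //.
  exact: (bx (k n, s m)).
have h1 : converges (fun n => ulim U (psi n)) 0.
  (* The extra term depends on [g] and [h] through [s m], and nothing keeps [s] injective. If [s] is
     a constant [t] along [U], decay comes from the outer variable, since [D (dl (k n))] tends to 0
     at the fixed vector [rm x (dl t)]. *)
  have [[t Ut]|nU] := pselect (exists t, U [set m | s m = t]).
    pose w := ulim U (fun m => Om (gh m).1 (gh m).2).
    have := c0_inj_converges (c0Z w (D_c0 (rm x (dl t)))) ki.
    congr converges; apply/funext => n; apply/esym/ulim_unique => d d0.
    have d1 : 0 < d / (K * nr x + 1) by rewrite divr_gt0 // ltr_wpDl.
    apply: filterS (filterI Ut (ulimP UU (fun m => normc_Omega wt (gh m).1 (gh m).2) d1)).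
    move=> m /= [st hw]; rewrite /psi st mulrC -mulrBl normcM mulrC.
    rewrite ler_pdivlMr ?ltr_wpDl // in hw; apply: le_trans hw.
    rewrite mulrC ler_wpM2l ?normc_ge0 // (le_trans (bx (k n, t))) // lerDl //.
  have -> : (fun n => ulim U (psi n)) = fun=> 0; last first.
    by move=> d d0; exists 0%N => n _; rewrite subrr normc0 ltW.
  (* Otherwise [s] leaves every finite set along [U], and normality makes the inner limit vanish
     already for each fixed [n]. *)
  apply/funext => n; apply: ulim_unique => d d0.
  have /c0P/(_ d d0) fin := rm_c0 (D_dual (ld (k n))) x; set J := [set g | _] in fin.
  have [UJ|UJ] := in_ultra_setVsetC (\bigcup_(t in J) [set m | s m = t]) UU.
    by have [t _ Ut] := ultra_bigcup UU fin UJ; case: nU; exists t.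
  apply: filterS UJ => m /= mJ; rewrite subr0 /psi normcM.
  have [h|h] := lerP d (normc (D (dl (k n)) (rm x (dl (s m))))).
    by case: mJ; exists (s m).
  by apply: le_trans (ltW h); rewrite ler_piMr ?normc_ge0 ?normc_Omega.
have h2 : converges (fun n => nu (lm (dl (k n)) x)) 0.
  exact: (c0_inj_converges (lm_c0 (coef_ulim gh UU) x) ki).
move=> d d0; have d2 : 0 < d / 2 by rewrite divr_gt0.
have [N1 hN1] := h1 _ d2; have [N2 hN2] := h2 _ d2.
exists (maxn N1 N2) => n; rewrite geq_max => /andP[/hN1 e1 /hN2 e2].
have -> : ulim U (fun m => coef x (mul (gh m).2 (k n), (gh m).1) * Om (gh m).2 (k n)) =
    ulim U (psi n) + nu (lm (dl (k n)) x).
  rewrite -(ulimD UU (bpsi n) (fun m => KD (lm (dl (k n)) x) _)).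
  by congr ulim; apply/funext => m; rewrite coef_lact.
rewrite !subr0 in e1 e2 *; have := normcD (ulim U (psi n)) (nu (lm (dl (k n)) x)); lra.
Qed.

(** * The implementing functional *)

Variables (e : S -> C) (he : is_unit mul om e) (M : (X -> C) -> C).
Hypotheses (hM : linf_dual M)
  (M1 : forall f : S -> C, c0 f -> M (fun p => f (mul p.1 p.2) * Om p.1 p.2) = pair f e)
  (M2 : forall (k : S) (f : X -> C), admissible mul om f ->
       M (fun p => f (mul p.2 k, p.1) * Om p.2 k - f (p.2, mul k p.1) * Om k p.1) = 0).

Let le1 : l1 e. Proof. by case: he. Qed.
Let convea a : l1 a -> conv e a = a. Proof. by move=> la; case: he => _ /(_ a la)[]. Qed.
Let convae a : l1 a -> conv a e = a. Proof. by move=> la; case: he => _ /(_ a la)[]. Qed.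

Let tcoef x : X -> C := fun p => coef x (p.2, p.1).
Let phi x := M (tcoef x).

Let tcoef_bounded x : bounded2 (tcoef x).
Proof.
by have [K K0 hK] := coef_bound; apply: (@bnd_bounded2 _ _ _ (K * nr x)) => p; exact: hK.
Qed.

Let phiD x y : phi (x + y) = phi x + phi y.
Proof.
by rewrite /phi -(dualD hM) //; congr M; apply/funext => p; exact: coefD.
Qed.

Let phi_dual : dualE phi.
Proof.
have [K K0 hK] := coef_bound; have [L L0 hL] := dual_bound hM.
apply: (@dualE_intro _ _ _ (L * K)) => [x y|c x|x]; first exact: phiD.
  by rewrite /phi -(dualZ hM) //; congr M; apply/funext => p; exact: coefZ.
rewrite -mulrA; apply: hL; last by rewrite mulr_ge0 ?nr_ge0.
by move=> p; exact: hK.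
Qed.

(** This is (2) for [coef x], after both terms are rewritten as coefficients of translates of [x].
    The leftover [q] is a function in [c0] of the product [gh] times [Omega], and (1) evaluates
    [M q] as [D (dl k) (rm x e)]. *)
Let phi_dl k x : D (dl k) (rm x e) + phi (lm (dl k) x) = phi (rm x (dl k)).
Proof.
have pc := rm_c0 (D_dual (ld k)) x; have := M2 k (coef_admissible x).
pose q p := D (dl k) (rm x (dl (mul p.1 p.2))) * Om p.1 p.2 : C.
have -> : (fun p => coef x (mul p.2 k, p.1) * Om p.2 k - coef x (p.2, mul k p.1) * Om k p.1) =
    fun p => (q p + tcoef (lm (dl k) x) p) + (-1) * tcoef (rm x (dl k)) p.
  by apply/funext => p; rewrite coef_lact coef_ract mulN1r.
have [B B0 hB] := c0_bnd pc.
have bq : bounded2 q.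
  apply: (@bnd_bounded2 _ _ _ B).
  by apply: (@bndM_Omega _ _ _ _ wt _ (fun p : X => D (dl k) (rm x (dl (mul p.1 p.2)))) fst snd) => // p; exact: hB.
have bqt : bounded2 (fun p => q p + tcoef (lm (dl k) x) p).
  have /bounded2P[A A0 hA] := tcoef_bounded (lm (dl k) x); have /bounded2P[A' A0' hA'] := bq.
  apply: (@bnd_bounded2 _ _ _ (A' + A)) => p.
  by rewrite (le_trans (normcD _ _)) // lerD.
have bN : bounded2 (fun p => (-1) * tcoef (rm x (dl k)) p).
  have /bounded2P[A A0 hA] := tcoef_bounded (rm x (dl k)).
  by apply: (@bnd_bounded2 _ _ _ A) => p; rewrite mulN1r normc_opp.
rewrite (dualD hM bqt bN) (dualZ hM) // (dualD hM bq) // (M1 pc) -rm_pair //; last exact: D_dual.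
by move=> /eqP; rewrite mulN1r subr_eq0 => /eqP.
Qed.

(** All three terms are [sigma(l^1, c_0)]-continuous in [a], so they are sums over their values at
    point masses. *)
Let phi_l1 a x : l1 a -> D a (rm x e) + phi (lm a x) = phi (rm x a).
Proof.
move=> la; have sa := iffLR (l1P a) la.
rewrite (D_pair _ la) (lm_pair phi_dual _ la) (rm_pair phi_dual _ la).
have [A _ hA] := c0_bnd (D_c0 (rm x e)); have [B _ hB] := c0_bnd (lm_c0 phi_dual x).
rewrite -(pairDl hA hB sa); apply: eq_pair => s; exact: phi_dl.
Qed.

Lemma virtual_diagonal_inner : inner lm rm D.
Proof.
exists (fun x => phi x - D e (lm e x)); split.
  have [K K0 hK] := dualE_bound phi_dual; have [L L0 hL] := dualE_bound (D_dual le1).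
  have [N N0 hN] := lm_bound; have De := D_dual le1.
  apply: (@dualE_intro _ _ _ (K + L * (N * n1 e))) => [x y|c x|x].
  - by rewrite phiD lmD // (dualED De); ring.
  - by rewrite (dualEZ phi_dual) lmZ // (dualEZ De); ring.
  rewrite (le_trans (normcB _ _)) // mulrDl lerD // (le_trans (hL _)) //.
  by rewrite -mulrA ler_wpM2l // hN.
move=> a x la; have De := D_dual le1.
(* The term [D e (lm a x)] is what the correction [- D e (lm e x)] to [phi] has to produce. *)
have h1 : D a x = D a (rm x e) + D e (lm a x).
  by rewrite -{1}(convea la) D_conv.
have h2 : lm e (lm a x) = lm a x by rewrite -lm_conv // convea.
(* On a vector [y] fixed by [e] on both sides, the derivation rule for [e * e = e] reads
   [D e y = D e y + D e y]. *)
have h3 : D e (lm e (rm x a)) = 0.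
  set y := lm e (rm x a).
  have ye : rm y e = y by rewrite /y -lm_rm // -rm_conv // convae.
  have ey : lm e y = y by rewrite /y -lm_conv // convea.
  have := D_conv y le1 le1; rewrite convea // ye ey => /eqP.
  by rewrite -subr_eq subrr eq_sym => /eqP.
by rewrite h2 h3 h1 -(phi_l1 _ la); ring.
Qed.

End Sufficiency.

Theorem theorem5p11 (R : realType) (S : choiceType) (mul : S -> S -> S)
  (om : S -> R) (e : S -> R[i]) :
  associative mul ->
  infinite_set [set: S] ->
  weakly_cancellative mul ->
  weight mul om ->
  is_unit mul om e ->
  connes_amenable mul om <->
  exists M : (S * S -> R[i]) -> R[i],
    linf_dual M /\
    (forall f : S -> R[i], c0 f ->
       M (fun p => f (mul p.1 p.2) * Omega mul om p.1 p.2) = pair f e) /\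
    (forall (k : S) (f : S * S -> R[i]), admissible mul om f ->
       M (fun p => f (mul p.2 k, p.1) * Omega mul om p.2 k
                   - f (p.2, mul k p.1) * Omega mul om k p.1) = 0).
Proof.
move=> mulA inf wc wt he; have [s0 _] := infinite_setN0 inf.
split; first exact: connes_amenable_virtual_diagonal.
move=> [M [hM [M1 M2]]] E lm rm hb hn D hD cD.
exact: (virtual_diagonal_inner wt hb hn hD cD he hM M1 M2).
Qed.
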